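(* Let $\alpha\in\mathbb{C}$, $\alpha\neq\pm1$, and let $L$ be an isotropic line in the complexification $\mathbb{C}^{2n-1,1}$ of $\mathbb{R}^{2n-1,1}$ such that $(\alpha,L)$ is an admissible pair, and let $p_{\alpha,L}$ be the corresponding simple element. Let $F=\Phi_1\begin{pmatrix}0\\ g_2^{-1}\mathbf{c}\end{pmatrix}$ be a flat lift, where $\Phi_\lambda$ is an extended flat frame of a solution of the $U/K=\frac{\mathrm{O}(2n-1,1)}{\mathrm{O}(n)\times\mathrm{O}(n-1,1)}$-system defined by $\mathfrak{a}$, $\Phi_0=\begin{pmatrix}g_1&0\\ 0&g_2\end{pmatrix}$, and $\mathbf{c}\in\mathbb{R}^{n-1,1}$ is a non-zero null vector. Then the dressing action $F\mapsto\tilde F=p_{\alpha,L}\#F$, defined by $$\tilde F:=\Phi_1\,p_{\alpha,\tilde L}^{-1}(1)\,p_{\alpha,\tilde L}(0)\,\Phi_1^{-1}F,\qquad \tilde L(x)=\Phi_\alpha(x)^{-1}L,$$ is a Ribaucour $n$-hyperbola congruence in $\mathcal{L}^{2n-1,1}$ if $\alpha$ is real, and a Ribaucour $n$-sphere congruence in $\mathcal{L}^{2n-1,1}$ if $\alpha$ is pure imaginary. Moreover: 1. $\tilde F-F\in\begin{pmatrix}\mathrm{I}_n&0\\ 0&\alpha^{-1}\mathrm{I}_n\end{pmatrix}\mathcal{L}^{2n-1,1}$, and $\tilde{\mathbf{e}}_i-\mathbf{e}_i$ is parallel to $\tilde F-F$ for all $1\le i\le n$, where the $\mathbf{e}_i$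 and $\tilde{\mathbf{e}}_i$ are principal curvature directions for $F$ and $\tilde F$ respectively. 2. If $F$ is a flat lift of a conformally flat immersion $f$ in $S^{2n-2}$, then $\tilde F$ is a flat lift of another conformally flat immersion $\tilde f$ in $S^{2n-2}$, and the transform $f\to\tilde f$ is a Ribaucour transform in $S^{2n-2}$.
   Context: $J=\mathrm{I}_{n-1,1}=\operatorname{diag}(1,\dots,1,-1)$, $\mathrm{I}_n$ is the $n\times n$ identity; $\mathbb{R}^{m,1}$ is $\mathbb{R}^{m+1}$ with $(x,y)=x^T\mathrm{I}_{m,1}y$ (extended complex-bilinearly); $\mathcal{L}^{2n-1,1}$ is the light-cone $\{(x,x)=0\}$ of $\mathbb{R}^{2n-1,1}$. Fix $t_0$ with $(t_0,t_0)=-1$; $S^{2n-2}$ is the unit sphere in the Euclidean space $t_0^\perp$. An immersion $f$ is conformally flat if $e^{2u}\mathrm{I}_f$ is flat for some smooth function $u$. A flat lift of $f$ is a map $F$ into $\mathcal{L}^{2n-1,1}$ with $f+t_0\in\langle F\rangle$ and flat induced metric. Principal curvature directions (lines of curvature) of an immersion with flat normal bundle are the common eigendirections of all shape operators. $U/K$-system: $\rho=\operatorname{diag}(\mathrm{I}_n,-\mathrm{I}_n)$, $\tau(g)=\rho g\rho^{-1}$, $\mathfrak{p}=\left\{\begin{pmatrix}0&\eta^TJ\\ -\eta&0\end{pmatrix}\right\}\subset\mathfrak{o}(2n-1,1)$, $a_i=\begin{pmatrix}0&e_{ii}J\\ -e_{ii}&0\end{pmatrix}$ with $e_{ii}$ elementary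 $n\times n$ matrices, $\mathfrak{a}=\langle a_1,\dots,a_n\rangle$, $\perp$ for the Killing form. For $\Xi:\mathbb{R}^n\to\mathfrak{a}^\perp\cap\mathfrak{p}$ the system is $[a_i,\Xi_{x_j}]-[a_j,\Xi_{x_i}]-[[a_i,\Xi],[a_j,\Xi]]=0$, $i\neq j$. An extended flat frame is a solution $\Phi_\lambda\in\mathrm{O}(2n-1,1,\mathbb{C})$ of $\Phi_\lambda^{-1}d\Phi_\lambda=\sum_i(\lambda a_i+[a_i,\Xi])dx_i$ with $\overline{\Phi_\lambda}=\Phi_{\bar\lambda}$, $\tau\Phi_\lambda=\Phi_{-\lambda}$. $(\alpha,L)$ is admissible if $L=\ell\otimes\mathbb{C}$ for an isotropic real line $\ell$ and either $\alpha\in\mathbb{R}\setminus\{0\}$, $\ell\subset\mathbb{R}^{2n-1,1}$, or $\alpha\in i(\mathbb{R}\setminus\{0\})$, $\ell\subset\mathbb{R}^n\oplus i\mathbb{R}^{n-1,1}$; it is also required that $\rho L\neq L$. The simple element is $p_{\alpha,L}(\lambda)=\frac{\lambda-\alpha}{\lambda+\alpha}\pi_L+\pi_{(L\oplus\rho L)^\perp}+\frac{\lambda+\alpha}{\lambda-\alpha}\pi_{\rho L}$, with projections for $\mathbb{C}^{2n}=L\oplus(L\oplus\rho L)^\perp\oplus\rho L$. The transform $\tilde F$ is defined at the points $x$ where $\rho\tilde L(x)\neq\tilde L(x)$. The directions $\mathbf{e}_i$ and $\tilde{\mathbf{e}}_i$ are the first $n$ columns of $\Phi_1$ and of $\Phi_1p_{\alpha,\tilde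 L}^{-1}(1)$ respectively. Congruences: an $n$-sphere in $\mathbb{R}^{2n-1,1}$ is a set $\mathbf{c}_0+\{x\in V:(x,x)=r^2\}$, where $V$ is a space-like $(n+1)$-dimensional linear subspace, $\mathbf{c}_0\in V^\perp$, $r$ constant; an $n$-hyperbola is a set $\mathbf{c}_0+\{x\in V:(x,x)=-r^2\}$ with $V$ a Lorentzian $(n+1)$-dimensional linear subspace, $\mathbf{c}_0\in V^\perp$. They are in $\mathcal{L}^{2n-1,1}$ if contained in it. A map $\phi:\mathcal{M}\to\mathcal{M}^*$ between $n$-dimensional submanifolds is an $n$-sphere ($n$-hyperbola) congruence if for each $p\in\mathcal{M}$ there is an $n$-sphere ($n$-hyperbola) $C(p)$ to which $\mathcal{M}$ is tangent at $p$ and $\mathcal{M}^*$ is tangent at $\phi(p)$. It is Ribaucour if moreover $\phi$ maps lines of curvature to lines of curvature. A Ribaucour transform in $S^{2n-2}$ is a Ribaucour congruence of $n$-spheres contained in $S^{2n-2}$. Here $\phi$ is $F(x)\mapsto\tilde F(x)$ (resp. $f(x)\mapsto\tilde f(x)$).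
   Formalization: The inclusion in 1 is stated as F̃−F ∈ Φ₁·diag(I, α⁻¹I)·(light-cone), using the real form Rⁿ⊕iRⁿ⁻¹·¹ if α is imaginary. The congruences, 2 and ''ẽ_i principal'' assume F̃ is an immersion; the sphere congruence, f̃≠f and the Ribaucour claim in 2 also assume F̃≠F for imaginary α. *)

(* Defs.v *)
From HB Require Import structures.
From mathcomp Require Import all_boot all_order all_algebra.
From mathcomp Require Import complex.
From mathcomp Require Import all_classical all_reals all_analysis.

Set Implicit Arguments.
Unset Strict Implicit.
Unset Printing Implicit Defensive.

Import Order.TTheory GRing.Theory Num.Theory.
Import numFieldNormedType.Exports.

Local Open Scope classical_set_scope.
Local Open Scope ring_scope.

(* Points of R^n and tangent vectors of R^n are columns 'cV[R]_n, and
   R^{2n-1,1} is 'cV[R]_(n + n), split as R^n (+) R^{n-1,1}. *)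

Definition lorentz (K : pzRingType) (m : nat) : 'M[K]_m :=
  diag_mx (\row_(i < m) (if i.+1 == m then -1 else 1)).

Definition bil (K : pzRingType) (m : nat) (x y : 'cV[K]_m) : K :=
  (x^T *m lorentz K m *m y) 0 0.

Definition lightcone (K : pzRingType) (m : nat) : set 'cV[K]_m :=
  [set x | bil x x = 0].

Definition orthv (K : fieldType) (m : nat) (U : {vspace 'cV[K]_m}) :
    {vspace 'cV[K]_m} :=
  (\bigcap_(u <- vbasis U) lker (linfun (mulmx (u^T *m lorentz K m))))%VS.

Lemma mem_orthv (K : fieldType) (m : nat) (U : {vspace 'cV[K]_m}) y :
  reflect (forall u, u \in U -> bil u y = 0) (y \in orthv U).
Proof.
have kerE (u : 'cV[K]_m) :
    (y \in lker (linfun (mulmx (u^T *m lorentz K m)))) = (bil u y == 0).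
  rewrite memv_ker lfunE /=; rewrite /bil; apply/eqP/eqP => [->|h].
    by rewrite mxE.
  by apply/matrixP => i j; rewrite !ord1 h mxE.
have bilZ a (v : 'cV[K]_m) : bil (a *: v) y = a * bil v y.
  have trZ : (a *: v)^T = a *: v^T by apply/matrixP => i j; rewrite !mxE.
  by rewrite /bil trZ -!scalemxAl mxE.
apply: (iffP idP) => [yU u /coord_vbasis -> | h].
  have -> : bil (\sum_(i < \dim U) coord (vbasis U) i u *: (vbasis U)`_i) y =
            \sum_(i < \dim U) coord (vbasis U) i u * bil (vbasis U)`_i y.
    rewrite /bil (raddf_sum (@trmx K m 1)) !mulmx_suml summxE.
    by apply: eq_bigr => i _; exact: bilZ.
  rewrite big1 // => i _.
  have bi : (vbasis U)`_i \in tval (vbasis U) by rewrite mem_nth ?size_tuple.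
  suff /eqP -> : bil (vbasis U)`_i y == 0 by rewrite mulr0.
  rewrite -kerE; apply: subvP yU.
  rewrite /orthv big_tnth.
  have [j ->] : exists j, (vbasis U)`_i = tnth (in_tuple (vbasis U)) j.
    have hi : (i < size (vbasis U))%N by rewrite size_tuple.
    by exists (Ordinal hi); rewrite (tnth_nth 0).
  exact: bigcapv_inf.
rewrite /orthv big_tnth memvE; apply/subv_bigcapP => j _.
by rewrite -memvE kerE h // vbasis_mem // mem_tnth.
Qed.

Definition rho (K : pzRingType) (n : nat) : 'M[K]_(n + n) :=
  block_mx 1%:M 0 0 (- 1%:M).

Definition mximg (K : fieldType) (m : nat) (A : 'M[K]_m)
    (U : {vspace 'cV[K]_m}) : {vspace 'cV[K]_m} :=
  (linfun (mulmx A) @: U)%VS.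

Section RealComplex.
Variables (R : realType) (p q : nat).

Definition toC (A : 'M[R]_(p, q)) : 'M[R[i]]_(p, q) := map_mx (real_complex R) A.
Definition reM (A : 'M[R[i]]_(p, q)) : 'M[R]_(p, q) := map_mx (@complex.Re R) A.
Definition imM (A : 'M[R[i]]_(p, q)) : 'M[R]_(p, q) := map_mx (@complex.Im R) A.

End RealComplex.

Section Calculus.
Variables (R : realType) (n : nat).
Local Notation E := 'cV[R]_n.

Definition evec (i : 'I_n) : E := delta_mx i 0.

Definition iter_partial (W : normedModType R) (s : seq 'I_n) (F : E -> W) :
    E -> W :=
  foldr (fun i G => fun x => 'D_(evec i) G x) F s.

Definition smooth_on (W : normedModType R) (D : set E) (F : E -> W) : Prop :=
  forall (s : seq 'I_n) (x : E), D x -> differentiable (iter_partial s F) x.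

Definition smooth_onC (p q : nat) (D : set E) (A : E -> 'M[R[i]]_(p, q)) : Prop :=
  smooth_on D (fun x => reM (A x)) /\ smooth_on D (fun x => imM (A x)).

Definition partialC (p q : nat) (i : 'I_n) (A : E -> 'M[R[i]]_(p, q)) (x : E) :
    'M[R[i]]_(p, q) :=
  toC ('D_(evec i) (fun y => reM (A y)) x)
  + Complex 0 1 *: toC ('D_(evec i) (fun y => imM (A y)) x).

(* [christoffel g x k i j] is Gamma^k_{ij}. *)
Definition christoffel (g : E -> 'M[R]_n) (x : E) (k i j : 'I_n) : R :=
  2^-1 * \sum_(l < n) invmx (g x) k l *
    ('D_(evec i) (fun y => g y j l) x + 'D_(evec j) (fun y => g y i l) x
     - 'D_(evec l) (fun y => g y i j) x).

(* [riemann g x l k i j] is the component of R(d_i, d_j) d_k along d_l. *)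
Definition riemann (g : E -> 'M[R]_n) (x : E) (l k i j : 'I_n) : R :=
  'D_(evec i) (fun y => christoffel g y l j k) x
  - 'D_(evec j) (fun y => christoffel g y l i k) x
  + \sum_(m < n) (christoffel g x l i m * christoffel g x m j k
                  - christoffel g x l j m * christoffel g x m i k).

Definition metric_on (D : set E) (g : E -> 'M[R]_n) : Prop :=
  smooth_on D g /\
  forall x, D x -> (g x)^T = g x /\
    forall X : E, X != 0 -> 0 < (X^T *m g x *m X) 0 0.

Definition flat_metric_on (D : set E) (g : E -> 'M[R]_n) : Prop :=
  metric_on D g /\ forall x, D x -> forall l k i j, riemann g x l k i j = 0.

End Calculus.

Section Submanifolds.
Variables (R : realType) (n : nat).
Local Notation E := 'cV[R]_n.
Local Notation V := 'cV[R]_(n + n).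

Definition immersive_on (D : set E) (F : E -> V) : Prop :=
  forall x, D x -> forall X : E, 'D_X F x = 0 -> X = 0.

Definition immersion_on (D : set E) (F : E -> V) : Prop :=
  smooth_on D F /\ immersive_on D F.

Definition first_form (F : E -> V) (x : E) : 'M[R]_n :=
  \matrix_(i, j) bil ('D_(evec R i) F x) ('D_(evec R j) F x).

Definition second_form (F : E -> V) (x : E) (xi : V) : 'M[R]_n :=
  \matrix_(i, j)
    bil ('D_(evec R i) (fun y => 'D_(evec R j) F y) x) xi.

(* In coordinates, from (A_xi X, Y) = (D_X D_Y F, xi). *)
Definition shape_op (F : E -> V) (x : E) (xi : V) : 'M[R]_n :=
  invmx (first_form F x) *m second_form F x xi.

Definition sphere (t0 : V) : set V := [set y | bil y t0 = 0 /\ bil y y = 1].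

(* An ambient manifold N inside R^{2n-1,1} enters only through its tangent
   spaces y |-> T_y N. *)
Definition tan_full (_ : V) : set V := setT.
Definition tan_sphere (t0 y : V) : set V :=
  [set v | bil v t0 = 0 /\ bil v y = 0].

Definition normal_at (TN : V -> set V) (F : E -> V) (x : E) : set V :=
  [set xi | TN (F x) xi /\ forall X : E, bil xi ('D_X F x) = 0].

(* X is a coordinate vector: the direction in the submanifold is dF_x(X). *)
Definition principal_at (TN : V -> set V) (F : E -> V) (x X : E) : Prop :=
  X != 0 /\
  forall xi, normal_at TN F x xi ->
    exists kappa : R, shape_op F x xi *m X = kappa *: X.

(* Every normal vector extends locally to a normal field that is parallel for
   the normal connection, i.e. whose derivatives have no normal component. *)
Definition flat_normal_bundle (TN : V -> set V) (D : set E) (F : E -> V) : Prop :=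
  forall x xi0, D x -> normal_at TN F x xi0 ->
  exists2 xi : E -> V, xi x = xi0 &
    \forall y \near x,
      [/\ differentiable xi y, normal_at TN F y (xi y) &
          forall (X : E) (nu : V), normal_at TN F y nu -> bil ('D_X xi y) nu = 0].

Definition conformally_flat_on (D : set E) (f : E -> V) : Prop :=
  exists u : E -> R, smooth_on D (u : E -> R^o) /\
    flat_metric_on D (fun x => expR (2 * u x) *: first_form f x).

Definition flat_lift_on (D : set E) (F : E -> V) : Prop :=
  [/\ smooth_on D F, forall x, D x -> lightcone (F x) &
      flat_metric_on D (first_form F)].

End Submanifolds.

Section Congruences.
Variables (R : realType) (n : nat).
Local Notation E := 'cV[R]_n.
Local Notation V := 'cV[R]_(n + n).

(* The set center + {y in dirs | (y, y) = level}. *)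
Record quadric := Quadric
  { center : V; dirs : {vspace V}; level : R }.

Definition carrier (C : quadric) : set V :=
  [set p | p - center C \in dirs C /\
           bil (p - center C) (p - center C) = level C].

Definition tan_quadric (C : quadric) (p : V) : set V :=
  [set v | v \in dirs C /\ bil v (p - center C) = 0].

Definition spacelike (U : {vspace V}) : Prop :=
  forall y, y \in U -> y != 0 -> 0 < bil y y.

(* Signature (dim U - 1, 1). *)
Definition lorentzian (U : {vspace V}) : Prop :=
  exists t, [/\ t \in U, bil t t < 0 &
    forall y, y \in U -> bil t y = 0 -> y != 0 -> 0 < bil y y].

Definition is_sphere (C : quadric) : Prop :=
  [/\ \dim (dirs C) = n.+1, spacelike (dirs C), center C \in orthv (dirs C) &
      exists2 r : R, 0 < r & level C = r ^+ 2].

Definition is_hyperbola (C : quadric) : Prop :=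
  [/\ \dim (dirs C) = n.+1, lorentzian (dirs C), center C \in orthv (dirs C) &
      exists2 r : R, 0 < r & level C = - r ^+ 2].

Definition tangent_to (C : quadric) (F : E -> V) (x : E) : Prop :=
  carrier C (F x) /\
  [set v | exists X : E, v = 'D_X F x] = tan_quadric C (F x).

Definition congruence (isC : quadric -> Prop) (S : set V) (D : set E)
    (F Ft : E -> V) : Prop :=
  forall x, D x -> exists C : quadric,
    [/\ isC C, carrier C `<=` S, tangent_to C F x & tangent_to C Ft x].

(* Lines of curvature are those of immersions with flat normal bundle, so the
   flatness of both normal bundles in the ambient N is part of the definition. *)
Definition ribaucour (TN : V -> set V) (isC : quadric -> Prop) (S : set V)
    (D : set E) (F Ft : E -> V) : Prop :=
  [/\ immersion_on D F /\ immersion_on D Ft,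
      flat_normal_bundle TN D F /\ flat_normal_bundle TN D Ft,
      congruence isC S D F Ft &
      forall x, D x -> forall X : E,
        principal_at TN F x X -> principal_at TN Ft x X].

Definition ribaucour_hyperbola_lightcone :=
  ribaucour (@tan_full R n) is_hyperbola (@lightcone R (n + n)).
Definition ribaucour_sphere_lightcone :=
  ribaucour (@tan_full R n) is_sphere (@lightcone R (n + n)).
Definition ribaucour_sphere (t0 : V) :=
  ribaucour (tan_sphere t0) is_sphere (sphere t0).

Definition conformally_flat_immersion (t0 : V) (D : set E) (f : E -> V) : Prop :=
  [/\ immersion_on D f, forall x, D x -> sphere t0 (f x) &
      conformally_flat_on D f].

Definition flat_lift_of (t0 : V) (D : set E) (F f : E -> V) : Prop :=
  flat_lift_on D F /\ forall x, D x -> f x + t0 \in <[F x]>%VS.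

Definition parallel (u v : V) : Prop :=
  exists a b : R, (a, b) != (0, 0) /\ a *: u = b *: v.

End Congruences.

Section System.
Variables (R : realType) (n : nat).
Local Notation E := 'cV[R]_n.
Local Notation M := 'M[R]_(n + n).

Definition lie (X Y : M) : M := X *m Y - Y *m X.

(* The rows of [so_basis] are the vectorisations of a basis of o(2n-1,1). *)
Definition so_ker : 'M[R]_((n + n) * (n + n)) :=
  kermx (lin_mx (fun X : M => X^T *m lorentz R (n + n) + lorentz R (n + n) *m X)).
Definition so_basis := row_base so_ker.

(* Matrix of ad X on o(2n-1,1) in the basis [so_basis]. *)
Definition ad_mx (X : M) : 'M[R]_(\rank so_ker) :=
  so_basis *m lin_mx (fun Y : M => lie X Y) *m pinvmx so_basis.

Definition killing (X Y : M) : R := \tr (ad_mx X *m ad_mx Y).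

Definition pmx (eta : 'M[R]_n) : M :=
  block_mx 0 (eta^T *m lorentz R n) (- eta) 0.

Definition amx (i : 'I_n) : M := pmx (delta_mx i i).

Definition perp_a_cap_p : set M :=
  [set X | (exists eta, X = pmx eta) /\ forall i, killing X (amx i) = 0].

Definition UK_solution (Xi : E -> M) : Prop :=
  [/\ smooth_on setT Xi, forall x, perp_a_cap_p (Xi x) &
      forall i j, i != j -> forall x,
        lie (amx i) ('D_(evec R j) Xi x) - lie (amx j) ('D_(evec R i) Xi x)
        - lie (lie (amx i) (Xi x)) (lie (amx j) (Xi x)) = 0].

Definition extended_flat_frame (Xi : E -> M)
    (Phi : R[i] -> E -> 'M[R[i]]_(n + n)) : Prop :=
  [/\ forall l, smooth_onC setT (Phi l),
      forall l x, (Phi l x)^T *m lorentz _ (n + n) *m Phi l x = lorentz _ (n + n),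
      forall l x i, invmx (Phi l x) *m partialC i (Phi l) x =
                    l *: toC (amx i) + toC (lie (amx i) (Xi x)),
      forall l x, map_mx conjc (Phi l x) = Phi (conjc l) x &
      forall l x, rho _ n *m Phi l x *m invmx (rho _ n) = Phi (- l) x].

End System.

Section Dressing.
Variables (R : realType) (n : nat).
Local Notation E := 'cV[R]_n.
Local Notation C := R[i].
Local Notation VC := 'cV[C]_(n + n).

(* R^{2n-1,1} if alpha is real, R^n (+) i R^{n-1,1} if alpha is imaginary. *)
Definition real_form (alpha : C) : set VC :=
  [set y | (complex.Im alpha = 0 /\
              exists w z : 'cV[R]_n, y = toC (col_mx w z)) \/
           (complex.Re alpha = 0 /\
              exists w z : 'cV[R]_n,
                y = col_mx (toC w) (Complex 0 1 *: toC z))].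

Definition admissible (alpha : C) (L : {vspace VC}) : Prop :=
  [/\ alpha != 0,
      exists l : VC, [/\ real_form alpha l, l != 0, bil l l = 0 & L = <[l]>%VS] &
      mximg (rho C n) L != L].

Definition simple_elt (alpha : C) (L : {vspace VC}) (lambda : C) : 'End(VC) :=
  let rL := mximg (rho C n) L in
  let P := orthv (L + rL) in
  ((lambda - alpha) / (lambda + alpha)) *: daddv_pi L (P + rL)
  + daddv_pi P (L + rL)
  + ((lambda + alpha) / (lambda - alpha)) *: daddv_pi rL (L + P).

Variables (Phi : C -> E -> 'M[C]_(n + n)) (alpha : C) (L : {vspace VC}).

Definition Ltilde (x : E) : {vspace VC} := mximg (invmx (Phi alpha x)) L.

(* The dressed map and the first columns of Phi_1 p^{-1}(1) are computed in
   C^{2n}; [dressing] and [etilde] are their real parts. *)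
Definition dressingC (F : E -> 'cV[R]_(n + n)) (x : E) : VC :=
  Phi 1 x *m ((simple_elt alpha (Ltilde x) 1)^-1%VF
    (simple_elt alpha (Ltilde x) 0 (invmx (Phi 1 x) *m toC (F x)))).

Definition dressing (F : E -> 'cV[R]_(n + n)) (x : E) : 'cV[R]_(n + n) :=
  reM (dressingC F x).

Definition edir (i : 'I_n) (x : E) : 'cV[R]_(n + n) :=
  reM (col (lshift n i) (Phi 1 x)).

Definition etildeC (i : 'I_n) (x : E) : VC :=
  Phi 1 x *m ((simple_elt alpha (Ltilde x) 1)^-1%VF (delta_mx (lshift n i) 0)).

Definition etilde (i : 'I_n) (x : E) : 'cV[R]_(n + n) := reM (etildeC i x).

Definition frame_lift (g2 : E -> 'M[R]_n) (c : 'cV[R]_n) (x : E) :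
    'cV[R]_(n + n) :=
  reM (Phi 1 x) *m col_mx 0 (invmx (g2 x) *m c).

End Dressing.

(* Main.v *)
Require Import Defs.
From mathcomp Require Import all_boot all_order all_algebra.
From mathcomp Require Import complex.
From mathcomp Require Import all_classical all_reals all_analysis.
From mathcomp Require Import ring lra.
Import Order.TTheory GRing.Theory Num.Theory.
Import numFieldNormedType.Exports.
Local Open Scope classical_set_scope.
Local Open Scope ring_scope.

Set Implicit Arguments.
Unset Strict Implicit.
Unset Printing Implicit Defensive.

(** Dressing by a simple element turns out to be a reflection, and a reflection
    of this kind is a Ribaucour transformation.

    At each point the null vector [Phi alpha^-1 l] that spans [Ltilde] is of the
    form [(w, alpha z)] with [w] and [z] real ([spec_qE], [mv_col]). Put
    [q = (w, z)] and [Q = Phi_1 q]. On the first factor of the splitting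
    [p(1)^-1] is, and on the second one [p(1)^-1 p(0)] is, the reflection in the
    orthogonal complement of [q] ([simple_elt_upper], [simple_elt_lower]).
    Therefore the transform of [F] and the transformed directions are the
    reflections of [F] and of the [e_i] in the orthogonal complement of [Q]
    ([dressingC_reflect], [etildeC_reflect]). In particular all the differences
    are multiples of [Q = Phi_1 diag(1, alpha^-1) Phi_alpha^-1 l]. Comparing the
    equations of [Phi_1] and [Phi_alpha] shows that [d_i Q] is parallel to [e_i]
    ([spec_Q_derive]).

    The geometry of [F] is carried by a frame [e, N] with [d_i N = e_i K_i]
    ([parallel_frame]), where [N = Phi_1 (0; g2^-1)] and [F = N c]. For every
    such frame and [c] with nonvanishing [K c], the [e_i] are the curvature
    directions of [N c], the fields [N b] are parallel normal fields, and by the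
    Gauss equation the metric is flat ([frame_flat_metric]). As [d_i Q] is
    parallel to [e_i], the reflected frame is of the same kind
    ([reflected_frame]), so that all of this holds for the transform too.

    The quadric through [F x] with directions spanned by the [e_i] and [Q],
    tangent there to the [e_i], is symmetric under the reflection; hence it
    contains and is tangent to both submanifolds ([lightcone_quadric]), provided
    that [(F, Q)] does not vanish. The part of [Q] orthogonal to the [e_i] has
    norm [(z, z) = - (w . w) / alpha^2], which makes the quadric a hyperbola for
    real [alpha] and a sphere for imaginary [alpha].

    Finally [f + t0 = - F / (F, t0)], and similarly for the transform, which
    yields conformally flat immersions with projected curvature directions. The
    projected directions of the two immersions differ by multiples of the
    difference of the immersions, and the same quadric construction in the
    sphere gives the congruence ([spherical_ribaucour]). *)

(** * Derivatives of matrix valued maps *)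

Section MatrixDerivatives.
Variables (R : realType) (V : normedModType R).
Implicit Types x v : V.

Lemma is_derive_mxP p q (A : V -> 'M[R]_(p, q)) x v dA :
  is_derive x v A dA <->
  forall i j, is_derive x v (fun y => A y i j : R) (dA i j).
Proof.
split=> [dAx i j|dAx].
  have [dA1 dA2] := dAx; have /derivable_mxP dAij := dA1.
  apply: DeriveDef; first exact: dAij.
  by rewrite -dA2 derive_mx // mxE.
have dA1 : derivable A x v.
  by apply/derivable_mxP => i j; have [] := dAx i j.
apply: DeriveDef => //; rewrite derive_mx //; apply/matrixP => i j.
by rewrite mxE; have [] := dAx i j.
Qed.

Lemma is_derive_sumf (I : Type) (r : seq I) (h : I -> V -> R) x v dh :
  (forall i, is_derive x v (h i) (dh i)) ->
  is_derive x v (fun y => \sum_(i <- r) h i y) (\sum_(i <- r) dh i).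
Proof.
move=> dhx; elim: r => [|i r IHr].
  rewrite big_nil; have -> : (fun y => \sum_(i <- [::]) h i y) = cst 0.
    by apply/funext => y; rewrite big_nil.
  exact: is_derive_cst.
rewrite big_cons.
have -> : (fun y => \sum_(j <- i :: r) h j y) =
          h i + (fun y => \sum_(j <- r) h j y).
  by apply/funext => y; rewrite big_cons.
exact: is_deriveD.
Qed.

Lemma is_deriveMf (f g : V -> R) x v df dg :
  is_derive x v f df -> is_derive x v g dg ->
  is_derive x v (fun y => f y * g y) (df * g x + f x * dg).
Proof.
move=> fx gx; apply: is_derive_eq (is_deriveM fx gx) _.
by rewrite /GRing.scale /= addrC [df * _]mulrC.
Qed.

Lemma is_deriveDf (W : normedModType R) (f g : V -> W) x v df dg :
  is_derive x v f df -> is_derive x v g dg ->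
  is_derive x v (fun y => f y + g y) (df + dg).
Proof. by move=> fx gx; exact: is_deriveD. Qed.

Lemma is_deriveBf (W : normedModType R) (f g : V -> W) x v df dg :
  is_derive x v f df -> is_derive x v g dg ->
  is_derive x v (fun y => f y - g y) (df - dg).
Proof. by move=> fx gx; exact: is_deriveB. Qed.

Lemma is_deriveVf (f : V -> R) x v df : f x != 0 ->
  is_derive x v f df ->
  is_derive x v (fun y => (f y)^-1) (- df / (f x) ^+ 2).
Proof.
move=> f0 [f1 f2]; apply: DeriveDef; first exact: derivableV.
by rewrite deriveV // f2 /GRing.scale /= mulrC mulNr mulrN.
Qed.

Lemma is_derive_cstf (W : normedModType R) (w : W) x v :
  is_derive x v (fun=> w) 0.
Proof. exact: is_derive_cst. Qed.

Lemma is_derive_mulmx p q r (A : V -> 'M[R]_(p, q)) (B : V -> 'M[R]_(q, r))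
    x v dA dB :
  is_derive x v A dA -> is_derive x v B dB ->
  is_derive x v (fun y => A y *m B y) (dA *m B x + A x *m dB).
Proof.
move=> /is_derive_mxP Ax /is_derive_mxP Bx; apply/is_derive_mxP => i j.
rewrite !mxE -big_split /=.
have -> : (fun y => (A y *m B y) i j) = (fun y => \sum_k A y i k * B y k j).
  by apply/funext => y; rewrite mxE.
by apply: is_derive_sumf => k; exact: is_deriveMf.
Qed.

Lemma is_derive_tr p q (A : V -> 'M[R]_(p, q)) x v dA :
  is_derive x v A dA -> is_derive x v (fun y => (A y)^T) dA^T.
Proof.
move=> /is_derive_mxP Ax; apply/is_derive_mxP => i j.
rewrite mxE; have -> : (fun y => (A y)^T i j) = (fun y => A y j i).
  by apply/funext => y; rewrite mxE.
exact: Ax.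
Qed.

Lemma is_derive_scalemx p q (k : V -> R) (A : V -> 'M[R]_(p, q)) x v dk dA :
  is_derive x v k dk -> is_derive x v A dA ->
  is_derive x v (fun y => k y *: A y) (dk *: A x + k x *: dA).
Proof.
move=> kx /is_derive_mxP Ax; apply/is_derive_mxP => i j.
rewrite !mxE; have -> : (fun y => (k y *: A y) i j) = (fun y => k y * A y i j).
  by apply/funext => y; rewrite mxE.
exact: is_deriveMf.
Qed.

Lemma is_derive_mulmxr p q r (A : V -> 'M[R]_(p, q)) (B : 'M[R]_(q, r)) x v dA :
  is_derive x v A dA -> is_derive x v (fun y => A y *m B) (dA *m B).
Proof.
move=> Ax; apply: is_derive_eq (is_derive_mulmx Ax (is_derive_cstf B x v)) _.
by rewrite mulmx0 addr0.
Qed.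

Lemma is_derive_mulmxl p q r (A : 'M[R]_(p, q)) (B : V -> 'M[R]_(q, r)) x v dB :
  is_derive x v B dB -> is_derive x v (fun y => A *m B y) (A *m dB).
Proof.
move=> Bx; apply: is_derive_eq (is_derive_mulmx (is_derive_cstf A x v) Bx) _.
by rewrite mul0mx add0r.
Qed.

Lemma is_derive_bil m (f g : V -> 'cV[R]_m) x v df dg :
  is_derive x v f df -> is_derive x v g dg ->
  is_derive x v (fun y => bil (f y) (g y)) (bil df (g x) + bil (f x) dg).
Proof.
move=> fx gx.
have /is_derive_mxP /(_ 0 0) :=
  is_derive_mulmx (is_derive_mulmxr (lorentz R m) (is_derive_tr fx)) gx.
by rewrite mxE.
Qed.

Lemma is_derive_uniq (W : normedModType R) (f : V -> W) x v d1 d2 :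
  is_derive x v f d1 -> is_derive x v f d2 -> d1 = d2.
Proof. by move=> [_ <-] [_ <-]. Qed.

Lemma is_derive_near (W : normedModType R) (D : set V) (f g : V -> W) x v df :
  open D -> D x -> (forall y, D y -> f y = g y) ->
  is_derive x v f df -> is_derive x v g df.
Proof.
move=> oD Dx fg; apply: near_eq_is_derive.
by have := open_nbhs_nbhs (conj oD Dx); apply: filterS => y /fg.
Qed.

Lemma derive_near (W : normedModType R) (D : set V) (f g : V -> W) x v :
  open D -> D x -> (forall y, D y -> f y = g y) -> 'D_v f x = 'D_v g x.
Proof.
move=> oD Dx fg; apply: near_eq_derive.
by have := open_nbhs_nbhs (conj oD Dx); apply: filterS => y /fg.
Qed.

Lemma differentiable_near (W : normedModType R) (D : set V) (f g : V -> W) x :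
  open D -> D x -> (forall y, D y -> f y = g y) ->
  differentiable f x -> differentiable g x.
Proof.
move=> oD Dx fg /diff_locallyP [dc df].
have Dn := open_nbhs_nbhs (conj oD Dx).
have Dn0 : \forall h \near (0 : V), D (h + x).
  by rewrite (near_shift x 0) /=; apply: filterS Dn => y; rewrite /= sub0r addrNK.
have dg : g \o shift x = cst (g x) + 'd f x +o_ (0 : V) id.
  apply/eqaddoP => _ /posnumP[eps].
  have /eqaddoP /(_ _ (gt0 eps)) hf := df.
  apply: filterS2 Dn0 hf => h Dh.
  by rewrite ![`|_ h|]/(`|_ (h + x) - (_ x + _)|) (fg _ Dh) (fg _ Dx).
have e : 'd g x = 'd f x :> (V -> W) by exact: diff_unique.
by apply/diff_locallyP; rewrite e.
Qed.

End MatrixDerivatives.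

(** * Closure properties of smooth maps *)

Section SmoothMaps.
Variables (R : realType) (n : nat) (D : set 'cV[R]_n).
Hypothesis oD : open D.
Local Notation E := 'cV[R]_n.

(** The iterated coordinate derivatives of [F] up to order [k] are
    differentiable on [D]: the finite-order version of [smooth_on], on which
    closure properties are proved by induction on [k]. *)
Fixpoint smooth_ord (W : normedModType R) (k : nat) (F : E -> W) : Prop :=
  (forall x, D x -> differentiable F x) /\
  if k is k'.+1 then forall i, smooth_ord k' (fun x => 'D_(evec R i) F x)
  else True.

Lemma smooth_ord_diff (W : normedModType R) k (F : E -> W) x :
  smooth_ord k F -> D x -> differentiable F x.
Proof. by case: k => [|k] [h _]; exact: h. Qed.

Lemma smooth_ord_iter (W : normedModType R) k (F : E -> W) :
  smooth_ord k F <-> forall s : seq 'I_n, (size s <= k)%N ->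
    forall x, D x -> differentiable (iter_partial s F) x.
Proof.
elim: k F => [|k IHk] F /=.
  split=> [[h _] [|//] _ x Dx|h]; first exact: h.
  by split=> // x Dx; exact: (h [::]).
split=> [[h hi] s|h].
  elim/last_ind: s => [|s i _]; first by move=> _ x Dx; exact: h.
  rewrite size_rcons ltnS /iter_partial foldr_rcons => sk x Dx.
  by have /IHk := hi i; apply.
split=> [x Dx|i]; first exact: (h [::]).
apply/IHk => s sk x Dx; have := h (rcons s i).
by rewrite size_rcons ltnS /iter_partial foldr_rcons => /(_ sk x Dx).
Qed.

Lemma smooth_onP (W : normedModType R) (F : E -> W) :
  smooth_on D F <-> forall k, smooth_ord k F.
Proof.
split=> [h k|h s x Dx]; first by apply/smooth_ord_iter => s _; exact: h.
by have /smooth_ord_iter /(_ s (leqnn _)) := h (size s); apply.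
Qed.

Lemma smooth_ord_eq (W : normedModType R) k (F G : E -> W) :
  (forall x, D x -> F x = G x) -> smooth_ord k F -> smooth_ord k G.
Proof.
elim: k F G => [|k IHk] F G FG /= [h hi]; split=> //.
- by move=> x Dx; exact: (differentiable_near oD Dx FG (h x Dx)).
- by move=> x Dx; exact: (differentiable_near oD Dx FG (h x Dx)).
- by move=> i; apply: IHk (hi i) => x Dx; exact: (derive_near _ oD Dx FG).
Qed.

Lemma smooth_ordW (W : normedModType R) k (F : E -> W) :
  smooth_ord k.+1 F -> smooth_ord k F.
Proof.
move=> /smooth_ord_iter h; apply/smooth_ord_iter => s sk x Dx.
by apply: h => //; exact: leqW.
Qed.

(** A criterion with explicit candidates [dF i] for the derivatives, which need
    to be right on [D] only. *)
Lemma smooth_ordS (W : normedModType R) k (F : E -> W) (dF : 'I_n -> E -> W) :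
  (forall x, D x -> differentiable F x) ->
  (forall i x, D x -> is_derive x (evec R i) F (dF i x)) ->
  (forall i, smooth_ord k (dF i)) -> smooth_ord k.+1 F.
Proof.
move=> h hd hi; split=> // i; apply: smooth_ord_eq (hi i) => x Dx.
by have [_ ->] := hd i x Dx.
Qed.

Lemma smooth_ord_derive (W : normedModType R) k (F : E -> W) i x :
  smooth_ord k F -> D x -> is_derive x (evec R i) F ('D_(evec R i) F x).
Proof.
move=> Fk Dx; apply/derivableP/diff_derivable.
exact: smooth_ord_diff Fk Dx.
Qed.

Lemma smooth_ord_cst (W : normedModType R) k (w : W) :
  smooth_ord k (fun _ : E => w).
Proof.
elim: k w => [|k IHk] w; first by split=> // x _; exact: differentiable_cst.
by apply: (smooth_ordS (dF := fun _ _ => 0)) => // i x _; exact: is_derive_cstf.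
Qed.

Lemma smooth_ordD (W : normedModType R) k (F G : E -> W) :
  smooth_ord k F -> smooth_ord k G -> smooth_ord k (fun x => F x + G x).
Proof.
elim: k F G => [|k IHk] F G Fk Gk.
  by split=> // x Dx; apply: differentiableD; [case: Fk => h _|case: Gk => h _];
    exact: h.
apply: (smooth_ordS (dF := fun i x => 'D_(evec R i) F x + 'D_(evec R i) G x)).
- by move=> x Dx; apply: differentiableD;
    [exact: smooth_ord_diff Fk Dx|exact: smooth_ord_diff Gk Dx].
- move=> i x Dx; apply: is_deriveDf;
    [exact: smooth_ord_derive Fk Dx|exact: smooth_ord_derive Gk Dx].
- by move=> i; apply: IHk; [have [_] := Fk|have [_] := Gk]; apply.
Qed.

Lemma smooth_ordM k (F G : E -> R) :
  smooth_ord k (F : E -> R^o) -> smooth_ord k (G : E -> R^o) ->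
  smooth_ord k (fun x => F x * G x : R^o).
Proof.
elim: k F G => [|k IHk] F G Fk Gk.
  by split=> // x Dx; apply: differentiableM; [case: Fk => h _|case: Gk => h _];
    exact: h.
apply: (smooth_ordS
  (dF := fun i x => 'D_(evec R i) F x * G x + F x * 'D_(evec R i) G x)).
- by move=> x Dx; apply: differentiableM;
    [exact: smooth_ord_diff Fk Dx|exact: smooth_ord_diff Gk Dx].
- move=> i x Dx; apply: is_deriveMf;
    [exact: smooth_ord_derive Fk Dx|exact: smooth_ord_derive Gk Dx].
- move=> i; apply: smooth_ordD; apply: IHk; do ?exact: smooth_ordW.
  + by have [_] := Fk; apply.
  + by have [_] := Gk; apply.
Qed.

Lemma smooth_ordV k (F : E -> R) : (forall x, D x -> F x != 0) ->
  smooth_ord k (F : E -> R^o) -> smooth_ord k (fun x => (F x)^-1 : R^o).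
Proof.
move=> F0; elim: k => [|k IHk] Fk.
  by split=> // x Dx; apply: differentiableV; [case: Fk => h _; exact: h|exact: F0].
have FVk := IHk (smooth_ordW Fk).
apply: (smooth_ordS
  (dF := fun i x => -1 * ('D_(evec R i) F x * ((F x)^-1 * (F x)^-1)))).
- by move=> x Dx; apply: differentiableV; [exact: smooth_ord_diff Fk Dx|exact: F0].
- move=> i x Dx; apply: is_derive_eq (is_deriveVf (F0 x Dx) _) _.
    exact: smooth_ord_derive Fk Dx.
  by rewrite mulN1r mulNr expr2 invfM.
- move=> i; apply: smooth_ordM; first exact: smooth_ord_cst.
  apply: smooth_ordM; last exact: smooth_ordM.
  by have [_] := Fk; apply.
Qed.

Lemma smooth_on_eq (W : normedModType R) (F G : E -> W) :
  (forall x, D x -> F x = G x) -> smooth_on D F -> smooth_on D G.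
Proof.
by move=> FG /smooth_onP h; apply/smooth_onP => k; exact: smooth_ord_eq (h k).
Qed.

Lemma smooth_on_diff (W : normedModType R) (F : E -> W) x :
  smooth_on D F -> D x -> differentiable F x.
Proof. by move=> h Dx; exact: (h [::]). Qed.

Lemma smooth_on_derive (W : normedModType R) (F : E -> W) i x :
  smooth_on D F -> D x -> is_derive x (evec R i) F ('D_(evec R i) F x).
Proof. by move=> /smooth_onP /(_ 0%N); exact: smooth_ord_derive. Qed.

Lemma smooth_on_partial (W : normedModType R) (F : E -> W) i :
  smooth_on D F -> smooth_on D (fun x => 'D_(evec R i) F x).
Proof.
by move=> /smooth_onP h; apply/smooth_onP => k; have [_] := h k.+1; apply.
Qed.

Lemma smooth_on_cst (W : normedModType R) (w : W) : smooth_on D (fun=> w).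
Proof. by apply/smooth_onP => k; exact: smooth_ord_cst. Qed.

Lemma smooth_onD (W : normedModType R) (F G : E -> W) :
  smooth_on D F -> smooth_on D G -> smooth_on D (fun x => F x + G x).
Proof.
move=> /smooth_onP hF /smooth_onP hG; apply/smooth_onP => k.
exact: smooth_ordD.
Qed.

Lemma smooth_onM (F G : E -> R) :
  smooth_on D (F : E -> R^o) -> smooth_on D (G : E -> R^o) ->
  smooth_on D (fun x => F x * G x : R^o).
Proof.
move=> /smooth_onP hF /smooth_onP hG; apply/smooth_onP => k.
exact: smooth_ordM.
Qed.

Lemma smooth_onV (F : E -> R) : (forall x, D x -> F x != 0) ->
  smooth_on D (F : E -> R^o) -> smooth_on D (fun x => (F x)^-1 : R^o).
Proof.
move=> F0 /smooth_onP hF; apply/smooth_onP => k; exact: smooth_ordV.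
Qed.

Lemma smooth_on_ln (F : E -> R) : (forall x, D x -> 0 < F x) ->
  smooth_on D (F : E -> R^o) -> smooth_on D (fun x => ln (F x) : R^o).
Proof.
move=> F0 hF; have lnd x : D x -> is_diff x (fun y => ln (F y) : R^o)
    ((F x)^-1 \*: 'd (F : E -> R^o) x).
  move=> Dx; have lnF := is_derive1_ln (F0 x Dx).
  have dln : differentiable (@ln R : R -> R^o) (F x).
    by apply/derivable1_diffP; case: lnF.
  have dF := smooth_on_diff hF Dx.
  apply: DiffDef; first exact: (differentiable_comp dF dln).
  rewrite (diff_comp dF dln); apply/funext => v /=.
  by rewrite diff1E // derive1E; case: lnF => _ ->; rewrite /GRing.scale /= mulrC.
apply/smooth_onP => -[|k].
  by split=> // x Dx; case: (lnd x Dx).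
apply: (smooth_ordS (dF := fun i x => (F x)^-1 * 'D_(evec R i) (F : E -> R^o) x)).
- by move=> x Dx; case: (lnd x Dx).
- move=> i x Dx; have [d1 d2] := lnd x Dx; apply: DeriveDef.
    exact: diff_derivable.
  rewrite deriveE // d2 deriveE //; exact: smooth_on_diff hF Dx.
- move=> i; move: k; apply/smooth_onP/smooth_onM.
    by apply: smooth_onV => // x Dx; rewrite gt_eqF // F0.
  exact: smooth_on_partial.
Qed.

Lemma smooth_on_sum (I : Type) (r : seq I) (F : I -> E -> R) :
  (forall i, smooth_on D (F i : E -> R^o)) ->
  smooth_on D (fun x => \sum_(i <- r) F i x : R^o).
Proof.
move=> h; elim: r => [|i r IHr].
  apply: smooth_on_eq (smooth_on_cst (0 : R^o)) => x _; by rewrite big_nil.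
by apply: smooth_on_eq (smooth_onD (h i) IHr) => x _; rewrite big_cons.
Qed.

Lemma smooth_on_prod (I : Type) (r : seq I) (F : I -> E -> R) :
  (forall i, smooth_on D (F i : E -> R^o)) ->
  smooth_on D (fun x => \prod_(i <- r) F i x : R^o).
Proof.
move=> h; elim: r => [|i r IHr].
  apply: smooth_on_eq (smooth_on_cst (1 : R^o)) => x _; by rewrite big_nil.
by apply: smooth_on_eq (smooth_onM (h i) IHr) => x _; rewrite big_cons.
Qed.

Lemma differentiable_mx p q (A : E -> 'M[R]_(p, q)) x :
  (forall i j, differentiable (fun y => A y i j : R^o) x) -> differentiable A x.
Proof.
move=> h; pose B i j : E -> 'M[R]_(p, q) := fun y => A y i j *: delta_mx i j.
have -> : A = \sum_i \sum_j B i j.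
  apply/funext => y; rewrite fct_sumE {1}[A y]matrix_sum_delta.
  by apply: eq_bigr => i _; rewrite fct_sumE.
apply: differentiable_sum => i; apply: differentiable_sum => j.
exact: differentiableZl.
Qed.

Lemma smooth_on_mxP p q (A : E -> 'M[R]_(p, q)) :
  smooth_on D A <-> forall i j, smooth_on D (fun x => A x i j : R^o).
Proof.
have entry k (B : E -> 'M[R]_(p, q)) :
    smooth_ord k B <-> forall i j, smooth_ord k (fun x => B x i j : R^o).
  elim: k B => [|k IHk] B; split=> h.
  - move=> i j; split=> // x Dx; case: h => h _.
    exact: (differentiable_comp (h x Dx) (differentiable_coord _ i j)).
  - by split=> // x Dx; apply: differentiable_mx => i j; case: (h i j) => + _; apply.
  - move=> i j.
    apply: (smooth_ordS (dF := fun l x => 'D_(evec R l) B x i j)).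
    + move=> x Dx; case: h => h _.
      exact: (differentiable_comp (h x Dx) (differentiable_coord _ i j)).
    + move=> l x Dx; have /is_derive_mxP := smooth_ord_derive l h Dx; exact.
    + by move=> l; have [_ /(_ l) /IHk] := h; apply.
  - apply: (smooth_ordS
      (dF := fun l x => \matrix_(i, j) 'D_(evec R l) (fun y => B y i j : R^o) x)).
    + move=> x Dx; apply: differentiable_mx => i j.
      exact: smooth_ord_diff (h i j) Dx.
    + move=> l x Dx; apply/is_derive_mxP => i j; rewrite mxE.
      exact: smooth_ord_derive (h i j) Dx.
    + move=> l; apply/IHk => i j.
      have [_ /(_ l)] := h i j; apply: smooth_ord_eq => x _; by rewrite mxE.
split=> [/smooth_onP h i j|h]; apply/smooth_onP => k.
  by have /entry := h k; apply.
by apply/entry => i j; move: k; apply/smooth_onP.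
Qed.

Lemma smooth_on_mulmx p q r (A : E -> 'M[R]_(p, q)) (B : E -> 'M[R]_(q, r)) :
  smooth_on D A -> smooth_on D B -> smooth_on D (fun x => A x *m B x).
Proof.
move=> /smooth_on_mxP hA /smooth_on_mxP hB; apply/smooth_on_mxP => i j.
apply: (@smooth_on_eq R^o (fun x => \sum_k A x i k * B x k j)).
  by move=> x _; rewrite mxE.
by apply: smooth_on_sum => k; exact: smooth_onM.
Qed.

Lemma smooth_on_scalemx p q (k : E -> R) (A : E -> 'M[R]_(p, q)) :
  smooth_on D (k : E -> R^o) -> smooth_on D A ->
  smooth_on D (fun x => k x *: A x).
Proof.
move=> hk /smooth_on_mxP hA; apply/smooth_on_mxP => i j.
apply: (@smooth_on_eq R^o (fun x => k x * A x i j)); last exact: smooth_onM.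
by move=> x _; rewrite mxE.
Qed.

Lemma smooth_on_tr p q (A : E -> 'M[R]_(p, q)) :
  smooth_on D A -> smooth_on D (fun x => (A x)^T).
Proof.
move=> /smooth_on_mxP hA; apply/smooth_on_mxP => i j.
by apply: smooth_on_eq (hA j i) => x _; rewrite mxE.
Qed.

Lemma smooth_on_bil m (F G : E -> 'cV[R]_m) :
  smooth_on D F -> smooth_on D G -> smooth_on D (fun x => bil (F x) (G x) : R^o).
Proof.
move=> hF hG; have /smooth_on_mxP /(_ 0 0) : smooth_on D
    (fun x => (F x)^T *m lorentz R m *m G x); last exact.
apply: smooth_on_mulmx => //; apply: smooth_on_mulmx; first exact: smooth_on_tr.
exact: smooth_on_cst.
Qed.

Lemma smooth_on_det p (A : E -> 'M[R]_p) :
  smooth_on D A -> smooth_on D (fun x => \det (A x) : R^o).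
Proof.
move=> /smooth_on_mxP hA; apply: smooth_on_sum => s.
apply: smooth_onM; first exact: smooth_on_cst.
exact: smooth_on_prod.
Qed.

Lemma smooth_on_invmx p (A : E -> 'M[R]_p) :
  (forall x, D x -> A x \in unitmx) ->
  smooth_on D A -> smooth_on D (fun x => invmx (A x)).
Proof.
move=> Au hA; apply: (@smooth_on_eq _ (fun x => (\det (A x))^-1 *: \adj (A x))).
  by move=> x Dx; rewrite /invmx Au.
apply: smooth_on_scalemx.
  apply: smooth_onV; last exact: smooth_on_det.
  by move=> x Dx; have := Au x Dx; rewrite unitmxE unitfE.
apply/smooth_on_mxP => i j.
apply: (@smooth_on_eq R^o (fun x => (-1) ^+ (j + i) * \det (row' j (col' i (A x))))).
  by move=> x _; rewrite mxE.
apply: smooth_onM; first exact: smooth_on_cst.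
apply: smooth_on_det; move/smooth_on_mxP: hA => hA; apply/smooth_on_mxP => k l.
by apply: smooth_on_eq (hA (lift j k) (lift i l)) => x _; rewrite !mxE.
Qed.

Lemma derive_coord (W : normedModType R) (F : E -> W) x X : differentiable F x ->
  'D_X F x = \sum_i X i 0 *: 'D_(evec R i) F x.
Proof.
move=> dF; rewrite deriveE // {1}[X]matrix_sum_delta linear_sum /=.
apply: eq_bigr => i _; rewrite big_ord1 linearZ /=; congr (_ *: _).
by rewrite deriveE.
Qed.

End SmoothMaps.

(** * Symmetry of second derivatives *)

Section SymmetryOfSecondDerivatives.
Variables (R : realType) (V : normedModType R).

Lemma near_right_ex2 (P Q : R -> Prop) :
  (\forall t \near 0^'+, P t) -> (\forall t \near 0^'+, Q t) ->
  exists t, [/\ 0 < t, P t & Q t].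
Proof.
move=> hP hQ; near (0 : R)^'+ => t; exists t; split; near: t => //.
exact: nbhs_right_gt.
Unshelve. all: by end_near. Qed.

(** The second difference of [f] over the parallelogram spanned by [t u] and
    [t v], the quantity symmetric in [u] and [v] that both iterated derivatives
    approximate. *)
Definition second_difference (f : V -> R) (x u v : V) (t : R) : R :=
  f (t *: u + (t *: v + x)) - f (t *: u + x) - (f (t *: v + x) - f x).

Lemma second_differenceC f x u v t :
  second_difference f x u v t = second_difference f x v u t.
Proof. by rewrite /second_difference addrCA; ring. Qed.

(** By the mean value theorem along [u], the second difference is [t] times a
    difference of two values of ['D_u f], which the differential of ['D_u f] at
    [x] computes up to [o(t)]. *)
Lemma second_difference_approx (D : set V) (f : V -> R) x u v : open D -> D x ->
  (forall y, D y -> differentiable (f : V -> R^o) y) ->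
  differentiable (fun y => 'D_u (f : V -> R^o) y) x ->
  forall e, 0 < e -> \forall t \near 0^'+,
    `|second_difference f x u v t -
      t ^+ 2 * 'D_v (fun y => 'D_u (f : V -> R^o) y) x| <= e * t ^+ 2.
Proof.
move=> oD Dx df dg e e0.
set g := fun y => 'D_u (f : V -> R^o) y.
pose M := `|u| + `|v| + 1.
have M0 : 0 < M by rewrite /M ltr_wpDl ?addr_ge0.
pose e1 := e / (2 * M).
have e10 : 0 < e1 by rewrite divr_gt0 // mulr_gt0.
have [L gL] : exists L : {linear V -> R^o}, forall h, 'd g x h = L h.
  by exists ('d g x).
have Lv : 'D_v g x = L v by rewrite deriveE.
have Dn0 : \forall h \near (0 : V), D (h + x).
  rewrite (near_shift x 0) /=; apply: filterS (open_nbhs_nbhs (conj oD Dx)).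
  by move=> y; rewrite /= sub0r addrNK.
have : \forall h \near (0 : V), D (h + x) /\
    `|g (h + x) - (g x + L h)| <= e1 * `|h|.
  apply: filterI => //.
  have /diff_locally /eqaddoP /(_ _ e10) := dg; apply: filterS => h.
  by rewrite -gL.
move=> /nbhs_ballP [d /= d0 hd].
have hd' h : `|h| < d -> D (h + x) /\ `|g (h + x) - (g x + L h)| <= e1 * `|h|.
  by move=> hlt; apply: hd; rewrite -ball_normE /= sub0r normrN.
near=> t.
have t0 : 0 < t by near: t; exact: nbhs_right_gt.
have tM : t * M < d.
  rewrite -ltr_pdivlMr //; near: t; apply: nbhs_right_lt.
  by rewrite divr_gt0.
(* The parallelogram at which the estimates are used stays within [d] of [x]. *)
have small a b : 0 <= a <= t -> 0 <= b <= t -> `|a *: u + b *: v| <= t * M.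
  move=> /andP[a0 at_] /andP[b0 bt].
  rewrite (le_trans (ler_normD _ _)) // !normrZ !ger0_norm // /M !mulrDr.
  rewrite (le_trans (lerD (ler_wpM2r _ at_) (ler_wpM2r _ bt))) //.
  by rewrite lerDl mulr1 ltW.
have tt : 0 <= t <= t by rewrite ltW /=.
have t00 : 0 <= (0 : R) <= t by rewrite lexx ltW.
pose phi s := f (s *: u + (t *: v + x)) - f (s *: u + x).
have line s b : 0 <= s <= t -> 0 <= b <= t ->
    is_derive s 1 (fun s => f (s *: u + (b *: v + x)) : R^o)
      (g (s *: u + (b *: v + x))).
  move=> hs hb.
  have [Ds _] := hd' _ (le_lt_trans (small s b hs hb) tM).
  rewrite -addrA in Ds; have dfs := df _ Ds.
  have da : differentiable (fun s : R => s *: u + (b *: v + x)) s.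
    by apply: differentiableD => //; exact: differentiableZl.
  have dc := differentiable_comp da dfs.
  have d1 : differentiable (fun s : R => s *: u) s by exact: differentiableZl.
  have ds : is_derive s 1 (fun s : R => s *: u) u.
    apply: DeriveDef; first exact: diff_derivable.
    by rewrite deriveE // diffZl // diff_val scale1r.
  have [_ da1] : is_derive s 1 (fun s : R => s *: u + (b *: v + x)) u.
    by have := is_deriveDf ds (is_derive_cstf (b *: v + x) s 1); rewrite addr0.
  have a1 : 'd (fun s : R => s *: u + (b *: v + x)) s 1 = u.
    by rewrite -deriveE.
  apply: DeriveDef; first exact: diff_derivable.
  by rewrite deriveE // (diff_comp da dfs) /comp a1 /g (deriveE u dfs).
have line0 s : 0 <= s <= t -> is_derive s 1 (fun s => f (s *: u + x) : R^o) (g (s *: u + x)).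
  by move=> hs; have := line s 0 hs t00; rewrite scale0r add0r.
have dphi s : 0 <= s <= t ->
    is_derive s 1 phi (g (s *: u + (t *: v + x)) - g (s *: u + x)).
  by move=> hs; apply: is_deriveBf; [exact: line|exact: line0].
have [||c] := @MVT R phi
    (fun s => g (s *: u + (t *: v + x)) - g (s *: u + x)) 0 t t0.
- by move=> s; rewrite in_itv /= => /andP[s0 st]; apply: dphi; rewrite !ltW.
- apply: derivable_within_continuous => s; rewrite in_itv /= => hs.
  by case: (dphi s hs).
rewrite in_itv /= => /andP[c0 ct].
rewrite subr0 {1 2}/phi !scale0r !add0r => E.
have hc : 0 <= c <= t by rewrite !ltW.
rewrite [second_difference _ _ _ _ _]E Lv.
have [_ h1] := hd' _ (le_lt_trans (small c t hc tt) tM).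
have [_ h2] := hd' _ (le_lt_trans (small c 0 hc t00) tM).
rewrite scale0r addr0 in h2; rewrite -addrA in h1.
have -> : (g (c *: u + (t *: v + x)) - g (c *: u + x)) * t - t ^+ 2 * L v =
    t * ((g (c *: u + (t *: v + x)) - (g x + L (c *: u + t *: v)))
      - (g (c *: u + x) - (g x + L (c *: u)))).
  have LZ : L (t *: v) = t * L v :> R by exact: linearZ.
  have -> : L (c *: u + t *: v) = L (c *: u) + t * L v :> R.
    by rewrite -LZ; exact: linearD.
  by ring.
rewrite normrM (gtr0_norm t0) expr2 [e * _]mulrCA ler_pM2l //.
rewrite (le_trans (ler_normB _ _)) // (le_trans (lerD h1 h2)) //.
have b1 := small c t hc tt.
have b2 := small c 0 hc t00; rewrite scale0r addr0 in b2.
rewrite -mulrDr (le_trans (ler_wpM2l (ltW e10) (lerD b1 b2))) //.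
have -> : e1 * (t * M + t * M) = e * t; last by [].
by rewrite /e1; field; rewrite gt_eqF.
Unshelve. all: by end_near. Qed.

(** Schwarz's theorem, with differentiability of the first partial derivatives
    in place of continuity of the second ones. *)
Lemma derive_comm (D : set V) (f : V -> R) x u v : open D -> D x ->
  (forall y, D y -> differentiable (f : V -> R^o) y) ->
  differentiable (fun y => 'D_u (f : V -> R^o) y) x ->
  differentiable (fun y => 'D_v (f : V -> R^o) y) x ->
  'D_v (fun y => 'D_u (f : V -> R^o) y) x =
  'D_u (fun y => 'D_v (f : V -> R^o) y) x.
Proof.
move=> oD Dx df du dv; apply/eqP; rewrite -subr_eq0 -normr_le0.
apply/ler_addgt0Pr => e e0; rewrite add0r.
have e2 : 0 < e / 2 by rewrite divr_gt0.
have h1 := second_difference_approx v oD Dx df du e2.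
have h2 := second_difference_approx u oD Dx df dv e2.
set a := 'D_v _ x in h1 *; set b := 'D_u _ x in h2 *.
have [t [t0 h4 h5]] := near_right_ex2 h1 h2.
rewrite second_differenceC in h5.
have t2 : 0 < t ^+ 2 by rewrite exprn_gt0.
rewrite -(ler_pM2r t2) -{1}(gtr0_norm t2) -normrM.
set d := second_difference _ _ _ _ _ in h4 h5.
have -> : (a - b) * t ^+ 2 = (d - t ^+ 2 * b) - (d - t ^+ 2 * a) by ring.
rewrite (le_trans (ler_normB _ _)) // (le_trans (lerD h5 h4)) //.
by rewrite -mulrDl -splitr.
Qed.

End SymmetryOfSecondDerivatives.

Lemma smooth_on_derive_comm (R : realType) n (D : set 'cV[R]_n) p q
    (A : 'cV[R]_n -> 'M[R]_(p, q)) i j x : open D -> smooth_on D A -> D x ->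
  'D_(evec R i) (fun y => 'D_(evec R j) A y) x =
  'D_(evec R j) (fun y => 'D_(evec R i) A y) x.
Proof.
move=> oD hA Dx; apply/matrixP => a b.
have hAab : smooth_on D (fun z => A z a b : R^o) by apply smooth_on_mxP.
have entry k l : 'D_(evec R k) (fun y => 'D_(evec R l) A y) x a b =
    'D_(evec R k) (fun y => 'D_(evec R l) (fun z => A z a b : R^o) y) x.
  have dA := smooth_on_derive k (smooth_on_partial l hA) Dx.
  have [_ <-] := (is_derive_mxP _ _ _ _).1 dA a b.
  apply: (derive_near _ oD Dx) => y Dy.
  by have [_ <-] := (is_derive_mxP _ _ _ _).1 (smooth_on_derive l hA Dy) a b.
refine (etrans (entry i j) (etrans _ (esym (entry j i)))).
apply: (derive_comm oD Dx (fun y Dy => smooth_on_diff hAab Dy)).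
- exact: smooth_on_diff (smooth_on_partial j hAab) Dx.
- exact: smooth_on_diff (smooth_on_partial i hAab) Dx.
Qed.

(** * The Lorentz form *)

Section LorentzForm.
Variable K : comNzRingType.
Implicit Types m n : nat.

Lemma tr_lorentz m : (lorentz K m)^T = lorentz K m.
Proof. exact: tr_diag_mx. Qed.

Lemma lorentzE m (i j : 'I_m) :
  lorentz K m i j = (if i.+1 == m then -1 else 1) *+ (i == j).
Proof. by rewrite !mxE. Qed.

Lemma mul_lorentz m : lorentz K m *m lorentz K m = 1%:M.
Proof.
rewrite mulmx_diag -diag_const_mx; congr diag_mx; apply/rowP => i.
by rewrite !mxE; case: ifP; rewrite ?mulrNN mulr1.
Qed.

Lemma lorentz_block n :
  lorentz K (n + n) = block_mx 1%:M 0 0 (lorentz K n).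
Proof.
apply/matrixP => i j; rewrite lorentzE.
case: (split_ordP i) => k ->; case: (split_ordP j) => l ->.
- rewrite block_mxEul !mxE (inj_eq (@lshift_inj _ _)) ltn_eqF //=.
  rewrite (leq_ltn_trans (ltn_ord k)) // -[X in (X < _)%N]addn0 ltn_add2l.
  exact: leq_ltn_trans (ltn_ord k).
- by rewrite block_mxEur !mxE eq_lrshift.
- by rewrite block_mxEdl !mxE eq_rlshift.
- rewrite block_mxEdr lorentzE (inj_eq (@rshift_inj _ _)) /=.
  by rewrite -addnS eqn_add2l.
Qed.

Lemma bilC m (x y : 'cV[K]_m) : bil x y = bil y x.
Proof.
rewrite /bil; set A := _ *m y.
have -> : A 0 0 = A^T 0 0 by rewrite [RHS]mxE.
by rewrite /A !trmx_mul trmxK tr_lorentz mulmxA.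
Qed.

Lemma bilDl m (x y z : 'cV[K]_m) : bil (x + y) z = bil x z + bil y z.
Proof. by rewrite /bil linearD /= !mulmxDl mxE. Qed.

Lemma bilZl m a (x y : 'cV[K]_m) : bil (a *: x) y = a * bil x y.
Proof. by rewrite /bil linearZ /= -!scalemxAl mxE. Qed.

Lemma bilNl m (x y : 'cV[K]_m) : bil (- x) y = - bil x y.
Proof. by rewrite -scaleN1r bilZl mulN1r. Qed.

Lemma bilBl m (x y z : 'cV[K]_m) : bil (x - y) z = bil x z - bil y z.
Proof. by rewrite bilDl bilNl. Qed.

Lemma bil0l m (y : 'cV[K]_m) : bil 0 y = 0.
Proof. by rewrite -(scale0r y) bilZl mul0r. Qed.

Lemma bilDr m (x y z : 'cV[K]_m) : bil x (y + z) = bil x y + bil x z.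
Proof. by rewrite ![bil x _]bilC bilDl. Qed.

Lemma bilZr m a (x y : 'cV[K]_m) : bil x (a *: y) = a * bil x y.
Proof. by rewrite ![bil x _]bilC bilZl. Qed.

Lemma bilNr m (x y : 'cV[K]_m) : bil x (- y) = - bil x y.
Proof. by rewrite ![bil x _]bilC bilNl. Qed.

Lemma bilBr m (x y z : 'cV[K]_m) : bil x (y - z) = bil x y - bil x z.
Proof. by rewrite bilDr bilNr. Qed.

Lemma bil0r m (x : 'cV[K]_m) : bil x 0 = 0.
Proof. by rewrite bilC bil0l. Qed.

Lemma bil_suml m (I : finType) (F : I -> 'cV[K]_m) y :
  bil (\sum_i F i) y = \sum_i bil (F i) y.
Proof.
by apply: (big_morph (fun x => bil x y)) => [x z|]; rewrite ?bilDl ?bil0l.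
Qed.

Lemma bil_sumr m (I : finType) (F : I -> 'cV[K]_m) y :
  bil y (\sum_i F i) = \sum_i bil y (F i).
Proof. by rewrite bilC bil_suml; apply: eq_bigr => i _; rewrite bilC. Qed.

Definition bilE := (bilDl, bilDr, bilNl, bilNr, bilZl, bilZr, bil0l, bil0r).

Lemma bil_mulmx m p q (A : 'M[K]_(m, p)) (B : 'M[K]_(m, q)) a b :
  bil (A *m a) (B *m b) = (a^T *m (A^T *m lorentz K m *m B) *m b) 0 0.
Proof. by rewrite /bil trmx_mul !mulmxA. Qed.

Lemma bil_sumE m (x y : 'cV[K]_m) :
  bil x y = \sum_i lorentz K m i i * (x i 0 * y i 0).
Proof.
rewrite /bil mxE; apply: eq_bigr => i _; rewrite mul_mx_diag !mxE eqxx mulr1n.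
by rewrite mulrAC mulrC.
Qed.

(** In the splitting of the space as R^n (+) R^{n-1,1} the form is the sum of
    the Euclidean form and of the Lorentz form. *)
Lemma bil_col_mx n (x1 x2 y1 y2 : 'cV[K]_n) :
  bil (col_mx x1 x2) (col_mx y1 y2) = (x1^T *m y1) 0 0 + bil x2 y2.
Proof.
rewrite /bil lorentz_block tr_col_mx mul_row_block mul_row_col.
by rewrite mulmx1 !mulmx0 addr0 add0r mxE.
Qed.

Lemma bil_delta_l m (i : 'I_m) (y : 'cV[K]_m) :
  bil (delta_mx i 0) y = lorentz K m i i * y i 0.
Proof.
rewrite bil_sumE (bigD1 i) //= !mxE !eqxx mul1r big1 ?addr0 // => j ji.
by rewrite !mxE (negbTE ji) mul0r mulr0.
Qed.

End LorentzForm.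

Section RealLorentz.
Variable R : realFieldType.

(** The form is positive definite on vectors without time component. *)
Lemma bil_euclid_ge0 m (x : 'cV[R]_m.+1) : x ord_max 0 = 0 ->
  0 <= bil x x /\ (bil x x = 0 -> x = 0).
Proof.
move=> x0; have xE : bil x x = \sum_i x i 0 ^+ 2.
  rewrite bil_sumE; apply: eq_bigr => i _; rewrite lorentzE eqxx mulr1n.
  case: eqP => [[im]|_]; last by rewrite mul1r expr2.
  have -> : i = ord_max by exact: val_inj.
  by rewrite x0 mul0r mulr0 expr0n.
rewrite xE; split; first by apply: sumr_ge0 => i _; exact: sqr_ge0.
move/eqP; rewrite psumr_eq0 => [/allP h|i _]; last exact: sqr_ge0.
apply/colP => i; rewrite mxE; apply/eqP.
by have := h i (mem_index_enum _); rewrite sqrf_eq0.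
Qed.

(** The orthogonal complement of a time-like vector is space-like. *)
Lemma timelike_orth m (t x : 'cV[R]_m) :
  bil t t < 0 -> bil t x = 0 -> x != 0 -> 0 < bil x x.
Proof.
case: m t x => [|m] t x tt tx xn0.
  by move: xn0; rewrite (flatmx0 x) eqxx.
pose t' := t ord_max 0; pose x' := x ord_max 0.
pose y := t' *: x - x' *: t.
have y0 : y ord_max 0 = 0 by rewrite !mxE mulrC subrr.
have [yge yeq] := bil_euclid_ge0 y0.
have yE : bil y y = t' ^+ 2 * bil x x + x' ^+ 2 * bil t t.
  by rewrite /y !bilE (bilC x t) tx; ring.
have t0 : t' != 0.
  apply/eqP => t0; have [+ _] := bil_euclid_ge0 t0.
  by rewrite leNgt tt.
have t2 : 0 < t' ^+ 2 by rewrite exprn_even_gt0.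
have x2 := sqr_ge0 x'.
rewrite lt_neqAle eq_sym andbC; apply/andP; split.
  by rewrite -(pmulr_rge0 _ t2); nra.
apply: contra xn0 => /eqP xx0.
have xt : x' ^+ 2 * bil t t = 0.
  apply/eqP; rewrite eq_le; apply/andP; split; first by nra.
  by move: yge; rewrite yE xx0 mulr0 add0r.
have x0 : x' = 0.
  by move/eqP: xt; rewrite mulf_eq0 (lt_eqF tt) orbF sqrf_eq0 => /eqP.
have /yeq : bil y y = 0 by rewrite yE xx0 xt mulr0 addr0.
by move/eqP; rewrite /y x0 scale0r subr0 scaler_eq0 (negbTE t0).
Qed.

Lemma timelike_null m (t x : 'cV[R]_m) :
  bil t t < 0 -> bil x x = 0 -> x != 0 -> bil t x != 0.
Proof.
move=> tt xx xn0; apply/eqP => tx; have := timelike_orth tt tx xn0.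
by rewrite xx ltxx.
Qed.

Lemma euclid_gt0 m (x : 'cV[R]_m) : x != 0 -> 0 < (x^T *m x) 0 0.
Proof.
have xE : (x^T *m x) 0 0 = \sum_i x i 0 ^+ 2.
  by rewrite mxE; apply: eq_bigr => i _; rewrite mxE expr2.
move=> xn0; rewrite xE lt_neqAle eq_sym andbC sumr_ge0 /=; last first.
  by move=> i _; exact: sqr_ge0.
apply: contra xn0; rewrite psumr_eq0 => [/allP h|i _]; last exact: sqr_ge0.
apply/eqP/colP => i; rewrite mxE; apply/eqP.
by have := h i (mem_index_enum _); rewrite sqrf_eq0.
Qed.

End RealLorentz.

(** * The Gauss equation *)

Section OrthonormalColumns.
Variables (R : comNzRingType) (m p : nat).

Lemma bil_col q (A : 'M[R]_(m, p)) (B : 'M[R]_(m, q)) i j :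
  bil (col i A) (col j B) = (A^T *m lorentz R m *m B) i j.
Proof.
rewrite !colE bil_mulmx trmx_delta -rowE.
by rewrite -colE !mxE.
Qed.

Lemma bil_mulmx_l (A : 'M[R]_(m, p)) a y :
  bil (A *m a) y = (a^T *m (A^T *m lorentz R m *m y)) 0 0.
Proof. by rewrite /bil trmx_mul !mulmxA. Qed.

Lemma bil_col_l (A : 'M[R]_(m, p)) i y :
  bil (col i A) y = (A^T *m lorentz R m *m y) i 0.
Proof. by rewrite colE bil_mulmx_l trmx_delta -rowE mxE. Qed.

Lemma mulmx_sum_colcv (A : 'M[R]_(m, p)) a : A *m a = \sum_i a i 0 *: col i A.
Proof. by apply/colP => i; rewrite mxE summxE; apply: eq_bigr => j _; rewrite !mxE mulrC. Qed.

Lemma mulmx_delta_cv (A : 'M[R]_(m, p)) (v : 'cV[R]_p) i :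
  A *m delta_mx i i *m v = v i 0 *: col i A.
Proof.
rewrite -mulmxA colE scalemxAr; congr (A *m _).
apply/colP => j; rewrite !mxE (bigD1 i) //= big1 => [|k ki]; last first.
  by rewrite !mxE (negbTE ki) andbF mul0r.
by rewrite !mxE !eqxx !andbT addr0 mulrC.
Qed.

End OrthonormalColumns.

(** The Gauss equation in coordinates. [G1 i], [G2 i j] and [G3 i j k] stand for
    the iterated partial derivatives of an immersion, [g] for its metric. *)
Section Gauss.
Variables (R : realType) (n : nat) (D : set 'cV[R]_n).
Variables (G1 : 'I_n -> 'cV[R]_n -> 'cV[R]_(n + n))
  (G2 : 'I_n -> 'I_n -> 'cV[R]_n -> 'cV[R]_(n + n))
  (G3 : 'I_n -> 'I_n -> 'I_n -> 'cV[R]_n -> 'cV[R]_(n + n))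
  (g : 'cV[R]_n -> 'M[R]_n).
Hypothesis oD : open D.
Hypothesis gE : forall x i j, D x -> g x i j = bil (G1 i x) (G1 j x).
Hypothesis gU : forall x, D x -> g x \in unitmx.
Hypothesis dG1 : forall i j x, D x -> is_derive x (evec R i) (G1 j) (G2 i j x).
Hypothesis dG2 : forall i j k x, D x ->
  is_derive x (evec R i) (G2 j k) (G3 i j k x).
Hypothesis G2C : forall i j x, D x -> G2 i j x = G2 j i x.
Hypothesis G3C : forall i j k x, D x -> G3 i j k x = G3 j i k x.
Hypothesis sG1 : forall i, smooth_on D (G1 i).
Hypothesis sG2 : forall i j, smooth_on D (G2 i j).
Local Notation chr := (christoffel g).

Lemma smooth_metric : smooth_on D g.
Proof.
apply/(smooth_on_mxP oD) => i j.
apply: (smooth_on_eq oD (F := fun x => bil (G1 i x) (G1 j x) : R^o)).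
  by move=> x Dx; rewrite gE.
exact: smooth_on_bil.
Qed.

Lemma is_derive_metric i j l x : D x ->
  is_derive x (evec R i) (fun y => g y j l : R)
    (bil (G2 i j x) (G1 l x) + bil (G1 j x) (G2 i l x)).
Proof.
move=> Dx.
apply: (is_derive_near oD Dx (f := fun y => bil (G1 j y) (G1 l y))).
  by move=> y Dy; rewrite gE.
by apply: is_derive_bil; exact: dG1.
Qed.

Lemma christoffelE x k i j : D x ->
  chr x k i j = \sum_l invmx (g x) k l * bil (G2 i j x) (G1 l x).
Proof.
move=> Dx; rewrite /christoffel mulr_sumr; apply: eq_bigr => l _.
have [_ ->] := is_derive_metric i j l Dx.
have [_ ->] := is_derive_metric j i l Dx.
have [_ ->] := is_derive_metric l i j Dx.
rewrite (G2C j i Dx) (G2C l i Dx) (G2C l j Dx).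
rewrite (bilC (G1 j x)) (bilC (G1 i x) (G2 j l x)).
by field.
Qed.

Lemma smooth_christoffel k i j : smooth_on D (fun x => chr x k i j : R^o).
Proof.
apply: (smooth_on_eq oD
  (F := fun x => \sum_l invmx (g x) k l * bil (G2 i j x) (G1 l x) : R^o)).
  by move=> x Dx; rewrite christoffelE.
apply: smooth_on_sum => // l; apply: smooth_onM => //; last exact: smooth_on_bil.
by move: (k) (l); apply/(smooth_on_mxP oD)/smooth_on_invmx => //;
  exact: smooth_metric.
Qed.

(** The first Christoffel symbols, with the upper index lowered. *)
Lemma lower_christoffel x p j k : D x ->
  \sum_l g x p l * chr x l j k = bil (G2 j k x) (G1 p x).
Proof.
move=> Dx.
transitivity ((g x *m (invmx (g x) *m \col_l bil (G2 j k x) (G1 l x))) p 0).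
  rewrite [RHS]mxE; apply: eq_bigr => l _; rewrite christoffelE // [in RHS]mxE.
  by congr (_ * _); apply: eq_bigr => q _; rewrite [in RHS]mxE.
by rewrite mulmxA mulmxV ?gU // mul1mx mxE.
Qed.

(** The normal part of the second derivative. *)
Definition normal_part x j k : 'cV[R]_(n + n) :=
  G2 j k x - \sum_l chr x l j k *: G1 l x.

Lemma normal_part_orth x j k p : D x -> bil (normal_part x j k) (G1 p x) = 0.
Proof.
move=> Dx; rewrite /normal_part bilBl -lower_christoffel // bil_suml.
apply/eqP; rewrite subr_eq0; apply/eqP/eq_bigr => l _.
by rewrite bilZl mulrC gE // bilC.
Qed.

(** The half of the Gauss equation that is not yet antisymmetrised in [i] and
    [j], obtained by differentiating [lower_christoffel]. *)
Lemma gauss_half x p k i j : D x ->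
  \sum_l g x p l * ('D_(evec R i) (fun y => chr y l j k : R) x
                    + \sum_m chr x l i m * chr x m j k) =
  bil (G3 i j k x) (G1 p x) + bil (G2 i p x) (normal_part x j k).
Proof.
move=> Dx.
pose dc l := 'D_(evec R i) (fun y => chr y l j k : R) x.
have dchr l : is_derive x (evec R i) (fun y => chr y l j k : R) (dc l).
  exact (smooth_on_derive i (smooth_christoffel l j k) Dx).
have dl : is_derive x (evec R i) (fun y => \sum_l g y p l * chr y l j k)
    (\sum_l ((bil (G2 i p x) (G1 l x) + bil (G1 p x) (G2 i l x)) * chr x l j k
             + g x p l * dc l)).
  by apply: is_derive_sumf => l; apply: is_deriveMf (is_derive_metric i p l Dx) (dchr l).
have dr := is_derive_bil (dG2 i j k Dx) (dG1 i p Dx).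
have := is_derive_uniq (is_derive_near oD Dx
  (fun y Dy => lower_christoffel p j k Dy) dl) dr.
rewrite big_split /= => E.
transitivity (\sum_l g x p l * dc l +
              \sum_l g x p l * \sum_m chr x l i m * chr x m j k).
  by rewrite -big_split /=; apply: eq_bigr => l _; rewrite mulrDr.
rewrite /normal_part bilBr bil_sumr.
have -> : \sum_l g x p l * \sum_m chr x l i m * chr x m j k =
    \sum_m bil (G1 p x) (G2 i m x) * chr x m j k.
  under eq_bigr do rewrite mulr_sumr.
  rewrite exchange_big /=; apply: eq_bigr => m _.
  rewrite bilC -lower_christoffel // mulr_suml; apply: eq_bigr => l _.
  by rewrite mulrA.
have S : \sum_l (bil (G2 i p x) (G1 l x) + bil (G1 p x) (G2 i l x)) * chr x l j k
  = \sum_l bil (G2 i p x) (chr x l j k *: G1 l x)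
    + \sum_m bil (G1 p x) (G2 i m x) * chr x m j k.
  rewrite -big_split /=; apply: eq_bigr => l _.
  by rewrite mulrDl bilZr mulrC.
rewrite S in E; rewrite (bilC (G2 i p x) (G2 j k x)).
move: E; set s1 := \sum_l bil _ _; set s2 := \sum_m bil _ _ * _.
set s3 := \sum_l _ * dc _ => E.
by move: E; move: (bil _ _) (bil _ _) => a b E; lra.
Qed.

Lemma gauss_equation x p k i j : D x ->
  \sum_l g x p l * riemann g x l k i j =
  bil (G2 i p x) (normal_part x j k) - bil (G2 j p x) (normal_part x i k).
Proof.
move=> Dx; have e1 := gauss_half p k i j Dx; have e2 := gauss_half p k j i Dx.
rewrite (G3C j i k Dx) in e2.
transitivity (\sum_l g x p l * ('D_(evec R i) (fun y => chr y l j k : R) x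
                    + \sum_m chr x l i m * chr x m j k) -
    \sum_l g x p l * ('D_(evec R j) (fun y => chr y l i k : R) x
                    + \sum_m chr x l j m * chr x m i k)).
  rewrite -sumrB; apply: eq_bigr => l _; rewrite -mulrBr /riemann sumrB.
  by congr (_ * _); rewrite opprD addrACA.
by rewrite e1 e2 opprD addrACA subrr add0r.
Qed.

(** The metric is flat if the values [II_ip] and [II_jk] of the second
    fundamental form are orthogonal for distinct [i] and [j]. *)
Lemma riemann_eq0 x : D x ->
  (forall i j p k, i != j -> bil (G2 i p x) (normal_part x j k) = 0) ->
  forall l k i j, riemann g x l k i j = 0.
Proof.
move=> Dx h l k i j.
have h' p : \sum_l g x p l * riemann g x l k i j = 0.
  rewrite gauss_equation //; have [->|ij] := eqVneq i j; first by rewrite subrr.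
  by rewrite !h ?subrr // eq_sym.
have : g x *m \col_l riemann g x l k i j = 0.
  apply/colP => p; rewrite !mxE -[RHS](h' p); apply: eq_bigr => q _.
  by rewrite [X in _ * X]mxE.
move=> /(congr1 (mulmx (invmx (g x)))); rewrite mulmxA mulVmx ?gU // mul1mx mulmx0.
by move=> /colP /(_ l); rewrite !mxE.
Qed.

End Gauss.

(** * Parallel frames *)

Lemma diag_mx_mulcv (R : comNzRingType) n (d : 'rV[R]_n) (X : 'cV[R]_n) i :
  (diag_mx d *m X) i 0 = d 0 i * X i 0.
Proof. by rewrite mul_diag_mx mxE. Qed.

(** Immersions whose coordinate fields are orthogonal, [d_i G = k_i u_i] with
    orthonormal [u_i]. *)
Section OrthogonalCoordinates.
Variables (R : realType) (n : nat) (D : set 'cV[R]_n).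
Variables (G : 'cV[R]_n -> 'cV[R]_(n + n)) (u : 'cV[R]_n -> 'M[R]_(n + n, n))
  (k : 'cV[R]_n -> 'cV[R]_n).
Hypothesis oD : open D.
Hypothesis sG : smooth_on D G.
Hypothesis hu : forall x, D x -> (u x)^T *m lorentz R (n + n) *m u x = 1%:M.
Hypothesis dG : forall x i, D x ->
  is_derive x (evec R i) G (k x i 0 *: col i (u x)).

Lemma derive_orthogonal x X : D x ->
  'D_X G x = \sum_i (X i 0 * k x i 0) *: col i (u x).
Proof.
move=> Dx; rewrite derive_coord; last exact: smooth_on_diff sG Dx.
by apply: eq_bigr => i _; have [_ ->] := dG i Dx; rewrite scalerA.
Qed.

Lemma orthonormal_col x i j : D x ->
  bil (col i (u x)) (col j (u x)) = (i == j)%:R.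
Proof. by move=> Dx; rewrite bil_col hu // mxE. Qed.

Lemma bil_derive_orthogonal x X i : D x ->
  bil (col i (u x)) ('D_X G x) = X i 0 * k x i 0.
Proof.
move=> Dx; rewrite derive_orthogonal // bil_sumr (bigD1 i) //= big1 => [|j ji].
  by rewrite bilZr orthonormal_col // eqxx mulr1 addr0.
by rewrite bilZr orthonormal_col // eq_sym (negbTE ji) mulr0.
Qed.

Lemma first_form_orthogonal x : D x ->
  first_form G x = diag_mx (\row_i (k x i 0 ^+ 2)).
Proof.
move=> Dx; apply/matrixP => i j; rewrite !mxE.
have [_ ->] := dG i Dx; rewrite bilZl bil_derive_orthogonal // mxE eqxx andbT.
by have [->|] := eqVneq i j; rewrite ?mul1r ?mulr1n ?expr2 // mul0r mulr0 mulr0n.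
Qed.

Lemma immersive_orthogonal :
  immersive_on D G <-> forall x i, D x -> k x i 0 != 0.
Proof.
split=> [h x i Dx|h x Dx X X0].
  apply/eqP => k0; have /h : 'D_(evec R i) G x = 0.
    by have [_ ->] := dG i Dx; rewrite k0 scale0r.
  move=> /(_ Dx) /colP /(_ i); rewrite !mxE !eqxx /= => /eqP.
  by rewrite oner_eq0.
apply/colP => i; rewrite mxE; apply/eqP.
have := bil_derive_orthogonal X i Dx; rewrite X0 bil0r => /esym/eqP.
by rewrite mulf_eq0 (negbTE (h x i Dx)) orbF.
Qed.

Hypothesis k0 : forall x i, D x -> k x i 0 != 0.

Lemma first_form_unit x : D x -> first_form G x \in unitmx.
Proof.
move=> Dx; rewrite first_form_orthogonal // unitmxE det_diag unitfE.
by apply/prodf_neq0 => i _; rewrite mxE expf_neq0 ?k0.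
Qed.

Lemma metric_orthogonal : metric_on D (first_form G).
Proof.
split=> [|x Dx].
  apply/(smooth_on_mxP oD) => i j.
  apply: (smooth_on_eq oD
    (F := fun x => bil ('D_(evec R i) G x) ('D_(evec R j) G x) : R^o)).
    by move=> x _; rewrite mxE.
  by apply: smooth_on_bil => //; exact: smooth_on_partial.
rewrite first_form_orthogonal //; split; first exact: tr_diag_mx.
move=> X X0.
have -> : (X^T *m diag_mx (\row_i (k x i 0 ^+ 2)) *m X) 0 0 =
    ((\col_i (k x i 0 * X i 0))^T *m \col_i (k x i 0 * X i 0)) 0 0.
  rewrite !mxE; apply: eq_bigr => i _; rewrite mul_mx_diag !mxE.
  by ring.
apply: euclid_gt0; apply: contra X0 => /eqP /colP h; apply/eqP/colP => i.
by have := h i; rewrite !mxE => /eqP; rewrite mulf_eq0 (negbTE (k0 _ _)) // => /eqP.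
Qed.

Lemma normal_orthogonal x xi : D x ->
  (forall X, bil xi ('D_X G x) = 0) <-> (forall i, bil (col i (u x)) xi = 0).
Proof.
move=> Dx; split=> [h i|h X].
  have := h (evec R i); have [_ ->] := dG i Dx; rewrite bilZr bilC => /eqP.
  by rewrite mulf_eq0 (negbTE (k0 _ _)) //= => /eqP.
rewrite derive_orthogonal // bil_sumr big1 // => i _.
by rewrite bilZr bilC h mulr0.
Qed.

(** If the normal vector [nu x] extends to a field normal along [G] whose
    derivative along [x_i] has tangential part [s_i u_i], the shape operator is
    diagonal. *)
Lemma shape_op_orthogonal x (nu : 'cV[R]_n -> 'cV[R]_(n + n)) dnu s : D x ->
  (forall y i, D y -> bil (col i (u y)) (nu y) = 0) ->
  (forall i, is_derive x (evec R i) nu (dnu i)) ->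
  (forall i j, bil (col j (u x)) (dnu i) = s i *+ (j == i)) ->
  shape_op G x (nu x) = diag_mx (\row_i - (s i / k x i 0)).
Proof.
move=> Dx nu0 dnux sE.
have sf : second_form G x (nu x) = diag_mx (\row_i - (k x i 0 * s i)).
  apply/matrixP => i j; rewrite !mxE.
  have d1 := smooth_on_derive i (smooth_on_partial j sG) Dx.
  have d2 := is_derive_bil d1 (dnux i).
  have d0 : is_derive x (evec R i) (fun=> 0 : R) 0 by exact: is_derive_cstf.
  have z y : D y -> 0 = bil ('D_(evec R j) G y) (nu y) :> R.
    by move=> Dy; have [_ ->] := dG j Dy; rewrite bilZl nu0 // mulr0.
  have := is_derive_uniq d2 (is_derive_near oD Dx z d0).
  have [_ ->] := dG j Dx; rewrite bilZl sE => /eqP; rewrite addr_eq0 => /eqP ->.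
  by have [->|] := eqVneq j i; rewrite ?mulr1n ?mulr0n ?mulr0 ?oppr0.
rewrite /shape_op sf -[RHS]mul1mx -(mulVmx (first_form_unit Dx)) -mulmxA.
congr (_ *m _); rewrite first_form_orthogonal // mulmx_diag; congr diag_mx.
by apply/rowP => i; rewrite !mxE; field; rewrite k0.
Qed.

End OrthogonalCoordinates.

Lemma eigen_diag (R : fieldType) n (d : 'rV[R]_n) (X : 'cV[R]_n) kap :
  (forall i, X i 0 != 0 -> d 0 i = kap) -> diag_mx d *m X = kap *: X.
Proof.
move=> h; apply/colP => i; rewrite diag_mx_mulcv mxE.
by have [->|/h ->] := eqVneq (X i 0) 0; rewrite ?mulr0.
Qed.

Lemma diag_eigen (R : fieldType) n (d : 'rV[R]_n) (X : 'cV[R]_n) kap i :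
  diag_mx d *m X = kap *: X -> X i 0 != 0 -> d 0 i = kap.
Proof.
move=> /colP /(_ i); rewrite diag_mx_mulcv mxE => h Xi.
exact: (mulIf Xi).
Qed.

Section ParallelFrames.
Variables (R : realType) (n : nat) (D : set 'cV[R]_n).
Local Notation I2 := (lorentz R (n + n)).
Local Notation J := (lorentz R n).

(** An orthonormal moving frame [e, N] of R^{2n-1,1} over [D] such that
    [d_i N = e_i K_i], with [e_i] the i-th column of [e] and [K_i] the i-th row of
    [K]. For constant [c] the map [N c] satisfies [d_i (N c) = (K c)_i e_i]; where
    no [(K c)_i] vanishes it is an immersion with curvature directions [e_i], and
    the fields [N b] with [b] constant are its parallel normal fields. *)
Definition parallel_frame (e N : 'cV[R]_n -> 'M[R]_(n + n, n))
    (K : 'cV[R]_n -> 'M[R]_n) : Prop :=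
  [/\ smooth_on D e, smooth_on D N,
      forall x, D x -> [/\ (e x)^T *m I2 *m e x = 1%:M,
        (N x)^T *m I2 *m N x = J, (e x)^T *m I2 *m N x = 0 &
        (K x)^T *m J *m K x = J] &
      forall x i, D x ->
        is_derive x (evec R i) N (e x *m delta_mx i i *m K x)].

Variables (e N : 'cV[R]_n -> 'M[R]_(n + n, n)) (K : 'cV[R]_n -> 'M[R]_n).
Hypothesis oD : open D.
Hypothesis hf : parallel_frame e N K.

Let ee x : D x -> (e x)^T *m I2 *m e x = 1%:M.
Proof. by case: hf => _ _ h _ /h[]. Qed.

Lemma frame_NN x b b' : D x -> bil (N x *m b) (N x *m b') = bil b b'.
Proof. by case: hf => _ _ h _ /h[_ NN _ _]; rewrite bil_mulmx NN. Qed.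

Lemma frame_eN x i b : D x -> bil (col i (e x)) (N x *m b) = 0.
Proof.
case: hf => _ _ h _ /h[_ _ eN _].
by rewrite bil_col_l mulmxA eN mul0mx mxE.
Qed.

Lemma frame_KK x b b' : D x -> bil (K x *m b) (K x *m b') = bil b b'.
Proof. by case: hf => _ _ h _ /h[_ _ _ KK]; rewrite bil_mulmx KK. Qed.

(** As [K x] is a Lorentz matrix, [J K^T J] is its inverse. *)
Lemma frame_KV x (y : 'cV[R]_n) : D x -> K x *m (J *m (K x)^T *m J *m y) = y.
Proof.
case: hf => _ _ h _ /h[_ _ _ KK].
have : J *m (K x)^T *m J *m K x = 1%:M by rewrite -!mulmxA (mulmxA (K x)^T) KK mul_lorentz.
by move=> /mulmx1C KV; rewrite mulmxA KV mul1mx.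
Qed.

(** The normal space of [N c] is spanned by the columns of [N]. *)
Lemma frame_decomp x xi : D x -> (forall i, bil (col i (e x)) xi = 0) ->
  xi = N x *m (J *m ((N x)^T *m I2 *m xi)).
Proof.
case: hf => _ _ h _ /h[eE NN eN _] xi0.
have Ne : (N x)^T *m I2 *m e x = 0.
  by apply/trmx_inj; rewrite !trmx_mul tr_lorentz trmxK mulmxA eN trmx0.
pose U := row_mx (e x) (N x).
have UU : (I2 *m U^T *m I2) *m U = 1%:M.
  have -> : I2 *m U^T *m I2 *m U = I2 *m (U^T *m I2 *m U) by rewrite !mulmxA.
  rewrite /U tr_row_mx mul_col_mx mul_col_row eE eN Ne NN -lorentz_block.
  exact: mul_lorentz.
have /(congr1 (fun A => A *m xi)) := mulmx1C UU; rewrite mul1mx => {1}<-.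
rewrite lorentz_block /U tr_row_mx mul_block_col !mul1mx !mul0mx addr0 add0r.
rewrite mulmxA mul_row_col -lorentz_block !mulmxDl -!mulmxA.
have -> : (e x)^T *m (I2 *m xi) = 0.
  by apply/colP => i; rewrite mulmxA -bil_col_l xi0 mxE.
by rewrite mulmx0 add0r.
Qed.

Lemma frame_smooth (c : 'cV[R]_n) : smooth_on D (fun x => N x *m c).
Proof.
by case: hf => _ sN _ _; apply: smooth_on_mulmx => //; exact: smooth_on_cst.
Qed.

Lemma frame_derive (c : 'cV[R]_n) x i : D x ->
  is_derive x (evec R i) (fun x => N x *m c) ((K x *m c) i 0 *: col i (e x)).
Proof.
case: hf => _ _ _ dN Dx.
apply: is_derive_eq (is_derive_mulmxr c (dN x i Dx)) _.
rewrite -(mulmxA (e x *m delta_mx i i)). exact: mulmx_delta_cv.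
Qed.

Variable c : 'cV[R]_n.
Local Notation F := (fun x => N x *m c).
Local Notation h := (fun x => K x *m c).

Lemma frame_immersive : immersive_on D F <-> forall x i, D x -> h x i 0 != 0.
Proof.
apply: (immersive_orthogonal (frame_smooth c) ee) => x i Dx; exact: frame_derive.
Qed.

Hypothesis h0 : forall x i, D x -> h x i 0 != 0.

Let dF x i : D x -> is_derive x (evec R i) F (h x i 0 *: col i (e x)).
Proof. exact: frame_derive. Qed.

Lemma frame_normal x xi : D x -> normal_at (@tan_full R n) F x xi ->
  exists b : 'cV[R]_n, xi = N x *m b.
Proof.
move=> Dx [_ hxi]; eexists; apply: frame_decomp => //.
exact/(normal_orthogonal (frame_smooth c) dF h0).
Qed.

Lemma frame_shape_op (b : 'cV[R]_n) x : D x ->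
  shape_op F x (N x *m b) = diag_mx (\row_i - ((K x *m b) i 0 / h x i 0)).
Proof.
move=> Dx; apply: (shape_op_orthogonal oD (frame_smooth c) ee dF h0 Dx
  (nu := fun x => N x *m b) (dnu := fun i => (K x *m b) i 0 *: col i (e x))).
- by move=> y i Dy; exact: frame_eN.
- by move=> i; exact: frame_derive.
- move=> i j; rewrite bilZr (orthonormal_col ee) // mulr_natr; by [].
Qed.

Lemma frame_flat_normal_bundle : flat_normal_bundle (@tan_full R n) D F.
Proof.
move=> x xi0 Dx /(frame_normal Dx) [b ->].
exists (fun y => N y *m b) => //.
apply: filterS (open_nbhs_nbhs (conj oD Dx)) => y Dy; split.
- exact: smooth_on_diff (frame_smooth b) Dy.
- split=> //; apply/(normal_orthogonal (frame_smooth c) dF h0) => // i.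
  exact: frame_eN.
- move=> X nu /(frame_normal Dy) [b' ->].
  rewrite (derive_orthogonal (frame_smooth b) (fun z i => frame_derive b i) X Dy).
  by rewrite bil_suml big1 // => i _; rewrite bilZl frame_eN // mulr0.
Qed.

(** The principal directions are exactly the coordinate ones. *)
Lemma frame_principal x X : D x ->
  principal_at (@tan_full R n) F x X <->
  X != 0 /\ forall i j, X i 0 != 0 -> X j 0 != 0 -> i = j.
Proof.
move=> Dx; split=> -[X0 hX]; split=> //.
  move=> i j Xi Xj; apply/eqP/negPn/negP => ij.
  (* The normal [N b] with [K b = h_i e_i] has principal curvature -1 in the
     i-th direction and 0 in the other ones. *)
  pose y : 'cV[R]_n := h x i 0 *: delta_mx i 0.
  pose b := J *m (K x)^T *m J *m y.
  have Nb : normal_at (@tan_full R n) F x (N x *m b).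
    split=> //; apply/(normal_orthogonal (frame_smooth c) dF h0) => // l.
    exact: frame_eN.
  have [kap] := hX _ Nb; rewrite frame_shape_op // frame_KV // => E.
  have := diag_eigen E Xi; have := diag_eigen E Xj; have := h0 i Dx.
  rewrite /y; move: (K x *m c) => hx hi.
  rewrite !mxE !eqxx eq_sym (negbTE ij) mulr0 mul0r oppr0 mulr1 divff //.
  by move=> <- /eqP; rewrite oppr_eq0 oner_eq0.
move=> xi /(frame_normal Dx) [b ->].
have /cV0Pn [i Xi] := X0.
exists (- ((K x *m b) i 0 / h x i 0)); rewrite frame_shape_op //.
apply: eigen_diag => j Xj; rewrite (hX j i) //.
by move: (K x *m c) (K x *m b) => hx bx; rewrite mxE.
Qed.

(** The induced metric is flat: the second fundamental form is diagonal, with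
    [II_jj] a multiple of [N K^-1 e_j], and these vectors are orthogonal. *)
Lemma frame_flat_metric : flat_metric_on D (first_form F).
Proof.
have sF := frame_smooth c; split.
  exact: (metric_orthogonal oD sF ee dF h0).
move=> x Dx; pose G1 i : 'cV[R]_n -> 'cV[R]_(n + n) := fun y => 'D_(evec R i) F y.
pose G2 i j : 'cV[R]_n -> 'cV[R]_(n + n) := fun y => 'D_(evec R i) (G1 j) y.
pose G3 i j k : 'cV[R]_n -> 'cV[R]_(n + n) := fun y => 'D_(evec R i) (G2 j k) y.
have sG1 i : smooth_on D (G1 i) by exact: smooth_on_partial.
have sG2 i j : smooth_on D (G2 i j) by exact: smooth_on_partial.
have dG1 i j y (Dy : D y) : is_derive y (evec R i) (G1 j) (G2 i j y).
  exact (smooth_on_derive i (sG1 j) Dy).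
have gE y i j (_ : D y) : first_form F y i j = bil (G1 i y) (G1 j y).
  by rewrite mxE.
have G2C i j y : D y -> G2 i j y = G2 j i y by exact: smooth_on_derive_comm.
have G1E i y : D y -> G1 i y = h y i 0 *: col i (e y).
  by move=> Dy; have [_] := dF i Dy.
have G2N i j y b : D y ->
    bil (G2 i j y) (N y *m b) = - (h y j 0 * (K y *m b) i 0) *+ (j == i).
  move=> Dy; have d1 := is_derive_bil (dG1 i j y Dy) (frame_derive b i Dy).
  have d0 : is_derive y (evec R i) (fun=> 0 : R) 0 by exact: is_derive_cstf.
  have z w : D w -> 0 = bil (G1 j w) (N w *m b) :> R.
    by move=> Dw; rewrite G1E // bilZl frame_eN // mulr0.
  have := is_derive_uniq d1 (is_derive_near oD Dy z d0).
  rewrite G1E // bilZl bilZr (orthonormal_col ee) // => /eqP.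
  rewrite addr_eq0 => /eqP ->.
  by have [->|] := eqVneq j i; rewrite ?mulr1 ?mulr1n ?mulr0n ?mulr0 ?oppr0.
have gU y : D y -> first_form F y \in unitmx.
  by move=> Dy; exact (first_form_unit sF ee dF h0 Dy).
have dG2 i j k y (Dy : D y) : is_derive y (evec R i) (G2 j k) (G3 i j k y).
  exact (smooth_on_derive i (sG2 j k) Dy).
have G3C i j k y (Dy : D y) : G3 i j k y = G3 j i k y.
  exact (smooth_on_derive_comm i j oD (sG1 k) Dy).
(* Only the relations just proved are used about the iterated derivatives. *)
clearbody G1 G2 G3.
apply (riemann_eq0 oD gE gU dG1 dG2 G2C G3C sG1 sG2 Dx).
move=> i j p k ij; set II := normal_part _ _ _ _ _ _.
have IIe l : bil (col l (e x)) II = 0.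
  have : bil II (G1 l x) = 0 by exact (normal_part_orth oD gE gU dG1 G2C j k l Dx).
  rewrite G1E // bilZr bilC => /eqP.
  by rewrite mulf_eq0 (negbTE (h0 _ _)) //= => /eqP.
have IIN b : bil II (N x *m b) = - (h x k 0 * (K x *m b) j 0) *+ (k == j).
  rewrite /II /normal_part bilBl G2N // bil_suml big1 ?subr0 // => l _.
  by rewrite bilZl G1E // bilZl frame_eN // !mulr0.
have [b IIb] : exists b, II = N x *m b by eexists; exact: frame_decomp.
rewrite IIb G2N //; have [pi|] := eqVneq p i; last by rewrite mulr0n.
suff -> : (K x *m b) i 0 = 0 by rewrite mulr0 oppr0 mul0rn.
have KV := frame_KV (delta_mx i 0) Dx; move: KV; set b' := _ *m _ *m _ *m _ => KV.
(* [b'] solves [K b' = e_i]: pairing [II_jk] with [N b'] extracts, up to sign,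
   the i-th component of [K b]. *)
have := IIN b'; rewrite IIb frame_NN // -(frame_KK b b' Dx) KV bilC bil_delta_l.
have -> : (delta_mx i 0 : 'cV[R]_n) j 0 = 0 by rewrite mxE eq_sym (negbTE ij).
rewrite mulr0 oppr0 mul0rn lorentzE eqxx mulr1n => /eqP.
by rewrite mulf_eq0; case: ifP => _; rewrite ?oppr_eq0 oner_eq0 => /eqP.
Qed.

End ParallelFrames.

(** * Reflections and quadrics *)

Section Reflection.
Variables (R : realFieldType) (m : nat).
Local Notation I := (lorentz R m).

(** The reflection in the orthogonal complement of [Q], applied to the columns
    of [A]. *)
Definition reflect_mx p (Q : 'cV[R]_m) (A : 'M[R]_(m, p)) : 'M[R]_(m, p) :=
  A - (2 / bil Q Q) *: (Q *m (Q^T *m I *m A)).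

Lemma mx11_bil (x y : 'cV[R]_m) : x^T *m I *m y = (bil x y)%:M.
Proof. by rewrite [LHS]mx11_scalar. Qed.

Lemma reflect_gram p r Q (A : 'M[R]_(m, p)) (B : 'M[R]_(m, r)) :
  bil Q Q != 0 ->
  (reflect_mx Q A)^T *m I *m reflect_mx Q B = A^T *m I *m B.
Proof.
move=> q0; rewrite /reflect_mx; set t := 2 / _.
set a := Q^T *m I *m A; set b := Q^T *m I *m B.
have aE : A^T *m I *m Q = a^T by rewrite /a !trmx_mul tr_lorentz trmxK mulmxA.
have -> : (A - t *: (Q *m a))^T = A^T - t *: (a^T *m Q^T).
  by apply/matrixP => i j; rewrite !mxE; congr (_ - _ * _);
     apply: eq_bigr => k _; rewrite !mxE mulrC.
rewrite !mulmxBl !mulmxBr -?scalemxAr -?scalemxAl -?scalemxAr.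
have -> : A^T *m I *m (Q *m b) = a^T *m b by rewrite mulmxA aE.
have -> : a^T *m Q^T *m I *m B = a^T *m b by rewrite /b !mulmxA.
have -> : a^T *m Q^T *m I *m (Q *m b) = bil Q Q *: (a^T *m b).
  have -> : a^T *m Q^T *m I *m (Q *m b) = a^T *m (Q^T *m I *m Q) *m b.
    by rewrite !mulmxA.
  by rewrite mx11_bil mul_mx_scalar -scalemxAl.
rewrite !scalerA opprB -addrA; set Y := a^T *m b.
apply: etrans (addr0 _); congr (_ + _).
rewrite -scaleNr -!scalerDl.
suff -> : - t + (t * t * bil Q Q - t) = 0 by rewrite scale0r.
by rewrite /t; field.
Qed.

Lemma reflect_mulmx p r Q (A : 'M[R]_(m, p)) (B : 'M[R]_(p, r)) :
  reflect_mx Q A *m B = reflect_mx Q (A *m B).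
Proof. by rewrite /reflect_mx mulmxBl -scalemxAl !mulmxA. Qed.

Lemma reflect_cv Q (x : 'cV[R]_m) :
  reflect_mx Q x = x - (2 * bil Q x / bil Q Q) *: Q.
Proof.
by rewrite /reflect_mx mx11_bil mul_mx_scalar scalerA mulrAC.
Qed.

Lemma col_reflect p Q (A : 'M[R]_(m, p)) i :
  col i (reflect_mx Q A) = reflect_mx Q (col i A).
Proof. by rewrite !colE reflect_mulmx. Qed.

Lemma reflect_bil Q (x y : 'cV[R]_m) : bil Q Q != 0 ->
  bil (reflect_mx Q x) (reflect_mx Q y) = bil x y.
Proof. by move=> q0; rewrite /bil reflect_gram. Qed.

End Reflection.

Section ReflectedFrame.
Variables (R : realType) (n : nat) (D : set 'cV[R]_n).
Variables (e N : 'cV[R]_n -> 'M[R]_(n + n, n)) (K : 'cV[R]_n -> 'M[R]_n).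
Variables (Q : 'cV[R]_n -> 'cV[R]_(n + n)) (mu : 'cV[R]_n -> 'cV[R]_n) (th : R).
Local Notation I2 := (lorentz R (n + n)).
Local Notation J := (lorentz R n).
Hypothesis oD : open D.
Hypothesis hf : parallel_frame D e N K.
Hypothesis sQ : smooth_on D Q.
Hypothesis dQ : forall x i, D x ->
  is_derive x (evec R i) Q (mu x i 0 *: col i (e x)).
Hypothesis q0 : forall x, D x -> bil (Q x) (Q x) != 0.
Hypothesis Kmu : forall x, D x ->
  (K x)^T *m J *m mu x = th *: ((Q x)^T *m I2 *m N x)^T.
Hypothesis mumu : forall x, D x -> bil (mu x) (mu x) = th * bil (Q x) (Q x).

Let smooth_reflect (A : 'cV[R]_n -> 'M[R]_(n + n, n)) : smooth_on D A ->
  smooth_on D (fun x => reflect_mx (Q x) (A x)).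
Proof.
move=> sA.
apply: (smooth_on_eq oD (F := fun x => A x + (-2 * (bil (Q x) (Q x))^-1) *:
    (Q x *m ((Q x)^T *m I2 *m A x)))).
  by move=> x _; rewrite /reflect_mx mulNr scaleNr.
apply: smooth_onD => //; apply: smooth_on_scalemx => //.
  apply: smooth_onM => //; first exact: smooth_on_cst.
  by apply: smooth_onV => //; exact: smooth_on_bil.
apply: smooth_on_mulmx => //; apply: smooth_on_mulmx => //.
by apply: smooth_on_mulmx => //; [exact: smooth_on_tr|exact: smooth_on_cst].
Qed.

(** Ribaucour transformation of a parallel frame: when [d_i Q] is parallel to
    [e_i], reflecting the frame in the orthogonal complement of [Q] yields a
    parallel frame again. *)
Lemma reflected_frame : parallel_frame D
  (fun x => reflect_mx (Q x) (e x)) (fun x => reflect_mx (Q x) (N x))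
  (fun x => K x - (2 / bil (Q x) (Q x)) *: (mu x *m ((Q x)^T *m I2 *m N x))).
Proof.
case: (hf) => se sN alg dN; split; [exact: smooth_reflect|exact: smooth_reflect| |].
  move=> x Dx; have [ee NN eN KK] := alg x Dx; have qx := q0 Dx.
  split; [exact (etrans (reflect_gram _ _ qx) ee)|
    exact (etrans (reflect_gram _ _ qx) NN)|
    exact (etrans (reflect_gram _ _ qx) eN)|]; cbv beta.
  have := Kmu Dx; have := mumu Dx; set q := bil (Q x) (Q x) in qx *.
  set s := (Q x)^T *m I2 *m N x.
  set t := 2 / q => mm Km.
  have mK : (mu x)^T *m J *m K x = th *: s.
    apply: trmx_inj; rewrite !trmx_mul tr_lorentz trmxK mulmxA Km.
    by apply/matrixP => i j; rewrite !mxE.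
  have -> : (K x - t *: (mu x *m s))^T = (K x)^T - t *: (s^T *m (mu x)^T).
    by apply/matrixP => i j; rewrite !mxE; congr (_ - _ * _);
       apply: eq_bigr => k _; rewrite !mxE mulrC.
  rewrite !mulmxBl !mulmxBr -?scalemxAr -?scalemxAl -?scalemxAr KK.
  have -> : (K x)^T *m J *m (mu x *m s) = th *: (s^T *m s).
    by rewrite mulmxA Km -scalemxAl.
  have -> : s^T *m (mu x)^T *m J *m K x = th *: (s^T *m s).
    by rewrite -!mulmxA (mulmxA (mu x)^T) mK -scalemxAr.
  have -> : s^T *m (mu x)^T *m J *m (mu x *m s) = (th * q) *: (s^T *m s).
    have -> : s^T *m (mu x)^T *m J *m (mu x *m s) =
        s^T *m ((mu x)^T *m J *m mu x) *m s by rewrite !mulmxA.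
    by rewrite mx11_bil mm mul_mx_scalar -scalemxAl.
  rewrite !scalerA opprB -addrA; set Y := s^T *m s.
  apply: etrans (addr0 _); congr (_ + _).
  rewrite -scaleNr -!scalerDl.
  suff -> : - (t * th) + (t * t * (th * q) - t * th) = 0 by rewrite scale0r.
  by rewrite /t; field.
move=> x i Dx; cbv beta; have [ee NN eN KK] := alg x Dx; have qx := q0 Dx.
pose E : 'M[R]_n := delta_mx i i.
set q := bil (Q x) (Q x) in qx *.
pose w := (Q x)^T *m I2 *m e x; pose s := (Q x)^T *m I2 *m N x.
pose om := (w *m E *m mu x) 0 0.
have dQE : mu x i 0 *: col i (e x) = e x *m E *m mu x.
  by rewrite mulmx_delta_cv.
have dQx : is_derive x (evec R i) Q (e x *m E *m mu x) by rewrite -dQE; exact: dQ.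
have dNx := dN x i Dx; rewrite -/E in dNx.
have dqx : is_derive x (evec R i) (fun y => bil (Q y) (Q y)) (2 * om).
  apply: is_derive_eq (is_derive_bil dQx dQx) _.
  have -> : om = bil (Q x) (e x *m E *m mu x) by rewrite /om /w /bil !mulmxA.
  by rewrite (bilC _ (Q x)); ring.
have dtx : is_derive x (evec R i) (fun y => 2 / bil (Q y) (Q y))
    (- (2 / q) ^+ 2 * om).
  have H := is_deriveMf (is_derive_cstf (2 : R) x (evec R i))
    (is_deriveVf (f := fun y => bil (Q y) (Q y)) qx dqx).
  have E2 : - (2 / q) ^+ 2 * om = 0 / q + 2 * (- (2 * om) / q ^+ 2) by field.
  by rewrite E2; exact H.
have dsx : is_derive x (evec R i) (fun y => (Q y)^T *m I2 *m N y) (w *m E *m K x).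
  apply: is_derive_eq (is_derive_mulmx (is_derive_mulmxr I2 (is_derive_tr dQx)) dNx) _.
  rewrite !trmx_mul -!mulmxA (mulmxA (e x)^T) eN !mulmx0 add0r.
  by rewrite /w !mulmxA.
have := is_deriveBf dNx (is_derive_scalemx dtx (is_derive_mulmx dQx dsx)).
rewrite -/s -/q; set t := 2 / q => H.
apply: is_derive_eq H _.
rewrite /reflect_mx -/q -/t -/w -/s -/E.
have omE : w *m E *m mu x = om%:M by rewrite [LHS]mx11_scalar.
rewrite !mulmxBl !mulmxBr -?scalemxAl -?scalemxAr -?scalemxAl.
have -> : Q x *m w *m E *m (mu x *m s) = om *: (Q x *m s).
  have -> : Q x *m w *m E *m (mu x *m s) = Q x *m (w *m E *m mu x) *m s.
    by rewrite !mulmxA.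
  by rewrite omE mul_mx_scalar -scalemxAl.
have -> : e x *m E *m (mu x *m s) = e x *m E *m mu x *m s by rewrite !mulmxA.
have -> : Q x *m w *m E *m K x = Q x *m (w *m E *m K x) by rewrite !mulmxA.
move: (e x *m E *m K x) (e x *m E *m mu x *m s) (Q x *m (w *m E *m K x)) (Q x *m s).
move=> a b c d; apply/matrixP => k l; rewrite !mxE; ring.
Qed.

End ReflectedFrame.

Lemma bil_pythagoras (R : comNzRingType) m (d z : 'cV[R]_m) : bil d z = 0 ->
  bil (d + z) (d + z) = bil z z + bil d d.
Proof. by move=> dz; rewrite !bilE (bilC z) dz addr0 add0r addrC. Qed.

Section Quadrics.
Variables (R : realType) (n : nat).
Local Notation V := 'cV[R]_(n + n).
Local Notation I2 := (lorentz R (n + n)).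
Variables (U : 'M[R]_(n + n, n)) (Q p : V).
Hypothesis hU : U^T *m I2 *m U = 1%:M.
Hypothesis pU : forall i, bil (col i U) p = 0.
Hypothesis s0 : bil p Q != 0.

(** The component of [Q] orthogonal to the columns of [U]. *)
Variable Q' : V.
Hypothesis Q'E : Q' = Q - U *m (U^T *m I2 *m Q).
Local Notation k := (bil Q' Q').
Local Notation s := (bil p Q).

(** The linear span of the columns of [U] and of [Q]. *)
Definition span_mx : {vspace V} := limg (linfun (mulmx (row_mx U Q))).

Lemma span_mxP v :
  reflect (exists a b, v = U *m a + b *: Q) (v \in span_mx).
Proof.
apply: (iffP memv_imgP) => [[y _ ->]|[a [b ->]]].
  rewrite lfunE /= -[y]vsubmxK mul_row_col.
  exists (usubmx y), (dsubmx y 0 0); congr (_ + _).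
  by rewrite {1}[dsubmx y]mx11_scalar mul_mx_scalar.
exists (col_mx a b%:M); first exact: memvf.
by rewrite lfunE /= mul_row_col mul_mx_scalar.
Qed.

Let bilUa a v : (forall i, bil (col i U) v = 0) -> bil (U *m a) v = 0.
Proof.
move=> h; rewrite mulmx_sum_colcv bil_suml big1 // => i _.
by rewrite bilZl h mulr0.
Qed.

Let UQ' i : bil (col i U) Q' = 0.
Proof. by rewrite bil_col_l Q'E mulmxBr [X in _ - X]mulmxA hU mul1mx subrr mxE. Qed.

Let QQ' : bil Q Q' = k.
Proof.
by rewrite [in X in _ = bil X _]Q'E bilBl (bilUa _ UQ') subr0.
Qed.

Let pQ' : bil p Q' = s.
Proof. by rewrite Q'E bilBr [bil p (U *m _)]bilC bilUa // subr0. Qed.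

Let Q'_span : Q' \in span_mx.
Proof.
apply/span_mxP; exists (- (U^T *m I2 *m Q)), 1.
by rewrite Q'E scale1r mulmxN addrC.
Qed.

Lemma span_mx_perp v : v \in span_mx -> exists a b, v = U *m a + b *: Q'.
Proof.
move=> /span_mxP [a [b ->]]; exists (a + b *: (U^T *m I2 *m Q)), b.
rewrite Q'E mulmxDr scalerBr -scalemxAr -addrA; congr (_ + _).
by rewrite addrC subrK.
Qed.

Hypothesis k0 : k != 0.

Lemma dim_span_mx : \dim span_mx = n.+1.
Proof.
rewrite limg_dim_eq ?dimvf /dim /= ?muln1 ?addn1 //.
apply/eqP; rewrite -subv0; apply/subvP => y; rewrite memv_cap => /andP[_].
rewrite memv_ker lfunE /= -[y]vsubmxK mul_row_col.
rewrite {1}[dsubmx y]mx11_scalar mul_mx_scalar => /eqP y0.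
have b0 : dsubmx y 0 0 = 0.
  have := congr1 (fun v => bil v Q') y0; rewrite bilDl bilUa; last exact: UQ'.
  rewrite add0r bilZl QQ' bil0l => /eqP.
  by rewrite mulf_eq0 (negbTE k0) orbF => /eqP.
have a0 : usubmx y = 0.
  have /(congr1 (mulmx (U^T *m I2))) : U *m usubmx y = 0.
    by move: y0; rewrite b0 scale0r addr0.
  by rewrite mulmxA hU mul1mx mulmx0.
have -> : dsubmx y = 0 by apply/matrixP => i j; rewrite !ord1 b0 mxE.
by rewrite a0 col_mx0 mem0v.
Qed.

(** The quadric through [p] with directions spanned by [U] and [Q] that is
    tangent at [p] to the span of [U]. *)
Definition quadric_at : quadric R n :=
  Quadric (p - (s / k) *: Q') span_mx (s ^+ 2 / k).
Local Notation C := quadric_at.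
Local Notation c0 := (Defs.center C).

Let Uc0 i : bil (col i U) c0 = 0.
Proof. by rewrite /= bilBr bilZr pU UQ' mulr0 subr0. Qed.

Let spanc0 v : v \in span_mx -> bil v c0 = 0.
Proof.
move=> /span_mxP [a [b ->]]; rewrite bilDl bilUa; last exact: Uc0.
rewrite add0r bilZl /= bilBr bilZr QQ' [bil Q p]bilC.
by rewrite divfK // subrr mulr0.
Qed.

Lemma center_orth : c0 \in orthv (dirs C).
Proof. by apply/mem_orthv => u hu; exact: spanc0. Qed.

Lemma carrier_base : carrier C p.
Proof.
rewrite /carrier /= opprB addrC subrK memvZ //; split=> //.
by rewrite bilZl bilZr; field; exact: k0.
Qed.

(** The form is constant on the quadric, as the centre is orthogonal to all its
    directions; this is what keeps it in the light cone or in the sphere. *)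
Lemma carrier_quadric y :
  carrier C y <-> y - p \in span_mx /\ bil y y = bil p p.
Proof.
have [pd pl] := carrier_base.
have subBB (a b d : V) : a - b = (a - d) - (b - d) by rewrite opprB addrA subrK.
have norm z : z - c0 \in span_mx -> bil z z = bil c0 c0 + bil (z - c0) (z - c0).
  move=> /spanc0 dc; rewrite -[in LHS](subrK c0 z).
  exact: bil_pythagoras dc.
split=> [[yd yl]|[yd yl]].
  split; last by rewrite (norm y yd) (norm p pd) yl pl.
  by rewrite (subBB y p c0) memvB.
have yd' : y - c0 \in span_mx.
  by rewrite -(addrNK p y) -addrA memvD.
split=> //; apply: (addrI (bil c0 c0)).
by rewrite -(norm y yd') yl (norm p pd) pl.
Qed.

Lemma tan_quadric_base : tan_quadric C p = [set v | exists a, v = U *m a].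
Proof.
apply/seteqP; split=> v /=; rewrite /tan_quadric /= opprB addrC subrK.
  move=> [/span_mxP [a [b ->]]]; rewrite bilZr bilDl bilUa; last exact: UQ'.
  rewrite add0r bilZl QQ' mulrCA divfK // => /eqP.
  rewrite mulf_eq0 (negbTE s0) orbF => /eqP ->.
  by exists a; rewrite scale0r addr0.
move=> [a ->]; split; last by rewrite bilZr bilUa ?mulr0 //; exact: UQ'.
by apply/span_mxP; exists a, 0; rewrite scale0r addr0.
Qed.

(** A second point of the quadric, in the direction of [Q] from [p], with its
    tangent space. *)
Lemma tan_quadric_shift U' p' b (w : 'rV[R]_n) : b != 0 -> p' = p + b *: Q ->
  bil p' p' = bil p p -> U' = U + Q *m w -> (forall i, bil (col i U') p' = 0) ->
  carrier C p' /\ tan_quadric C p' = [set v | exists a, v = U' *m a].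
Proof.
move=> b0 p'E pp U'E U'p'.
have p'C : carrier C p'.
  apply/carrier_quadric; split=> //; apply/span_mxP; exists 0, b.
  by rewrite p'E mulmx0 add0r addrC addKr.
split=> //.
(* Equality of the norms of [p] and [p'] forces [b (Q, Q) = -2 (p, Q)]. *)
have s' : bil Q p' != 0.
  have qE : b * bil Q Q = - (2 * s).
    apply: (mulfI b0); apply/eqP; rewrite -subr_eq0; apply/eqP.
    have : bil p' p' - bil p p = 0 by rewrite pp subrr.
    rewrite p'E !bilE (bilC Q p) => <-; ring.
  rewrite p'E bilDr bilZr qE [bil Q p]bilC.
  have -> : s + - (2 * s) = - s by ring.
  by rewrite oppr_eq0.
have bilU'a a : bil (U' *m a) p' = 0.
  rewrite mulmx_sum_colcv bil_suml big1 // => i _.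
  by rewrite bilZl U'p' mulr0.
have U'a a : U' *m a = U *m a + (w *m a) 0 0 *: Q.
  rewrite U'E mulmxDl -mulmxA {1}[w *m a]mx11_scalar.
  by rewrite mul_mx_scalar.
have cl v : v \in span_mx -> bil v (p' - c0) = bil v p'.
  by move=> hv; rewrite bilBr spanc0 // subr0.
apply/seteqP; split=> v /=.
  move=> [hv]; rewrite cl //; move/span_mxP: hv => [a [d ->]].
  have -> : U *m a + d *: Q = U' *m a + (d - (w *m a) 0 0) *: Q.
    by rewrite U'a scalerBl -addrA; congr (_ + _); rewrite addrC subrK.
  rewrite bilDl bilU'a add0r bilZl => /eqP.
  rewrite mulf_eq0 (negbTE s') orbF => /eqP ->.
  by exists a; rewrite scale0r addr0.
move=> [a ->]; have hv : U' *m a \in span_mx.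
  by apply/span_mxP; rewrite U'a; exists a, ((w *m a) 0 0).
by split=> //; rewrite cl.
Qed.

Lemma bil_span a b : bil (U *m a + b *: Q') (U *m a + b *: Q') =
  (a^T *m a) 0 0 + b ^+ 2 * k.
Proof.
rewrite !bilE (bilC Q') (bilUa a UQ').
by rewrite !mulr0 addr0 add0r bil_mulmx hU mulmx1 expr2 mulrA.
Qed.

Lemma quadric_sphere : 0 < k -> is_sphere C.
Proof.
move=> kp; split; [exact: dim_span_mx| |exact: center_orth|].
  move=> y /span_mx_perp [a [b ->]] y0; rewrite bil_span.
  have b2 : 0 <= b ^+ 2 * k by rewrite mulr_ge0 ?sqr_ge0 // ltW.
  have [a0|/euclid_gt0 ha] := eqVneq a 0; last by rewrite ltr_wpDr.
  rewrite a0 mulmx0 mxE add0r mulr_gt0 // exprn_even_gt0 //=.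
  by apply: contra y0 => /eqP ->; rewrite a0 mulmx0 scale0r addr0.
have h : 0 < s ^+ 2 / k by rewrite divr_gt0 // exprn_even_gt0.
by exists (Num.sqrt (s ^+ 2 / k)); rewrite ?sqrtr_gt0 // sqr_sqrtr // ltW.
Qed.

Lemma quadric_hyperbola : k < 0 -> is_hyperbola C.
Proof.
move=> kn; split; [exact: dim_span_mx| |exact: center_orth|].
  exists Q'; split=> // y /span_mx_perp [a [b ->]].
  rewrite bilC bilDl bilUa; last exact: UQ'.
  rewrite add0r bilZl => /eqP; rewrite mulf_eq0 (negbTE k0) orbF => /eqP -> y0.
  rewrite bil_span expr0n mul0r addr0; apply: euclid_gt0.
  by apply: contra y0 => /eqP ->; rewrite mulmx0 scale0r addr0.
have h : 0 < - (s ^+ 2 / k).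
  by rewrite -mulrN -invrN divr_gt0 ?oppr_gt0 // exprn_even_gt0.
exists (Num.sqrt (- (s ^+ 2 / k))); rewrite ?sqrtr_gt0 //.
by rewrite sqr_sqrtr ?opprK // ltW.
Qed.

End Quadrics.

Lemma range_derive (R : realType) n (D : set 'cV[R]_n)
    (G : 'cV[R]_n -> 'cV[R]_(n + n)) u (k : 'cV[R]_n -> 'cV[R]_n) x :
  smooth_on D G ->
  (forall x i, D x -> is_derive x (evec R i) G (k x i 0 *: col i (u x))) ->
  (forall x i, D x -> k x i 0 != 0) -> D x ->
  [set v | exists X, v = 'D_X G x] = [set v | exists a, v = u x *m a].
Proof.
move=> sG dG k0 Dx; apply/seteqP; split=> v /= [X ->].
  exists (\col_i (X i 0 * k x i 0)); rewrite (derive_orthogonal sG dG X Dx).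
  by rewrite mulmx_sum_colcv; apply: eq_bigr => i _; rewrite mxE.
exists (\col_i (X i 0 / k x i 0)); rewrite (derive_orthogonal sG dG _ Dx).
rewrite mulmx_sum_colcv; apply: eq_bigr => i _; rewrite mxE divfK //.
exact: k0.
Qed.

(** * Projection of the light cone to the sphere *)

Lemma flat_metric_eq (R : realType) n (D : set 'cV[R]_n)
    (g g' : 'cV[R]_n -> 'M[R]_n) : open D -> (forall x, D x -> g x = g' x) ->
  flat_metric_on D g -> flat_metric_on D g'.
Proof.
move=> oD gg' [[sg pg] fg]; split; first split.
- exact: smooth_on_eq sg.
- by move=> x Dx; rewrite -gg' //; exact: pg.
have add3 (a b d a' b' d' : R) : a = a' -> b = b' -> d = d' ->
    a + b - d = a' + b' - d' by move=> -> -> ->.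
have chrE x l i j : D x -> christoffel g' x l i j = christoffel g x l i j.
  move=> Dx; rewrite /christoffel (gg' x Dx); congr (_ * _).
  apply: eq_bigr => p _; congr (_ * _); apply: add3;
    by apply: (derive_near _ oD Dx) => y Dy; rewrite (gg' y Dy).
move=> x Dx l k i j; apply: etrans (fg x Dx l k i j).
have add3' (a b d a' b' d' : R) : a = a' -> b = b' -> d = d' ->
    a - b + d = a' - b' + d' by move=> -> -> ->.
apply: add3'.
- by apply: (derive_near _ oD Dx) => y Dy; exact: chrE.
- by apply: (derive_near _ oD Dx) => y Dy; exact: chrE.
- by apply: eq_bigr => p _; rewrite !(chrE _ _ _ _ Dx).
Qed.

(** The projection to the sphere of the map [N c] into the light cone: [phi] is
    the multiple of [N c] with [(phi, t0) = -1], and [f] is [phi - t0]. *)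
Section SphericalProjection.
Variables (R : realType) (n : nat) (D : set 'cV[R]_n).
Variables (e N : 'cV[R]_n -> 'M[R]_(n + n, n)) (K : 'cV[R]_n -> 'M[R]_n).
Variables (c : 'cV[R]_n) (t0 : 'cV[R]_(n + n)).
Local Notation I2 := (lorentz R (n + n)).
Local Notation F := (fun x => N x *m c).
Local Notation h := (fun x => K x *m c).
Hypothesis oD : open D.
Hypothesis hf : parallel_frame D e N K.
Hypothesis c0 : c != 0.
Hypothesis cc : bil c c = 0.
Hypothesis tt : bil t0 t0 = -1.
Hypothesis h0 : forall x i, D x -> h x i 0 != 0.

Lemma frame_neq0 x : D x -> F x != 0.
Proof.
case: (hf) => _ _ alg _ /alg[_ NN _ _]; apply: contra c0 => /eqP Nc.
by rewrite -[c]mul1mx -(mul_lorentz R n) -NN -!mulmxA Nc !mulmx0.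
Qed.

Lemma frame_height_neq0 x : D x -> bil (F x) t0 != 0.
Proof.
move=> Dx; rewrite bilC; apply: timelike_null; rewrite ?tt ?ltrN10 //.
  by rewrite (frame_NN hf).
exact: frame_neq0.
Qed.

(** The factor that normalises [(N c, t0)] to -1. *)
Definition height_factor x : R := - (bil (F x) t0)^-1.
Local Notation m := height_factor.
Variable phi : 'cV[R]_n -> 'cV[R]_(n + n).
Hypothesis phiE : forall x, phi x = m x *: F x.

Lemma height_factor_neq0 x : D x -> m x != 0.
Proof. by move=> Dx; rewrite oppr_eq0 invr_eq0 frame_height_neq0. Qed.

Lemma lift_t0 x : D x -> bil (phi x) t0 = -1.
Proof. by move=> Dx; rewrite phiE bilZl mulNr mulVf ?frame_height_neq0. Qed.

Lemma lift_null x : D x -> bil (phi x) (phi x) = 0.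
Proof. by move=> Dx; rewrite phiE bilZl bilZr (frame_NN hf) // cc !mulr0. Qed.

Lemma lift_N x b : D x -> bil (phi x) (N x *m b) = m x * bil c b.
Proof. by move=> Dx; rewrite phiE bilZl (frame_NN hf). Qed.

Lemma frame_lift_orth x i : D x -> bil (col i (e x)) (phi x) = 0.
Proof. by move=> Dx; rewrite phiE bilZr (frame_eN hf) // mulr0. Qed.

Lemma frame_ee x i j : D x -> bil (col i (e x)) (col j (e x)) = (i == j)%:R.
Proof. by case: (hf) => _ _ alg _ Dx; have [ee _ _ _] := alg x Dx; rewrite bil_col ee mxE. Qed.

(** The orthonormal directions [e_i + (e_i, t0) phi] of the derivatives of
    [f]: the [e_i] projected along [phi] to the orthogonal complement of
    [t0]. *)
Definition spherical_frame x : 'M[R]_(n + n, n) :=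
  e x + phi x *m (t0^T *m I2 *m e x).
Local Notation u := spherical_frame.

Lemma col_spherical x i :
  col i (u x) = col i (e x) + bil t0 (col i (e x)) *: phi x.
Proof.
rewrite !colE mulmxDl -mulmxA -(mulmxA (t0^T *m I2)); congr (_ + _).
by rewrite mx11_bil mul_mx_scalar.
Qed.

Lemma spherical_orthonormal x : D x -> (u x)^T *m I2 *m u x = 1%:M.
Proof.
move=> Dx; apply/matrixP => i j; rewrite -bil_col !col_spherical mxE.
rewrite !(bilDl, bilDr, bilZl, bilZr) lift_null // frame_ee // (bilC (phi x)) !frame_lift_orth //.
by rewrite !mulr0 !addr0.
Qed.

Lemma spherical_frame_lift x i : D x -> bil (col i (u x)) (phi x) = 0.
Proof.
by move=> Dx; rewrite col_spherical bilDl bilZl frame_lift_orth // lift_null // mulr0 addr0.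
Qed.

Lemma spherical_frame_t0 x i : D x -> bil (col i (u x)) t0 = 0.
Proof.
move=> Dx; rewrite col_spherical bilDl bilZl lift_t0 // mulrN1.
by rewrite [bil t0 _]bilC subrr.
Qed.

Lemma lift_derive x i : D x ->
  is_derive x (evec R i) phi ((m x *: h x) i 0 *: col i (u x)).
Proof.
move=> Dx; have dF := frame_derive hf c i Dx.
have d0 := is_derive_cstf t0 x (evec R i).
have dm0 := is_derive_bil dF d0.
have f0 := frame_height_neq0 Dx.
have dm : is_derive x (evec R i) (fun y => - (bil (F y) t0)^-1 : R)
    (m x ^+ 2 * (h x i 0 * bil (col i (e x)) t0)).
  have H := is_deriveMf (is_derive_cstf (-1 : R) x (evec R i))
    (is_deriveVf (f := fun y => bil (F y) t0) f0 dm0).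
  have -> : m x ^+ 2 * (h x i 0 * bil (col i (e x)) t0) =
    0 * (bil (F x) t0)^-1 + -1 * (- (bil (h x i 0 *: col i (e x)) t0 +
      bil (F x) 0) / bil (F x) t0 ^+ 2).
    rewrite bilZl bil0r addr0 mul0r add0r mulN1r mulNr opprK /m sqrrN exprVn.
    by rewrite mulrC.
  have -> : (fun y => - (bil (F y) t0)^-1) = (fun y => -1 * (bil (F y) t0)^-1).
    by apply/funext => y; rewrite mulN1r.
  exact: H.
have := is_derive_scalemx dm dF.
set d1 := _ + _ => H; have -> : (m x *: h x) i 0 *: col i (u x) = d1.
  2: by apply: (is_derive_near oD Dx _ H) => y _; rewrite phiE.
rewrite /d1 col_spherical phiE mxE scalerDr !scalerA [in RHS]addrC.
congr (_ *: _ + _ *: _); rewrite (bilC t0) expr2.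
by move: (m x) ((K x *m c) i 0) (bil _ _) => a b d; ring.
Qed.

Lemma height_smooth : smooth_on D (fun x => bil (F x) t0 : R^o).
Proof.
by apply: smooth_on_bil => //; [exact: (frame_smooth oD hf)|exact: smooth_on_cst].
Qed.

Lemma lift_smooth : smooth_on D phi.
Proof.
apply: (smooth_on_eq oD (F := fun x => m x *: F x)).
  by move=> x _; rewrite phiE.
apply: smooth_on_scalemx => //; last exact: (frame_smooth oD hf).
apply: (smooth_on_eq oD (F := fun x => -1 * (bil (F x) t0)^-1 : R^o)).
  by move=> x _; rewrite mulN1r.
apply: smooth_onM => //; first exact: smooth_on_cst.
by apply: smooth_onV height_smooth => // x; exact: frame_height_neq0.
Qed.

Variable f : 'cV[R]_n -> 'cV[R]_(n + n).
Hypothesis fE : forall x, D x -> f x = phi x - t0.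

Lemma spherical_smooth : smooth_on D f.
Proof.
apply: (smooth_on_eq oD (F := fun x => phi x + - t0)).
  by move=> x Dx; rewrite fE.
by apply: smooth_onD => //; [exact: lift_smooth|exact: smooth_on_cst].
Qed.

Lemma spherical_derive x i : D x ->
  is_derive x (evec R i) f ((m x *: h x) i 0 *: col i (u x)).
Proof.
move=> Dx; apply: (is_derive_near oD Dx (f := fun x => phi x - t0)).
  by move=> y Dy; rewrite fE.
have := is_deriveBf (lift_derive i Dx) (is_derive_cstf t0 x (evec R i)).
by rewrite subr0.
Qed.

Lemma spherical_speed_neq0 x i : D x -> (m x *: h x) i 0 != 0.
Proof. by move=> Dx; rewrite mxE mulf_neq0 ?height_factor_neq0 ?h0. Qed.

Lemma spherical_immersion : immersion_on D f.
Proof.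
split; first exact: spherical_smooth.
apply/(immersive_orthogonal spherical_smooth spherical_orthonormal
  spherical_derive) => x i; exact: spherical_speed_neq0.
Qed.

Lemma spherical_sphere x : D x -> sphere t0 (f x).
Proof.
move=> Dx; rewrite /sphere /= fE // !(bilBl, bilBr) lift_null // lift_t0 // tt.
by rewrite (bilC t0) lift_t0 //; split; ring.
Qed.

Lemma spherical_frame_orth x i : D x -> bil (col i (u x)) (f x) = 0.
Proof. by move=> Dx; rewrite fE // bilBr spherical_frame_lift // spherical_frame_t0 // subr0. Qed.

(** The normals of [f] inside the sphere are the normals of [N c] that are
    orthogonal to [N c] and to [t0]. *)
Lemma spherical_normal x xi : D x ->
  normal_at (tan_sphere t0) f x xi <->
  exists b, [/\ xi = N x *m b, bil b c = 0 & bil (N x *m b) t0 = 0].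
Proof.
move=> Dx; have nP xi' := normal_orthogonal spherical_smooth spherical_derive
  spherical_speed_neq0 xi' Dx.
split=> [[[xt xf] /nP hxi]|[b [-> bc bt]]].
  have xphi : bil xi (phi x) = 0 by move: xf; rewrite fE // bilBr xt subr0.
  have xe i : bil (col i (e x)) xi = 0.
    have := hxi i; rewrite col_spherical bilDl bilZl (bilC (phi x)) xphi mulr0.
    by rewrite addr0.
  have [b xiE] : exists b, xi = N x *m b.
    by eexists; exact: (frame_decomp hf Dx xe).
  exists b; rewrite -xiE; split=> //.
  move: xphi; rewrite xiE bilC lift_N // bilC => /eqP.
  by rewrite mulf_eq0 (negbTE (height_factor_neq0 Dx)) => /eqP.
split; first split=> //.
  by rewrite fE // bilBr bt bilC lift_N // bilC bc mulr0 subr0.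
apply/nP => i; rewrite col_spherical bilDl bilZl lift_N //.
by rewrite (frame_eN hf) // (bilC c) bc !mulr0 addr0.
Qed.

(** For [b] orthogonal to [c], a parallel normal field of [f] in the sphere. It
    equals [N b] wherever [N b] is orthogonal to [t0]. *)
Let nu b y := N y *m b + bil (N y *m b) t0 *: phi y.

Let u_nu b y i : D y -> bil b c = 0 -> bil (col i (u y)) (nu b y) = 0.
Proof.
move=> Dy bc; rewrite /nu bilDr bilZr spherical_frame_lift // mulr0 addr0.
by rewrite col_spherical bilDl bilZl (frame_eN hf) // lift_N // (bilC c) bc !mulr0 addr0.
Qed.

Let dnu b y i : D y -> is_derive y (evec R i) (nu b)
  ((K y *m b) i 0 *: col i (e y) +
   ((K y *m b) i 0 * bil (col i (e y)) t0 *: phi y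
    + bil (N y *m b) t0 *: ((m y *: h y) i 0 *: col i (u y)))).
Proof.
move=> Dy; have dN := frame_derive hf b i Dy.
apply: is_deriveDf => //.
have dt := is_derive_bil dN (is_derive_cstf t0 y (evec R i)).
have := is_derive_scalemx dt (lift_derive i Dy).
by rewrite bilZl bil0r addr0.
Qed.

Lemma spherical_shape_op x b : D x -> bil b c = 0 -> bil (N x *m b) t0 = 0 ->
  shape_op f x (N x *m b) =
  diag_mx (\row_i - ((K x *m b) i 0 / (m x *: h x) i 0)).
Proof.
move=> Dx bc bt; have nux : nu b x = N x *m b by rewrite /nu bt scale0r addr0.
rewrite -{1}nux; apply: (shape_op_orthogonal oD spherical_smooth
  spherical_orthonormal spherical_derive spherical_speed_neq0 Dx (dnu := fun i => _) (fun y i Dy => u_nu i Dy bc) (fun i => dnu b i Dx)).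
move=> i j; rewrite bt scale0r addr0 bilDr !bilZr spherical_frame_lift // mulr0 addr0.
rewrite col_spherical bilDl bilZl (bilC (phi x)) frame_lift_orth // mulr0 addr0 frame_ee //.
by rewrite mulr_natr.
Qed.

Lemma spherical_flat_normal_bundle : flat_normal_bundle (tan_sphere t0) D f.
Proof.
move=> x xi0 Dx /(spherical_normal _ Dx) [b [-> bc bt]].
exists (nu b); first by rewrite /nu bt scale0r addr0.
apply: filterS (open_nbhs_nbhs (conj oD Dx)) => y Dy; split.
- have snu : smooth_on D (nu b).
    apply: smooth_onD => //; first exact: (frame_smooth oD hf).
    apply: smooth_on_scalemx lift_smooth => //.
    by apply: smooth_on_bil => //; [exact: (frame_smooth oD hf)|exact: smooth_on_cst].
  exact: smooth_on_diff snu Dy.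
- have nt : bil (nu b y) t0 = 0 by rewrite bilDl bilZl lift_t0 // mulrN1 subrr.
  have np : bil (nu b y) (phi y) = 0.
    by rewrite bilDl bilZl lift_null // mulr0 addr0 bilC lift_N // bilC bc mulr0.
  split; first by split=> //; rewrite fE // bilBr nt np subr0.
  apply/(normal_orthogonal spherical_smooth spherical_derive
    spherical_speed_neq0 _ Dy) => i; exact: u_nu.
- move=> X v /(spherical_normal _ Dy) [b' [-> bc' bt']].
  rewrite derive_coord; last first.
    have snu : smooth_on D (nu b).
      apply: smooth_onD => //; first exact: (frame_smooth oD hf).
      apply: smooth_on_scalemx lift_smooth => //.
      by apply: smooth_on_bil => //; [exact: (frame_smooth oD hf)|exact: smooth_on_cst].
    exact: smooth_on_diff snu Dy.
  rewrite bil_suml big1 // => i _; have [_ ->] := dnu b i Dy.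
  rewrite bilZl !bilDl !bilZl (frame_eN hf) // lift_N // (bilC c) bc' col_spherical.
  by rewrite bilDl bilZl (frame_eN hf) // lift_N // (bilC c) bc' !(mulr0, addr0).
Qed.

(** When [n > 2] the curvature directions of [f] are the coordinate ones; when
    [n = 2] the image is open in the sphere and every direction is principal. *)
Lemma spherical_principal x X : D x ->
  principal_at (tan_sphere t0) f x X <-> X != 0 /\
  forall i j, X i 0 != 0 -> X j 0 != 0 -> i != j -> forall l, l = i \/ l = j.
Proof.
move=> Dx; split=> -[X0 hX]; split=> //.
  move=> i j Xi Xj ij l.
  have [|li] := eqVneq l i; first by left.
  have [|lj] := eqVneq l j; first by right.
  exfalso; have hi := h0 i Dx; have hj := h0 j Dx; have hl := h0 l Dx.
  (* A normal of [N c] with distinct principal curvatures in the i-th and j-th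
     directions: [y] is Lorentz orthogonal to [h], and its l-th component makes
     that possible without using the j-th one. The multiple of [c] added below
     makes the normal orthogonal to [t0]. *)
  pose y : 'cV[R]_n := (h x i 0)^-1 *: (lorentz R n i i *: delta_mx i 0)
    - (h x l 0)^-1 *: (lorentz R n l l *: delta_mx l 0).
  pose b1 := lorentz R n *m (K x)^T *m lorentz R n *m y.
  have Kb1 : K x *m b1 = y by exact: (frame_KV hf).
  have sq p : lorentz R n p p * lorentz R n p p = 1.
    by rewrite lorentzE eqxx; case: ifP => _; rewrite mulr1n ?mulrNN mulr1.
  have b1c : bil b1 c = 0.
    rewrite -(frame_KK hf b1 c Dx) Kb1 /y bilBl !bilZl !bil_delta_l.
    by rewrite !(mulrA (lorentz R n _ _)) !sq !mul1r !mulVf // subrr.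
  pose r := - (bil (N x *m b1) t0 / bil (F x) t0).
  pose b := b1 + r *: c.
  have bc : bil b c = 0 by rewrite bilDl bilZl b1c cc mulr0 addr0.
  have bt : bil (N x *m b) t0 = 0.
    rewrite mulmxDr -scalemxAr bilDl bilZl /r mulNr divfK ?frame_height_neq0 //.
    by rewrite subrr.
  have [|kap] := hX (N x *m b).
    by apply/spherical_normal => //; exists b.
  rewrite spherical_shape_op // => E.
  have := diag_eigen E Xi; rewrite -(diag_eigen E Xj).
  have -> : K x *m b = y + r *: h x by rewrite mulmxDr -scalemxAr Kb1.
  have mx := height_factor_neq0 Dx.
  have yi : y i 0 = (h x i 0)^-1 * lorentz R n i i.
    rewrite /y; move: (h x) => hx; rewrite !mxE !eqxx !mulr1n (eq_sym i) (negbTE li).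
    by rewrite !mulr0 subr0 mulr1.
  have yj : y j 0 = 0.
    rewrite /y; move: (h x) => hx; rewrite !mxE !eqxx (eq_sym j) (negbTE ij).
    by rewrite (eq_sym j) (negbTE lj) !mulr0 subr0.
  move: yi yj hi hj; clearbody y; move: (h x) => hx yi yj hi hj.
  rewrite !mxE yi yj => /oppr_inj E2.
  have : lorentz R n i i / (hx i 0 ^+ 2 * m x) = 0.
    have -> : lorentz R n i i / (hx i 0 ^+ 2 * m x) =
      ((hx i 0)^-1 * lorentz R n i i + r * hx i 0) / (m x * hx i 0)
      - r / m x by field; rewrite mx hi.
    rewrite E2; field; by rewrite mx hj.
  move/(congr1 (fun z => lorentz R n i i * z)); rewrite mulrA sq mulr0 div1r.
  by move/eqP; rewrite invr_eq0 mulf_eq0 expf_eq0 /= (negbTE hi) (negbTE mx).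
move=> xi /(spherical_normal _ Dx) [b [-> bc bt]].
have /cV0Pn [i Xi] := X0.
exists (- ((K x *m b) i 0 / (m x *: h x) i 0)); rewrite spherical_shape_op //.
apply: eigen_diag => j Xj.
have [->|ij] := eqVneq i j; first by move: (K x *m b) (m x *: h x) => p q; rewrite mxE.
have all_ij := hX i j Xi Xj ij.
have hi := h0 i Dx; have hj := h0 j Dx.
have b1 : bil (K x *m b) (h x) = 0 by rewrite (frame_KK hf).
have b2 : bil (h x) (h x) = 0 by rewrite (frame_KK hf).
have mx := height_factor_neq0 Dx.
move: b1 b2 hi hj; move: (K x *m b) (h x) => y hx b1 b2 hi hj.
(* Here [n = 2], and [y], [h] are orthogonal to the null vector [h] of a
   Lorentzian plane, hence parallel. *)
have two (v w : 'cV[R]_n) : bil v w = lorentz R n i i * (v i 0 * w i 0)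
    + lorentz R n j j * (v j 0 * w j 0).
  rewrite bil_sumE (bigD1 i) //= (bigD1 j) 1?eq_sym //= big1 ?addr0 // => l.
  by case: (all_ij l) => ->; rewrite eqxx // andbF.
move: b1 b2; rewrite !two => b1 b2.
have Ji : lorentz R n i i != 0.
  by rewrite lorentzE eqxx; case: ifP => _; rewrite mulr1n ?oppr_eq0 oner_eq0.
rewrite !mxE; congr (- _).
have E : lorentz R n i i * hx i 0 * (y i 0 * hx j 0 - y j 0 * hx i 0) = 0.
  have -> : lorentz R n i i * hx i 0 * (y i 0 * hx j 0 - y j 0 * hx i 0) =
    hx j 0 * (lorentz R n i i * (y i 0 * hx i 0) + lorentz R n j j * (y j 0 * hx j 0))
    - y j 0 * (lorentz R n i i * (hx i 0 * hx i 0) + lorentz R n j j * (hx j 0 * hx j 0)).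
    by ring.
  by rewrite b1 b2 !mulr0 subr0.
move/eqP: E; rewrite !mulf_eq0 (negbTE Ji) (negbTE hi) /= subr_eq0 => /eqP E.
have -> : y j 0 = y i 0 * hx j 0 / hx i 0 by rewrite E mulfK.
by field; rewrite mx hi hj.
Qed.

(** The induced metric of [f] is that of the flat map [N c] divided by
    [(N c, t0)^2]. *)
Lemma spherical_conformally_flat : conformally_flat_on D f.
Proof.
exists (fun x => 2^-1 * ln ((bil (F x) t0) ^+ 2)); split.
  apply: smooth_onM => //; first exact: smooth_on_cst.
  apply: smooth_on_ln => //.
    by move=> x Dx; rewrite exprn_even_gt0 // frame_height_neq0.
  apply: (smooth_on_eq oD (F := fun x => bil (F x) t0 * bil (F x) t0 : R^o)).
    by move=> x _; rewrite expr2.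
  by apply: smooth_onM => //; exact: height_smooth.
apply: flat_metric_eq (frame_flat_metric oD hf h0) => // x Dx.
have dF y i (Dy : D y) := frame_derive hf c i Dy.
have ee y : D y -> (e y)^T *m I2 *m e y = 1%:M.
  by case: (hf) => _ _ alg _ /alg[].
rewrite (first_form_orthogonal (frame_smooth oD hf c) ee dF Dx).
rewrite (first_form_orthogonal spherical_smooth spherical_orthonormal spherical_derive Dx).
have f2 : 0 < bil (F x) t0 ^+ 2 by rewrite exprn_even_gt0 //= frame_height_neq0.
rewrite mulrA divff ?pnatr_eq0 // mul1r lnK //.
have f0 := frame_height_neq0 Dx.
apply/matrixP => i j; rewrite !mxE mulrnAr; congr (_ *+ _).
by rewrite /m; field.
Qed.

End SphericalProjection.

(** * Simple elements as reflections *)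

Lemma daddv_pi_id0 (K : fieldType) (vT : vectType K) (U W : {vspace vT}) v :
  (U :&: W = 0)%VS -> v \in W -> daddv_pi U W v = 0.
Proof.
move=> UW vW; have WU : (W :&: U = 0)%VS by rewrite capvC.
have := daddv_pi_add UW (subvP (addvSr U W) _ vW).
rewrite (daddv_pi_id WU vW) => E; apply: (addIr v).
by rewrite E add0r.
Qed.

Lemma mximg_line (K : fieldType) m (A : 'M[K]_m) v :
  mximg A <[v]>%VS = <[A *m v]>%VS.
Proof. by rewrite /mximg limg_line lfunE. Qed.

Lemma lin3_lfunE (K : fieldType) (vT : vectType K) (f g h : 'End(vT)) s t u :
  (s *: f + g + t *: h) u = s *: f u + g u + t *: h u.
Proof. by rewrite !lfunE /= !lfunE /= !lfunE. Qed.

Section SimpleElements.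
Variables (R : realType) (n : nat).
Local Notation C := R[i].
Local Notation VC := 'cV[C]_(n + n).
Variables (alpha : C) (m : VC).
Local Notation rm := (rho C n *m m).
Hypothesis mm : bil m m = 0.
Hypothesis D0 : bil m rm != 0.

Lemma rho_mul_col (x1 x2 : 'cV[C]_n) :
  rho C n *m col_mx x1 x2 = col_mx x1 (- x2).
Proof.
by rewrite mul_block_col !mul1mx !mul0mx addr0 add0r mulNmx mul1mx.
Qed.

Lemma bil_rho (x y : VC) : bil (rho C n *m x) (rho C n *m y) = bil x y.
Proof.
rewrite -[x]vsubmxK -[y]vsubmxK !rho_mul_col !bil_col_mx bilNl bilNr opprK.
by [].
Qed.

Let rr : bil rm rm = 0. Proof. by rewrite bil_rho. Qed.

Let rmm : bil rm m = bil m rm. Proof. exact: bilC. Qed.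

(** The simple element acts by scaling the components along [m] and [rho m]. *)
Lemma simple_eltE lambda (u : VC) :
  simple_elt alpha <[m]>%VS lambda u =
  u + ((lambda - alpha) / (lambda + alpha) - 1) *: ((bil u rm / bil m rm) *: m)
    + ((lambda + alpha) / (lambda - alpha) - 1) *: ((bil u m / bil m rm) *: rm).
Proof.
rewrite /simple_elt mximg_line.
set L := <[m]>%VS; set rL := <[rm]>%VS; set P := orthv (L + rL).
set a := bil u rm / bil m rm; set b := bil u m / bil m rm.
pose p := u - a *: m - b *: rm.
have PE y : y \in P = (bil m y == 0) && (bil rm y == 0).
  apply/mem_orthv/andP => [h|[/eqP h1 /eqP h2] v].
    split; apply/eqP; apply: h.
      by apply: subvP (addvSl _ _) _ _; exact: memv_line.
    by apply: subvP (addvSr _ _) _ _; exact: memv_line.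
  move=> /memv_addP [v1 /vlineP [k1 ->]] [v2 /vlineP [k2 ->]] ->.
  by rewrite bilDl !bilZl h1 h2 !mulr0 addr0.
have pP : p \in P.
  rewrite PE; apply/andP; split; apply/eqP; rewrite /p !bilBr !bilZr.
    by rewrite mm mulr0 subr0 /b divfK // bilC subrr.
  by rewrite rr mulr0 subr0 rmm /a divfK // bilC subrr.
have uE : u = a *: m + p + b *: rm by rewrite -addrA /p subrK addrC subrK.
have hL : (L :&: (P + rL) = 0)%VS.
  apply/eqP; rewrite -subv0; apply/subvP => y; rewrite memv_cap => /andP[].
  move=> /vlineP [k1 ->] /memv_addP [y1 y1P [y2 /vlineP [k2 ->] E]].
  have := congr1 (bil rm) E; move: y1P; rewrite PE => /andP[_ /eqP y1r].
  rewrite bilDr !bilZr y1r rr mulr0 addr0 rmm => /eqP.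
  by rewrite mulf_eq0 (negbTE D0) orbF => /eqP ->; rewrite scale0r mem0v.
have hR : (rL :&: (L + P) = 0)%VS.
  apply/eqP; rewrite -subv0; apply/subvP => y; rewrite memv_cap => /andP[].
  move=> /vlineP [k1 ->] /memv_addP [y2 /vlineP [k2 ->] [y1 y1P E]].
  have := congr1 (bil m) E; move: y1P; rewrite PE => /andP[/eqP y1r _].
  rewrite bilDr !bilZr y1r mm mulr0 addr0 => /eqP.
  by rewrite mulf_eq0 (negbTE D0) orbF => /eqP ->; rewrite scale0r mem0v.
have hP : (P :&: (L + rL) = 0)%VS.
  apply/eqP; rewrite -subv0; apply/subvP => y; rewrite memv_cap PE => /andP[].
  move=> /andP[/eqP y1 /eqP y2].
  move=> /memv_addP [v1 /vlineP [k1 ->]] [v2 /vlineP [k2 ->] E].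
  move: y1 y2; rewrite E !bilDr !bilZr mm rr !mulr0 add0r addr0 rmm.
  move=> /eqP; rewrite mulf_eq0 (negbTE D0) orbF => /eqP ->.
  move=> /eqP; rewrite mulf_eq0 (negbTE D0) orbF => /eqP ->.
  by rewrite !scale0r addr0 mem0v.
have aL : a *: m \in L by rewrite memvZ // memv_line.
have bR : b *: rm \in rL by rewrite memvZ // memv_line.
have piL : daddv_pi L (P + rL) u = a *: m.
  rewrite {1}uE -addrA linearD /= daddv_pi_id // daddv_pi_id0 ?addr0 //.
  exact: memv_add.
have piR : daddv_pi rL (L + P) u = b *: rm.
  rewrite {1}uE linearD /= daddv_pi_id0 ?add0r ?daddv_pi_id //.
  exact: memv_add.
have piP : daddv_pi P (L + rL) u = p.
  have -> : u = p + (a *: m + b *: rm).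
    by rewrite [LHS]uE (addrC (a *: m)) -addrA.
  rewrite linearD /= daddv_pi_id // daddv_pi_id0 ?addr0 //.
  exact: memv_add.
move: piL piR piP; move: (daddv_pi L _) (daddv_pi rL _) (daddv_pi P _).
move: ((lambda - alpha) / _) ((lambda + alpha) / _) => s t f1 f3 f2 E1 E3 E2.
refine (etrans (lin3_lfunE f1 f2 f3 s t u) _); rewrite E1 E2 E3 /p.
by rewrite !scalerBl !scale1r; apply/matrixP => i j; rewrite !mxE; ring.
Qed.

Hypothesis a1 : alpha != 1.
Hypothesis aN1 : alpha != -1.

(** For [alpha] distinct from 1 and -1 the simple element at 1 is invertible. *)
Lemma simple_elt1_inv (x y : VC) : simple_elt alpha <[m]>%VS 1 x = y ->
  (simple_elt alpha <[m]>%VS 1)^-1%VF y = x.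
Proof.
have n1 : 1 - alpha != 0 by rewrite subr_eq0 eq_sym.
have n2 : 1 + alpha != 0 by rewrite addrC addr_eq0.
move=> <-; apply: lker0_lfunK; rewrite -subv0; apply/subvP => u.
rewrite memv_ker => /eqP u0; rewrite memv0.
have E := simple_eltE 1 u; rewrite u0 in E.
have h1 : bil u rm = 0.
  have /esym/eqP := congr1 (fun v => bil v rm) E.
  rewrite 2!bilDl 4!bilZl bil0l rr !mulr0 addr0 (divfK D0).
  rewrite -[X in X + _]mul1r -mulrDl addrC subrK mulf_eq0 mulf_eq0 invr_eq0.
  by rewrite (negbTE n1) (negbTE n2) => /eqP.
have h2 : bil u m = 0.
  have /esym/eqP := congr1 (fun v => bil v m) E.
  rewrite 2!bilDl 4!bilZl bil0l mm !mulr0 addr0 rmm (divfK D0).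
  rewrite -[X in X + _]mul1r -mulrDl addrC subrK mulf_eq0 mulf_eq0 invr_eq0.
  by rewrite (negbTE n1) (negbTE n2) => /eqP.
by move: E; rewrite h1 h2 !mul0r !scale0r !scaler0 !addr0 => <-.
Qed.

End SimpleElements.

(** With [m = (w, alpha z)], the values at 0 and 1 of the simple element act on
    the two factors of the splitting through the reflection in [q = (w, z)]. *)
Section SimpleReflection.
Variables (R : realType) (n : nat).
Local Notation C := R[i].
Local Notation VC := 'cV[C]_(n + n).
Variables (alpha : C) (w z : 'cV[C]_n).
Hypothesis a0 : alpha != 0.
Hypothesis a1 : alpha != 1.
Hypothesis aN1 : alpha != -1.
Local Notation W := ((w^T *m w) 0 0).
Hypothesis W0 : W != 0.
Hypothesis Wz : W + alpha ^+ 2 * bil z z = 0.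
Local Notation m := (col_mx w (alpha *: z)).
Local Notation q := (col_mx w z).

Let n1 : 1 - alpha != 0. Proof. by rewrite subr_eq0 eq_sym. Qed.
Let n2 : 1 + alpha != 0. Proof. by rewrite addrC addr_eq0. Qed.

Let mm : bil m m = 0.
Proof. by rewrite bil_col_mx bilZl bilZr mulrA -expr2. Qed.

Let mrm : bil m (rho C n *m m) = 2 * W.
Proof.
rewrite rho_mul_col bil_col_mx bilNr bilZl bilZr mulrA -expr2.
have -> : alpha ^+ 2 * bil z z = - W by apply/eqP; rewrite -addr_eq0 addrC Wz.
by rewrite opprK; ring.
Qed.

Let D0 : bil m (rho C n *m m) != 0.
Proof. by rewrite mrm mulf_neq0 // pnatr_eq0. Qed.

Let zz : bil z z = - W / alpha ^+ 2.
Proof.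
apply: (mulfI (expf_neq0 2 a0)); rewrite mulrCA divff ?expf_neq0 // mulr1.
by apply/eqP; rewrite -addr_eq0 addrC Wz.
Qed.

Lemma bil_qq : bil q q = W * (1 - (alpha ^+ 2)^-1).
Proof. by rewrite bil_col_mx zz; ring. Qed.

Let na : alpha ^+ 2 - 1 != 0.
Proof. by rewrite subr_eq0 sqrf_eq1 negb_or a1. Qed.

Let col_eq (x1 x2 y1 y2 : 'cV[C]_n) :
  (forall i, x1 i 0 = y1 i 0) -> (forall i, x2 i 0 = y2 i 0) ->
  col_mx x1 x2 = col_mx y1 y2.
Proof. by move=> h1 h2; congr col_mx; apply/colP. Qed.

Lemma simple_elt_upper (x : 'cV[C]_n) :
  (simple_elt alpha <[m]>%VS 1)^-1%VF (col_mx x 0) =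
  col_mx x 0 - (2 * bil q (col_mx x 0) / bil q q) *: q.
Proof.
apply: (simple_elt1_inv mm D0 a1 aN1); rewrite (simple_eltE _ mm D0) mrm bil_qq.
have xw : (x^T *m w) 0 0 = (w^T *m x) 0 0.
  have -> : x^T *m w = (w^T *m x)^T by rewrite trmx_mul trmxK.
  by rewrite mxE.
rewrite !bilBl !bilZl !rho_mul_col !bil_col_mx !bilNr !bilZr bil0l bil0r zz xw.
rewrite !(scale_col_mx, opp_col_mx, add_col_mx).
have h1 := n1; have h2 := n2; have h3 := na; have h4 := W0; have h5 := a0.
move: h4; move: W ((w^T *m x) 0 0) => W' t h4.
by apply: col_eq => i; rewrite !mxE; field; rewrite h1 h2 h3 h4 h5.
Qed.

Lemma simple_elt_lower (x : 'cV[C]_n) :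
  (simple_elt alpha <[m]>%VS 1)^-1%VF
    (simple_elt alpha <[m]>%VS 0 (col_mx 0 x)) =
  col_mx 0 x - (2 * bil q (col_mx 0 x) / bil q q) *: q.
Proof.
rewrite (simple_eltE alpha mm D0 0).
apply: (simple_elt1_inv mm D0 a1 aN1).
rewrite (simple_eltE alpha mm D0 1) mrm bil_qq.
rewrite !bilBl !bilZl !rho_mul_col !bil_col_mx !bilNr !bilZr !trmx0 !mul0mx.
have z00 : (0 : 'M[C]_1) 0 0 = 0 by rewrite mxE.
rewrite !mulmx0 !z00 zz (bilC x).
rewrite !(scale_col_mx, opp_col_mx, add_col_mx).
have h1 := n1; have h2 := n2; have h3 := na; have h4 := W0; have h5 := a0.
move: h4; move: W (bil z x) => W' t h4.
by apply: col_eq => i; rewrite !mxE; field; rewrite h1 h2 h3 h4 h5.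
Qed.

End SimpleReflection.

(** * Extended flat frames *)

Lemma delta_lshift (K : nzRingType) m (i : 'I_m) :
  delta_mx (lshift m i) 0 = col_mx (delta_mx i 0) 0 :> 'cV[K]_(m + m).
Proof.
apply/colP => k; case: (split_ordP k) => j ->; rewrite ?col_mxEu ?col_mxEd !mxE.
  by rewrite (inj_eq (@lshift_inj _ _)).
by rewrite eq_rlshift.
Qed.

Section ComplexMatrices.
Variable R : realType.
Local Notation C := R[i].

Lemma toCE p q (A : 'M[R]_(p, q)) i j : toC A i j = (A i j)%:C%C.
Proof. by rewrite mxE. Qed.

Lemma toCK p q : cancel (@toC R p q) (@reM R p q).
Proof. by move=> A; apply/matrixP => i j; rewrite !mxE. Qed.

Lemma toCM p q r (A : 'M[R]_(p, q)) (B : 'M[R]_(q, r)) :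
  toC (A *m B) = toC A *m toC B.
Proof. exact: map_mxM. Qed.

Lemma toCD p q (A B : 'M[R]_(p, q)) : toC (A + B) = toC A + toC B.
Proof. exact: map_mxD. Qed.

Lemma toCB p q (A B : 'M[R]_(p, q)) : toC (A - B) = toC A - toC B.
Proof. exact: map_mxB. Qed.

Lemma toCN p q (A : 'M[R]_(p, q)) : toC (- A) = - toC A.
Proof. exact: map_mxN. Qed.

Lemma toCZ p q k (A : 'M[R]_(p, q)) : toC (k *: A) = k%:C%C *: toC A.
Proof. exact: map_mxZ. Qed.

Lemma toC_tr p q (A : 'M[R]_(p, q)) : toC A^T = (toC A)^T.
Proof. by rewrite /toC map_trmx. Qed.

Lemma toC0 p q : toC (0 : 'M[R]_(p, q)) = 0.
Proof. exact: map_mx0. Qed.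

Lemma toC1 p : toC (1%:M : 'M[R]_p) = 1%:M.
Proof. exact: map_mx1. Qed.

Lemma toC_col p q r (A : 'M[R]_(p, r)) (B : 'M[R]_(q, r)) :
  toC (col_mx A B) = col_mx (toC A) (toC B).
Proof. exact: map_col_mx. Qed.

Lemma toC_block p q (A : 'M[R]_p) B D (E : 'M[R]_q) :
  toC (block_mx A B D E) = block_mx (toC A) (toC B) (toC D) (toC E).
Proof. exact: map_block_mx. Qed.

Lemma toC_delta p q i j : toC (delta_mx i j : 'M[R]_(p, q)) = delta_mx i j.
Proof. exact: map_delta_mx. Qed.

Lemma toC_lorentz p : toC (lorentz R p) = lorentz C p.
Proof.
apply/matrixP => i j; rewrite toCE !lorentzE rmorphMn /=.
by case: ifP => _; rewrite ?rmorphN rmorph1.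
Qed.

Lemma toC_inj p q : injective (@toC R p q).
Proof. exact: can_inj (@toCK p q). Qed.

Lemma bil_toC p (x y : 'cV[R]_p) : bil (toC x) (toC y) = (bil x y)%:C%C.
Proof. by rewrite /bil -toC_tr -toC_lorentz -!toCM toCE. Qed.

Lemma toC_reM p q (A : 'M[C]_(p, q)) : map_mx conjc A = A -> toC (reM A) = A.
Proof.
move=> cA; apply/matrixP => i j; rewrite !mxE.
have := congr1 (fun B : 'M[C]_(p, q) => B i j) cA; rewrite mxE.
case: (A i j) => a b /= [] hb; congr Complex.
by apply/eqP; rewrite eq_sym -eqNr hb.
Qed.

Lemma conj_toC p q (A : 'M[R]_(p, q)) : map_mx conjc (toC A) = toC A.
Proof. by apply/matrixP => i j; rewrite !mxE conjc_real. Qed.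

Lemma ReD (x y : C) : complex.Re (x + y) = complex.Re x + complex.Re y.
Proof. by case: x y => a b [c d]. Qed.

Lemma ImD (x y : C) : complex.Im (x + y) = complex.Im x + complex.Im y.
Proof. by case: x y => a b [c d]. Qed.

Lemma reM_mul p q r (A : 'M[C]_(p, q)) (B : 'M[C]_(q, r)) :
  reM (A *m B) = reM A *m reM B - imM A *m imM B.
Proof.
apply/matrixP => i j; rewrite !mxE (big_morph _ ReD (erefl _)) -sumrB.
by apply: eq_bigr => k _; rewrite !mxE; case: (A i k) (B k j) => a b [c d].
Qed.

Lemma imM_mul p q r (A : 'M[C]_(p, q)) (B : 'M[C]_(q, r)) :
  imM (A *m B) = reM A *m imM B + imM A *m reM B.
Proof.
apply/matrixP => i j; rewrite !mxE (big_morph _ ImD (erefl _)) -big_split /=.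
apply: eq_bigr => k _; rewrite !mxE.
by case: (A i k) (B k j) => a b [c d] /=.
Qed.

Lemma reM_tr p q (A : 'M[C]_(p, q)) : reM A^T = (reM A)^T.
Proof. by apply/matrixP => i j; rewrite !mxE. Qed.

Lemma imM_tr p q (A : 'M[C]_(p, q)) : imM A^T = (imM A)^T.
Proof. by apply/matrixP => i j; rewrite !mxE. Qed.

Lemma reM_partial p q (A B : 'M[R]_(p, q)) :
  reM (toC A + Complex 0 1 *: toC B) = A.
Proof. by apply/matrixP => i j; rewrite !mxE /=; ring. Qed.

Lemma imM_partial p q (A B : 'M[R]_(p, q)) :
  imM (toC A + Complex 0 1 *: toC B) = B.
Proof. by apply/matrixP => i j; rewrite !mxE /=; ring. Qed.

Variable V : normedModType R.

(** Derivative of a complex matrix valued map, through real and imaginary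
    parts. *)
Definition is_deriveC p q (x v : V) (A : V -> 'M[C]_(p, q)) dA : Prop :=
  is_derive x v (fun y => reM (A y)) (reM dA) /\
  is_derive x v (fun y => imM (A y)) (imM dA).

Lemma is_deriveC_mull p q r (B : 'M[C]_(p, q)) x v (A : V -> 'M[C]_(q, r)) dA :
  is_deriveC x v A dA -> is_deriveC x v (fun y => B *m A y) (B *m dA).
Proof.
move=> [d1 d2]; split.
  have -> : (fun y => reM (B *m A y)) = (fun y => reM B *m reM (A y) - imM B *m imM (A y)).
    by apply/funext => y; rewrite reM_mul.
  by rewrite reM_mul; apply: is_deriveBf; exact: is_derive_mulmxl.
have -> : (fun y => imM (B *m A y)) = (fun y => reM B *m imM (A y) + imM B *m reM (A y)).
  by apply/funext => y; rewrite imM_mul.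
by rewrite imM_mul; apply: is_deriveDf; exact: is_derive_mulmxl.
Qed.

Lemma is_deriveC_mulr p q r (B : 'M[C]_(q, r)) x v (A : V -> 'M[C]_(p, q)) dA :
  is_deriveC x v A dA -> is_deriveC x v (fun y => A y *m B) (dA *m B).
Proof.
move=> [d1 d2]; split.
  have -> : (fun y => reM (A y *m B)) = (fun y => reM (A y) *m reM B - imM (A y) *m imM B).
    by apply/funext => y; rewrite reM_mul.
  by rewrite reM_mul; apply: is_deriveBf; exact: is_derive_mulmxr.
have -> : (fun y => imM (A y *m B)) = (fun y => reM (A y) *m imM B + imM (A y) *m reM B).
  by apply/funext => y; rewrite imM_mul.
by rewrite imM_mul; apply: is_deriveDf; exact: is_derive_mulmxr.
Qed.

Lemma is_deriveC_tr p q x v (A : V -> 'M[C]_(p, q)) dA :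
  is_deriveC x v A dA -> is_deriveC x v (fun y => (A y)^T) dA^T.
Proof.
move=> [d1 d2]; split.
  have -> : (fun y => reM (A y)^T) = (fun y => (reM (A y))^T).
    by apply/funext => y; rewrite reM_tr.
  by rewrite reM_tr; exact: is_derive_tr.
have -> : (fun y => imM (A y)^T) = (fun y => (imM (A y))^T).
  by apply/funext => y; rewrite imM_tr.
by rewrite imM_tr; exact: is_derive_tr.
Qed.

End ComplexMatrices.

Section ExtendedFrames.
Variables (R : realType) (n : nat).
Local Notation E := 'cV[R]_n.
Local Notation C := R[i].
Local Notation I2 := (lorentz R (n + n)).
Local Notation J := (lorentz R n).

Lemma amxE (i : 'I_n) :
  amx R i = block_mx 0 (delta_mx i i *m J) (- delta_mx i i) 0.
Proof. by rewrite /amx /pmx trmx_delta. Qed.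

Lemma pmx_skew (eta : 'M[R]_n) : (pmx eta)^T *m I2 = - (I2 *m pmx eta).
Proof.
rewrite /pmx lorentz_block tr_block_mx !mulmx_block !trmx0.
rewrite !(mul0mx, mulmx0, mulmx1, mul1mx, addr0, add0r) opp_block_mx.
rewrite trmx_mul trmxK tr_lorentz mulmxN opprK oppr0.
by congr block_mx; rewrite linearN /= mulNmx.
Qed.

Lemma lie_skew (X Y : 'M[R]_(n + n)) : X^T *m I2 = - (I2 *m X) ->
  Y^T *m I2 = - (I2 *m Y) -> (lie X Y)^T *m I2 = - (I2 *m lie X Y).
Proof.
move=> hX hY; rewrite /lie linearB /= !trmx_mul mulmxBl mulmxBr -!mulmxA hX hY.
rewrite !mulmxN (mulmxA Y^T) (mulmxA X^T) hX hY !mulNmx !opprK -!mulmxA opprB.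
by [].
Qed.

Lemma lie_pmx_block (i : 'I_n) (eta : 'M[R]_n) : exists A B,
  lie (amx R i) (pmx eta) = block_mx A 0 0 B.
Proof.
rewrite /lie /amx /pmx !mulmx_block !(mul0mx, mulmx0, addr0, add0r).
by rewrite opp_block_mx add_block_mx !(oppr0, addr0); do 2 eexists.
Qed.

Variables (Xi : E -> 'M[R]_(n + n)) (Phi : C -> E -> 'M[C]_(n + n)).
Hypothesis hXi : forall x, exists eta, Xi x = pmx eta.
Hypothesis hPhi : extended_flat_frame Xi Phi.
Local Notation "'Cm' i x" := (lie (amx R i) (Xi x)) (at level 10, i, x at next level).

Lemma Cm_skew i x : (Cm i x)^T *m I2 = - (I2 *m Cm i x).
Proof. by have [eta ->] := hXi x; apply: lie_skew; exact: pmx_skew. Qed.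

Lemma Phi_orth l x :
  (Phi l x)^T *m lorentz C (n + n) *m Phi l x = lorentz C (n + n).
Proof. by case: hPhi. Qed.

(** The inverse of [Phi l x], polynomial in its entries. *)
Definition Phi_inv l x : 'M[C]_(n + n) :=
  lorentz C (n + n) *m (Phi l x)^T *m lorentz C (n + n).

Lemma Phi_invl l x : Phi_inv l x *m Phi l x = 1%:M.
Proof.
by rewrite /Phi_inv -!mulmxA (mulmxA (Phi l x)^T) Phi_orth mul_lorentz.
Qed.

Lemma Phi_unit l x : Phi l x \in unitmx.
Proof. by have [] := mulmx1_unit (Phi_invl l x). Qed.

Lemma invmx_Phi l x : invmx (Phi l x) = Phi_inv l x.
Proof.
by rewrite -[RHS]mulmx1 -(mulmxV (Phi_unit l x)) mulmxA Phi_invl mul1mx.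
Qed.

Lemma Phi_derive l x i : is_deriveC x (evec R i) (Phi l)
  (Phi l x *m (l *: toC (amx R i) + toC (Cm i x))).
Proof.
have [sP _ dP _ _] := hPhi.
have -> : Phi l x *m (l *: toC (amx R i) + toC (Cm i x)) = partialC i (Phi l) x.
  by rewrite -dP mulmxA mulmxV ?Phi_unit // mul1mx.
have [s1 s2] := sP l; rewrite /is_deriveC /partialC reM_partial imM_partial.
split; [exact: (smooth_on_derive i s1)|exact: (smooth_on_derive i s2)].
Qed.

Lemma Phi_real (k : R) x : toC (reM (Phi k%:C%C x)) = Phi k%:C%C x.
Proof. by case: hPhi => _ _ _ cP _; apply: toC_reM; rewrite cP conjc_real. Qed.

(** The real frame at a real value of the spectral parameter. *)
Definition rPhi (k : R) x := reM (Phi k%:C%C x).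

Lemma rPhi_orth k x : (rPhi k x)^T *m I2 *m rPhi k x = I2.
Proof.
apply: toC_inj; rewrite !toCM toC_tr toC_lorentz /rPhi Phi_real.
exact: Phi_orth.
Qed.

Lemma rPhi_derive k x i : is_derive x (evec R i) (rPhi k)
  (rPhi k x *m (k *: amx R i + Cm i x)).
Proof.
have [+ _] := Phi_derive k%:C%C x i.
suff -> : Phi k%:C%C x *m (k%:C%C *: toC (amx R i) + toC (Cm i x)) =
    toC (rPhi k x *m (k *: amx R i + Cm i x)) by rewrite toCK.
by rewrite toCM (toCD (k *: _)) toCZ /rPhi Phi_real.
Qed.

Lemma rPhi_smooth k : smooth_on setT (rPhi k).
Proof. by have [sP _ _ _ _] := hPhi; have [] := sP k%:C%C. Qed.

Lemma Phi_inv_derive l x i : is_deriveC x (evec R i) (Phi_inv l)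
  (- ((l *: toC (amx R i) + toC (Cm i x)) *m Phi_inv l x)).
Proof.
set M := l *: _ + _.
have skC (A : 'M[R]_(n + n)) : A^T *m I2 = - (I2 *m A) ->
    lorentz C (n + n) *m (toC A)^T = - (toC A *m lorentz C (n + n)).
  move=> sk; rewrite -toC_tr -toC_lorentz -!toCM -toCN; congr toC.
  have /(congr1 (fun B => I2 *m B *m I2)) := sk.
  by rewrite -!mulmxA mul_lorentz mulmx1 mulNmx mulmxN !mulmxA mul_lorentz mul1mx.
have sk : lorentz C (n + n) *m M^T = - (M *m lorentz C (n + n)).
  rewrite /M linearD /= linearZ /= mulmxDr -scalemxAr (skC _ (Cm_skew i x)).
  by rewrite (skC _ (pmx_skew _)) mulmxDl -scalemxAl scalerN opprD.
have := is_deriveC_mulr (lorentz C (n + n)) (is_deriveC_mull (lorentz C (n + n))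
  (is_deriveC_tr (Phi_derive l x i))).
by rewrite -/M trmx_mul mulmxA sk /Phi_inv !mulNmx !mulmxA.
Qed.

End ExtendedFrames.

Section SmoothComplex.
Variables (R : realType) (n : nat) (D : set 'cV[R]_n).
Hypothesis oD : open D.
Local Notation C := R[i].

Lemma smooth_onC_mull p q r (B : 'M[C]_(p, q)) (A : 'cV[R]_n -> 'M[C]_(q, r)) :
  smooth_onC D A -> smooth_onC D (fun x => B *m A x).
Proof.
have mull (B' : 'M[R]_(p, q)) A' : smooth_on D A' ->
    smooth_on D (fun x => B' *m A' x : 'M[R]_(p, r)).
  by move=> sA; apply: smooth_on_mulmx => //; exact: smooth_on_cst.
move=> [s1 s2]; split.
  apply: (smooth_on_eq oD
    (F := fun x => reM B *m reM (A x) + (- imM B) *m imM (A x))).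
    by move=> x _; rewrite reM_mul mulNmx.
  by apply: smooth_onD => //; exact: mull.
apply: (smooth_on_eq oD
  (F := fun x => reM B *m imM (A x) + imM B *m reM (A x))).
  by move=> x _; rewrite imM_mul.
by apply: smooth_onD => //; exact: mull.
Qed.

Lemma smooth_onC_tr p q (A : 'cV[R]_n -> 'M[C]_(p, q)) :
  smooth_onC D A -> smooth_onC D (fun x => (A x)^T).
Proof.
move=> [s1 s2]; split.
  by apply: (smooth_on_eq oD (F := fun x => (reM (A x))^T)) => [x _|];
    [rewrite reM_tr|exact: smooth_on_tr].
by apply: (smooth_on_eq oD (F := fun x => (imM (A x))^T)) => [x _|];
  [rewrite imM_tr|exact: smooth_on_tr].
Qed.

Lemma smooth_onC_mulr p q r (B : 'M[C]_(q, r)) (A : 'cV[R]_n -> 'M[C]_(p, q)) :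
  smooth_onC D A -> smooth_onC D (fun x => A x *m B).
Proof.
move=> sA; have := smooth_onC_tr (smooth_onC_mull B^T (smooth_onC_tr sA)).
by move=> [s1 s2]; split; [move: s1|move: s2]; apply: smooth_on_eq => // x _;
  rewrite trmx_mul !trmxK.
Qed.

End SmoothComplex.

(** * The dressed frame *)

Section DressingData.
Variables (R : realType) (n : nat).
Local Notation E := 'cV[R]_n.
Local Notation C := R[i].
Local Notation I2 := (lorentz R (n + n)).
Local Notation IC := (lorentz C (n + n)).
Local Notation J := (lorentz R n).
Variables (Xi : E -> 'M[R]_(n + n)) (Phi : C -> E -> 'M[C]_(n + n)).
Hypothesis hXi : forall x, exists eta, Xi x = pmx eta.
Hypothesis hPhi : extended_flat_frame Xi Phi.
Variables (g1 g2 : E -> 'M[R]_n).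
Hypothesis hg : forall x, Phi 0 x = toC (block_mx (g1 x) 0 0 (g2 x)).

Lemma reM_Phi0_inv x : reM (Phi_inv Phi 0 x) =
  block_mx (g1 x)^T 0 0 (J *m (g2 x)^T *m J).
Proof.
rewrite /Phi_inv hg -toC_tr -toC_lorentz -!toCM toCK lorentz_block.
rewrite tr_block_mx !mulmx_block !trmx0.
by rewrite !(mul0mx, mulmx0, mul1mx, mulmx1, addr0, add0r).
Qed.

Lemma g2_inv x : invmx (g2 x) = J *m (g2 x)^T *m J.
Proof.
have : J *m (g2 x)^T *m J *m g2 x = 1%:M.
  have /(congr1 (@reM R _ _)) := Phi_invl hPhi 0 x.
  rewrite hg /Phi_inv hg -toC_tr -toC_lorentz -!toCM toCK lorentz_block.
  have -> : reM (1%:M : 'M[C]_(n + n)) = 1%:M by rewrite -toC1 toCK.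
  rewrite tr_block_mx !mulmx_block !trmx0.
  rewrite !(mul0mx, mulmx0, mul1mx, mulmx1, addr0, add0r) scalar_mx_block.
  by move=> /eq_block_mx[].
move=> gI; have [_ gU] := mulmx1_unit gI.
by rewrite -[RHS]mulmx1 -(mulmxV gU) mulmxA gI mul1mx.
Qed.

(** The parallel frame of an extended flat frame: [e] consists of the first [n]
    columns of [Phi 1], and [N] of the last [n] ones turned by [g2^-1], which
    removes the connection term [lie (amx i) Xi]. *)
Definition base_e x : 'M[R]_(n + n, n) := reM (Phi 1 x) *m col_mx 1%:M 0.
Definition base_N x : 'M[R]_(n + n, n) :=
  reM (Phi 1 x) *m col_mx 0 (invmx (g2 x)).
Definition base_K x : 'M[R]_n := J *m invmx (g2 x).

Let P1orth x : (reM (Phi 1 x))^T *m I2 *m reM (Phi 1 x) = I2.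
Proof. exact: (rPhi_orth hPhi 1 x). Qed.

Let P1derive x i : is_derive x (evec R i) (fun y => reM (Phi 1 y))
  (reM (Phi 1 x) *m (amx R i + lie (amx R i) (Xi x))).
Proof. by have := rPhi_derive hPhi 1 x i; rewrite scale1r. Qed.

Let P1smooth : smooth_on setT (fun y => reM (Phi 1 y)).
Proof. exact: (rPhi_smooth hPhi 1). Qed.

Let gram p q (A : 'M[R]_(n + n, p)) (B : 'M[R]_(n + n, q)) x :
  (reM (Phi 1 x) *m A)^T *m I2 *m (reM (Phi 1 x) *m B) = A^T *m I2 *m B.
Proof.
have -> : (reM (Phi 1 x) *m A)^T *m I2 *m (reM (Phi 1 x) *m B) =
    A^T *m ((reM (Phi 1 x))^T *m I2 *m reM (Phi 1 x)) *m B.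
  by rewrite trmx_mul !mulmxA.
by rewrite P1orth.
Qed.

Lemma g2_inv_orth x : (invmx (g2 x))^T *m J *m invmx (g2 x) = J.
Proof.
have gU : g2 x \in unitmx.
  have := Phi_unit hPhi 0 x; rewrite hg unitmxE.
  rewrite /toC det_map_mx det_ublock rmorphM unitrM => /andP[_].
  by rewrite !unitfE -(rmorph0 (real_complex R)) (inj_eq (@complexI R)) unitmxE unitfE.
have gI : J *m (g2 x)^T *m J *m g2 x = 1%:M by rewrite -g2_inv mulVmx.
have gg : (g2 x)^T *m J *m g2 x = J.
  by rewrite -[RHS]mulmx1 -gI !mulmxA mul_lorentz mul1mx.
rewrite -{1}gg -!mulmxA mulmxV // mulmx1 !mulmxA -trmx_mul mulmxV //.
by rewrite trmx1 mul1mx.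
Qed.

(** [g2^-1] is smooth because it is a block of the inverse of [Phi 0]. *)
Lemma smooth_base_N : smooth_on setT base_N.
Proof.
have sg : smooth_on setT (fun x => reM (Phi_inv Phi 0 x)).
  have [s0 _ _ _ _] := hPhi.
  by have [] := smooth_onC_mulr openT IC
    (smooth_onC_mull openT IC (smooth_onC_tr openT (s0 0))).
apply: (smooth_on_eq openT
  (F := fun x => reM (Phi 1 x) *m (reM (Phi_inv Phi 0 x) *m col_mx 0 1%:M))).
  move=> x _; rewrite reM_Phi0_inv mul_block_col -g2_inv.
  by rewrite !(mul0mx, mulmx0, mulmx1, addr0, add0r).
apply: (smooth_on_mulmx openT) => //.
by apply: (smooth_on_mulmx openT); [exact: sg|exact: (smooth_on_cst openT)].
Qed.

Lemma base_frame : parallel_frame setT base_e base_N base_K.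
Proof.
split.
- by apply: (smooth_on_mulmx openT); [exact: P1smooth|exact: (smooth_on_cst openT)].
- exact: smooth_base_N.
- move=> x _; rewrite /base_e /base_N !gram !tr_col_mx lorentz_block.
  rewrite !mul_row_block !mul_row_col !trmx0 !trmx1.
  rewrite !(mul0mx, mulmx0, mul1mx, mulmx1, addr0, add0r); split=> //.
    exact: g2_inv_orth.
  rewrite /base_K trmx_mul tr_lorentz -!mulmxA (mulmxA J J) mul_lorentz mul1mx.
  by rewrite mulmxA g2_inv_orth.
- move=> x i _.
  have dInv : is_derive x (evec R i) (fun y => reM (Phi_inv Phi 0 y))
      (- (lie (amx R i) (Xi x) *m reM (Phi_inv Phi 0 x))).
    have [+ _] := Phi_inv_derive hXi hPhi 0 x i; rewrite scale0r add0r.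
    have -> : - (toC (lie (amx R i) (Xi x)) *m Phi_inv Phi 0 x) =
        toC (- (lie (amx R i) (Xi x) *m reM (Phi_inv Phi 0 x))).
      rewrite toCN toCM; congr (- (_ *m _)).
      by rewrite /Phi_inv hg -toC_tr -toC_lorentz -!toCM toCK.
    by rewrite toCK.
  have := is_derive_mulmxr (col_mx 0 1%:M : 'M[R]_(n + n, n))
    (is_derive_mulmx (P1derive x i) dInv).
  set d := (_ + _) *m _ => H.
  have NE y : reM (Phi 1 y) *m reM (Phi_inv Phi 0 y) *m col_mx 0 1%:M = base_N y.
    rewrite /base_N -mulmxA reM_Phi0_inv mul_block_col -g2_inv.
    by rewrite !(mul0mx, mulmx0, mulmx1, addr0, add0r).
  have <- : d = base_e x *m delta_mx i i *m base_K x.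
    rewrite /d mulmxDr mulmxN (mulmxDl _ _ (reM _)).
    rewrite -(mulmxA (reM (Phi 1 x)) (lie _ _)) addrK.
    rewrite amxE reM_Phi0_inv -g2_inv /base_e /base_K -!mulmxA; congr (_ *m _).
    rewrite !mul_block_col mul_col_mx.
    by rewrite !(mul0mx, mulmx0, mul1mx, mulmx1, addr0, add0r) !mulmxA.
  by apply: (is_derive_near openT _ _ H) => // y _; rewrite NE.
Qed.

Lemma frame_liftE c x : frame_lift Phi g2 c x = base_N x *m c.
Proof. by rewrite /frame_lift /base_N -mulmxA mul_col_mx mul0mx. Qed.

Variables (alpha : C) (L : {vspace 'cV[C]_(n + n)}) (l : 'cV[C]_(n + n)).
Hypothesis a0 : alpha != 0.
Hypothesis a1 : alpha != 1.
Hypothesis aN1 : alpha != -1.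
Hypothesis rl : real_form alpha l.
Hypothesis ll : bil l l = 0.
Hypothesis hL : L = <[l]>%VS.

Local Notation mv x := (Phi_inv Phi alpha x *m l).
(** The vector [Phi alpha^-1 l] spanning the dressed line has the form
    [(w, alpha z)] with [w] and [z] real; [spec_q] is the real vector [(w, z)]. *)
Definition scale_inv : 'M[C]_(n + n) := block_mx 1%:M 0 0 (alpha^-1)%:M.
Definition scale_mx : 'M[C]_(n + n) := block_mx 1%:M 0 0 alpha%:M.
Definition spec_q x : 'cV[R]_(n + n) := reM (scale_inv *m mv x).
Local Notation q := spec_q.

Lemma scale_mxK : scale_mx *m scale_inv = 1%:M.
Proof.
rewrite mulmx_block !(mul0mx, mulmx0, mulmx1, addr0, add0r).
by rewrite -scalar_mxM divff // -scalar_mx_block.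
Qed.

Let scale_conj (A B D F : 'M[C]_n) :
  scale_inv *m block_mx A (alpha *: B) (alpha *: - D) F *m scale_mx =
  block_mx A (alpha ^+ 2 *: B) (- D) F.
Proof.
rewrite mulmx_block !mul1mx !mul0mx !addr0 !add0r mulmx_block.
rewrite !mulmx1 !mulmx0 !addr0 !add0r !mul_mx_scalar !mul_scalar_mx !scalerA.
by congr block_mx; rewrite ?mulVf ?divff ?scale1r // -expr2.
Qed.

(** For admissible [alpha] the square is real: [kap] is [alpha ^+ 2]. *)
Definition kap : R := complex.Re (alpha ^+ 2).

Lemma kapE : kap%:C%C = alpha ^+ 2.
Proof.
rewrite /kap; case: rl => [[h _]|[h _]]; move: h; case: alpha => a b /= ->;
  rewrite !expr2; apply/eqP; rewrite eq_complex /= ?mulr0 ?mul0r ?addr0 ?subr0 ?eqxx //;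
  by rewrite !mul0r addr0.
Qed.

Lemma kap_neq0 : kap != 0.
Proof. by rewrite -(inj_eq (@complexI R)) kapE rmorph0 expf_neq0. Qed.

Lemma kap_neq1 : 1 - kap != 0.
Proof.
by rewrite subr_eq0 eq_sym -(inj_eq (@complexI R)) kapE rmorph1 sqrf_eq1 negb_or a1.
Qed.

Lemma kap_gt0 : complex.Im alpha = 0 -> 0 < kap.
Proof.
move=> h; rewrite lt_neqAle eq_sym kap_neq0 /= /kap; move: h.
by case: alpha => a b /= ->; rewrite mulr0 subr0 -expr2 sqr_ge0.
Qed.

Lemma kap_lt0 : complex.Re alpha = 0 -> kap < 0.
Proof.
move=> h; rewrite lt_neqAle kap_neq0 /= /kap; move: h.
by case: alpha => a b /= ->; rewrite mulr0 sub0r -expr2 oppr_le0 sqr_ge0.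
Qed.

Let conjM p q' r (A : 'M[C]_(p, q')) (B : 'M[C]_(q', r)) :
  map_mx conjc (A *m B) = map_mx conjc A *m map_mx conjc B.
Proof. exact: map_mxM. Qed.

Let conjI m : map_mx conjc (lorentz C m) = lorentz C m.
Proof. by rewrite -toC_lorentz conj_toC. Qed.

Let conj_block (A : C) : map_mx conjc (block_mx 1%:M 0 0 A%:M : 'M[C]_(n + n)) =
  block_mx 1%:M 0 0 (conjc A)%:M.
Proof. by rewrite map_block_mx map_mx1 !map_mx0 map_scalar_mx. Qed.

Let rhoE : rho C n = block_mx 1%:M 0 0 (-1)%:M.
Proof. by rewrite /rho; congr block_mx; rewrite raddfN. Qed.

Let rho_rho : rho C n *m rho C n = 1%:M.
Proof.
rewrite /rho mulmx_block !(mul0mx, mulmx0, mulmx1, mul1mx, addr0, add0r).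
by rewrite mulmxN mulmx1 opprK -scalar_mx_block.
Qed.

Let tr_rho : (rho C n)^T = rho C n.
Proof. by rewrite /rho tr_block_mx !trmx0 linearN /= trmx1. Qed.

Let rhoI : rho C n *m IC = IC *m rho C n.
Proof.
rewrite /rho lorentz_block !mulmx_block.
rewrite !(mul0mx, mulmx0, mulmx1, mul1mx, addr0, add0r).
by congr block_mx; rewrite mulmxN mulNmx mulmx1 mul1mx.
Qed.

Let conj_inv (S I P : 'M[C]_(n + n)) : S^T = S -> S *m S = 1%:M ->
  S *m I = I *m S -> S *m (I *m (S *m P *m S)^T *m I) *m S = I *m P^T *m I.
Proof.
move=> ST SS SI; rewrite !trmx_mul ST !mulmxA SI -(mulmxA I S S) SS mulmx1.
by rewrite -(mulmxA _ S I) SI -!mulmxA SS mulmx1.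
Qed.

(** Reality of [spec_q], from the reality conditions on [Phi] and [l]: for
    imaginary [alpha] conjugation acts on all the data as [rho]. *)
Lemma spec_qE x : toC (q x) = scale_inv *m mv x.
Proof.
apply: toC_reM; case: hPhi => _ _ _ cP rP.
have cI : map_mx conjc (Phi_inv Phi alpha x) = Phi_inv Phi (conjc alpha) x.
  by rewrite /Phi_inv 2!conjM conjI -map_trmx cP.
rewrite 2!conjM cI.
case: rl => [[h [w [z lE]]]|[h [w [z lE]]]].
  have ca : conjc alpha = alpha by move: h; case: alpha => a b /= ->; rewrite oppr0.
  by rewrite /scale_inv conj_block conjc_inv ca lE conj_toC.
have ca : conjc alpha = - alpha.
  by move: h; case: alpha => a b /= ->; rewrite /GRing.opp /= oppr0.
have cl : map_mx conjc l = rho C n *m l.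
  rewrite lE rho_mul_col map_col_mx conj_toC; congr col_mx.
  apply/matrixP => i j; rewrite !mxE; apply/eqP; rewrite eq_complex /=.
  by apply/andP; split; apply/eqP; ring.
have cT : map_mx conjc scale_inv = scale_inv *m rho C n.
  rewrite /scale_inv conj_block conjc_inv ca rhoE mulmx_block.
  rewrite !(mul0mx, mulmx0, mulmx1, addr0, add0r) -scalar_mxM.
  by rewrite invrN mulrN1.
have rI : invmx (rho C n) = rho C n.
  have [_ rU] := mulmx1_unit rho_rho.
  by rewrite -[RHS]mulmx1 -(mulmxV rU) mulmxA rho_rho mul1mx.
have rPr : rho C n *m Phi_inv Phi (- alpha) x *m rho C n = Phi_inv Phi alpha x.
  by rewrite /Phi_inv -rP rI; exact: conj_inv tr_rho rho_rho rhoI.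
rewrite cT cl ca -rPr; move: (rho C n) (Phi_inv _ _ _) => S Y.
by rewrite !mulmxA.
Qed.

Lemma mvE x : mv x = scale_mx *m toC (q x).
Proof. by rewrite spec_qE mulmxA scale_mxK mul1mx. Qed.

Definition spec_w x : 'cV[R]_n := usubmx (q x).
Definition spec_z x : 'cV[R]_n := dsubmx (q x).

Lemma mv_col x : mv x = col_mx (toC (spec_w x)) (alpha *: toC (spec_z x)).
Proof.
rewrite mvE -[q x]vsubmxK toC_col mul_block_col.
by rewrite mul1mx !mul0mx addr0 add0r mul_scalar_mx.
Qed.

Lemma mv_null x : bil (mv x) (mv x) = 0.
Proof.
rewrite bil_mulmx.
have -> : (Phi_inv Phi alpha x)^T *m IC *m Phi_inv Phi alpha x = IC.
  have PV := mulmx1C (Phi_invl hPhi alpha x).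
  have PT : (Phi_inv Phi alpha x)^T *m IC = IC *m Phi alpha x.
    rewrite /Phi_inv !trmx_mul tr_lorentz trmxK -!mulmxA mul_lorentz.
    by rewrite mulmx1.
  by rewrite PT -mulmxA PV mulmx1.
by rewrite -[RHS]ll /bil.
Qed.

Lemma mv_real_form x (k : R) : real_form alpha (k%:C%C *: mv x).
Proof.
rewrite mv_col scale_col_mx -toCZ scalerA.
case: rl => [[ha _]|[ha _]].
  left; split=> //; exists (k *: spec_w x), ((k * complex.Re alpha) *: spec_z x).
  rewrite toC_col toCZ (toCZ (k * _)) rmorphM; congr (col_mx _ (_ * _ *: _)).
  by move: ha; case: (alpha) => a b /= ->.
right; split=> //; exists (k *: spec_w x), ((k * complex.Im alpha) *: spec_z x).
congr col_mx; rewrite (toCZ (k * _)) scalerA; congr (_ *: _).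
move: ha; case: (alpha) => a b /= ->; apply/eqP; rewrite eq_complex /=.
by apply/andP; split; apply/eqP; ring.
Qed.

(** That the dressed line is null, in terms of [q = (w, z)]. *)
Lemma spec_constraint x :
  ((spec_w x)^T *m spec_w x) 0 0 + kap * bil (spec_z x) (spec_z x) = 0.
Proof.
have := mv_null x.
rewrite mv_col bil_col_mx bilZl bilZr mulrA -expr2 -kapE bil_toC.
rewrite -toC_tr -toCM toCE -rmorphM -rmorphD => E.
by apply: (@complexI R); rewrite /= E.
Qed.

Lemma smooth_spec_q : smooth_on setT q.
Proof.
have [s0 _ _ _ _] := hPhi.
by have [] := smooth_onC_mull openT scale_inv (smooth_onC_mulr openT l
  (smooth_onC_mulr openT IC (smooth_onC_mull openT IC
    (smooth_onC_tr openT (s0 alpha))))).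
Qed.

Lemma spec_q_derive x i : is_derive x (evec R i) q
  (- ((block_mx 0 (kap *: (delta_mx i i *m J)) (- delta_mx i i) 0
       + lie (amx R i) (Xi x)) *m q x)).
Proof.
have [+ _] := is_deriveC_mull scale_inv
  (is_deriveC_mulr l (Phi_inv_derive hXi hPhi alpha x i)).
set A := block_mx _ _ _ _ + _.
suff -> : scale_inv *m (- ((alpha *: toC (amx R i) + toC (lie (amx R i) (Xi x)))
    *m Phi_inv Phi alpha x) *m l) = toC (- (A *m q x)) by rewrite toCK.
rewrite mulNmx mulmxN toCN toCM; congr (- _).
rewrite -mulmxA mvE !mulmxA; congr (_ *m _); rewrite /A.
have [eta ->] := hXi x; have [P [S ->]] := lie_pmx_block i eta.
rewrite amxE add_block_mx !toC_block !(addr0, add0r) !toC0.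
rewrite scale_block_mx add_block_mx !(scaler0, addr0, add0r).
rewrite toCZ kapE toCN; exact: scale_conj.
Qed.

(** The vector field [Q] in whose orthogonal complement the dressing reflects,
    and the coefficients of its derivatives [d_i Q = mu_i e_i]. *)
Definition spec_Q x : 'cV[R]_(n + n) := reM (Phi 1 x) *m q x.
Definition spec_mu x : 'cV[R]_n := (1 - kap) *: (J *m spec_z x).
Local Notation Q := spec_Q.

Lemma smooth_spec_Q : smooth_on setT Q.
Proof.
by apply: (smooth_on_mulmx openT); [exact: P1smooth|exact: smooth_spec_q].
Qed.

(** The two frames [Phi 1] and [Phi alpha] have the same connection term, which
    cancels; the remaining difference [amx i] is one-dimensional. *)
Lemma spec_Q_derive x i : is_derive x (evec R i) Q
  (spec_mu x i 0 *: col i (base_e x)).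
Proof.
apply: is_derive_eq (is_derive_mulmx (P1derive x i) (spec_q_derive x i)) _.
rewrite mulmxN -[X in X - _]mulmxA -mulmxBr -mulmxBl opprD addrACA subrr addr0.
rewrite amxE opp_block_mx add_block_mx !(oppr0, opprK, addr0, addNr).
rewrite -[q x]vsubmxK mul_block_col !(mul0mx, addr0, add0r).
rewrite colE /base_e -mulmxA [RHS]scalemxAr; congr (_ *m _).
rewrite mul_col_mx mul1mx mul0mx scale_col_mx scaler0; congr col_mx.
rewrite -{1}[delta_mx i i *m J]scale1r -scalerBl -scalemxAl -mulmxA.
have := mulmx_delta_cv 1%:M (spec_mu x) i; rewrite mul1mx colE mul1mx => <-.
by rewrite /spec_mu scalemxAr.
Qed.

Lemma bil_Q x (y : 'cV[R]_(n + n)) : bil (Q x) (reM (Phi 1 x) *m y) = bil (q x) y.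
Proof. by rewrite /bil /spec_Q gram. Qed.

Lemma bil_QQ x : bil (Q x) (Q x) = (1 - kap) * bil (spec_z x) (spec_z x).
Proof.
rewrite bil_Q -[q x]vsubmxK bil_col_mx.
have := spec_constraint x; rewrite -/(spec_w x) -/(spec_z x) => h.
by rewrite mulrBl mul1r; lra.
Qed.

Lemma Q_N x : (Q x)^T *m I2 *m base_N x = (spec_z x)^T *m J *m invmx (g2 x).
Proof.
rewrite gram -[q x]vsubmxK tr_col_mx lorentz_block mul_row_block mul_row_col.
by rewrite !(mul0mx, mulmx0, addr0, add0r).
Qed.

Lemma Q_e x : (base_e x)^T *m I2 *m Q x = spec_w x.
Proof.
rewrite gram -[q x]vsubmxK tr_col_mx lorentz_block mul_row_block mul_row_col.
by rewrite trmx1 trmx0 !(mul0mx, mulmx0, mul1mx, mulmx1, addr0, add0r).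
Qed.

(** The part of [Q] orthogonal to the curvature directions. *)
Lemma spec_Q_perp x : let Q' := Q x - base_e x *m ((base_e x)^T *m I2 *m Q x) in
  bil Q' Q' = bil (spec_z x) (spec_z x).
Proof.
rewrite /= Q_e; have -> : Q x - base_e x *m spec_w x =
    reM (Phi 1 x) *m col_mx 0 (spec_z x).
  rewrite /spec_Q /base_e -mulmxA -mulmxBr -[q x]vsubmxK mul_col_mx mul1mx mul0mx.
  congr (_ *m _); apply: etrans (f_equal (fun v => _ + v) (opp_col_mx _ _)) _.
  by rewrite add_col_mx subrr oppr0 addr0.
transitivity (bil (col_mx 0 (spec_z x) : 'cV[R]_(n + n)) (col_mx 0 (spec_z x))).
  by rewrite /bil gram.
by rewrite bil_col_mx mulmx0 mxE add0r.
Qed.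

Lemma bil_NQ x (c : 'cV[R]_n) : bil (base_N x *m c) (Q x) = bil (invmx (g2 x) *m c) (spec_z x).
Proof.
rewrite bilC /base_N -mulmxA bil_Q mul_col_mx mul0mx -[q x]vsubmxK bil_col_mx.
by rewrite mulmx0 mxE add0r bilC.
Qed.

Lemma spec_Kmu x : (base_K x)^T *m J *m spec_mu x =
  (1 - kap) *: ((Q x)^T *m I2 *m base_N x)^T.
Proof.
rewrite Q_N /spec_mu /base_K !trmx_mul tr_lorentz trmxK -scalemxAr.
congr (_ *: _); rewrite -!mulmxA; congr (_ *m _).
by rewrite (mulmxA J J) mul_lorentz mul1mx.
Qed.

Lemma spec_mumu x : bil (spec_mu x) (spec_mu x) = (1 - kap) * bil (Q x) (Q x).
Proof.
rewrite bil_QQ /spec_mu bilZl bilZr; congr (_ * (_ * _)).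
by rewrite bil_mulmx tr_lorentz mul_lorentz mul1mx /bil.
Qed.

Lemma Ltilde_line x : Ltilde Phi alpha L x = <[mv x]>%VS.
Proof. by rewrite /Ltilde hL mximg_line (invmx_Phi hPhi). Qed.

(** If [w] vanishes the dressed line is stable under [rho]. *)
Lemma spec_w_neq0 x :
  mximg (rho C n) (Ltilde Phi alpha L x) != Ltilde Phi alpha L x ->
  spec_w x != 0.
Proof.
apply: contra => /eqP w0; rewrite Ltilde_line mximg_line mv_col w0 toC0.
rewrite rho_mul_col; move: (alpha *: _) => y.
have -> : col_mx 0 (- y) = - (col_mx 0 y : 'cV_(n + n)).
  by apply/esym; apply: etrans (opp_col_mx _ _) _; rewrite oppr0.
apply/eqP/vspaceP => v; apply/vlineP/vlineP => -[k ->].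
  by exists (- k); rewrite scalerN scaleNr.
by exists (- k); rewrite scalerN scaleNr opprK.
Qed.

Variable x : E.
Hypothesis w0 : spec_w x != 0.
Local Notation W := (((spec_w x)^T *m spec_w x) 0 0).

Lemma spec_W_gt0 : 0 < W. Proof. exact: euclid_gt0. Qed.

Lemma spec_zz : bil (spec_z x) (spec_z x) = - W / kap.
Proof.
apply: (mulfI kap_neq0); rewrite mulrCA divff ?kap_neq0 // mulr1.
by apply/eqP; rewrite -addr_eq0 addrC spec_constraint.
Qed.

Lemma bil_QQ_neq0 : bil (Q x) (Q x) != 0.
Proof.
rewrite bil_QQ spec_zz !mulf_neq0 ?kap_neq1 ?invr_eq0 ?kap_neq0 //.
by rewrite oppr_eq0 gt_eqF // spec_W_gt0.
Qed.

Let WC : ((toC (spec_w x))^T *m toC (spec_w x)) 0 0 != 0.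
Proof.
rewrite -toC_tr -toCM toCE -(rmorph0 (real_complex R)) (inj_eq (@complexI R)).
by rewrite gt_eqF // spec_W_gt0.
Qed.

Let WzC : ((toC (spec_w x))^T *m toC (spec_w x)) 0 0
  + alpha ^+ 2 * bil (toC (spec_z x)) (toC (spec_z x)) = 0.
Proof.
rewrite -toC_tr -toCM toCE bil_toC -kapE -rmorphM -rmorphD spec_constraint.
by rewrite rmorph0.
Qed.

Let toC_q : col_mx (toC (spec_w x)) (toC (spec_z x)) = toC (q x).
Proof. by rewrite -toC_col vsubmxK. Qed.

Let toC_reflect (y : 'cV[R]_(n + n)) :
  Phi 1 x *m (toC y - (2 * bil (toC (q x)) (toC y) / bil (toC (q x)) (toC (q x)))
     *: toC (q x)) = toC (reflect_mx (Q x) (reM (Phi 1 x) *m y)).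
Proof.
have P1 : Phi 1 x = toC (reM (Phi 1 x)) by rewrite (Phi_real hPhi 1 x).
rewrite reflect_cv !bil_Q toCB toCZ P1 !toCM -P1 mulmxBr -scalemxAr !bil_toC.
congr (_ - _ *: _); first by rewrite -P1.
by rewrite !(rmorphM, fmorphV) /= rmorph_nat.
Qed.

(** Dressing is reflection in the orthogonal complement of [Q]. *)
Lemma dressingC_reflect (F : E -> 'cV[R]_(n + n)) c : F x = base_N x *m c ->
  dressingC Phi alpha L F x = toC (reflect_mx (Q x) (F x)).
Proof.
move=> FE; rewrite /dressingC FE /base_N -mulmxA.
set y := col_mx 0 (invmx (g2 x)) *m c.
have -> : invmx (Phi 1 x) *m toC (reM (Phi 1 x) *m y) = toC y.
  rewrite toCM (Phi_real hPhi 1 x) mulmxA mulVmx ?mul1mx //.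
  exact: (Phi_unit hPhi).
rewrite Ltilde_line mv_col.
have -> : toC y = col_mx 0 (toC (invmx (g2 x) *m c)).
  by rewrite /y mul_col_mx mul0mx toC_col toC0.
rewrite (simple_elt_lower a0 a1 aN1 WC WzC) toC_q.
have -> : col_mx 0 (toC (invmx (g2 x) *m c)) = toC y.
  by rewrite /y mul_col_mx mul0mx toC_col toC0.
exact: toC_reflect.
Qed.

Lemma etildeC_reflect i :
  etildeC Phi alpha L i x = toC (col i (reflect_mx (Q x) (base_e x))).
Proof.
rewrite /etildeC Ltilde_line mv_col col_reflect.
rewrite delta_lshift (simple_elt_upper a0 a1 aN1 WC WzC) toC_q.
have -> : col_mx (delta_mx i 0) 0 = toC (col_mx (delta_mx i 0) 0) :> 'cV[C]_(n + n).
  by rewrite toC_col toC_delta toC0.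
rewrite toC_reflect; congr (toC (reflect_mx _ _)).
by rewrite /base_e colE -mulmxA mul_col_mx mul1mx mul0mx.
Qed.

End DressingData.

(** * Pairs of submanifolds related by a reflection *)

(** First forms, second forms and normal spaces over an open set depend only on
    the values of the map there. *)
Section LocalProperties.
Variables (R : realType) (n : nat) (D : set 'cV[R]_n).
Variables (F G : 'cV[R]_n -> 'cV[R]_(n + n)).
Hypothesis oD : open D.
Hypothesis FG : forall x, D x -> F x = G x.
Implicit Types (TN : 'cV[R]_(n + n) -> set 'cV[R]_(n + n)).

Lemma derive_on_eq x X : D x -> 'D_X F x = 'D_X G x.
Proof. by move=> Dx; exact: (derive_near _ oD Dx FG). Qed.

Lemma immersive_on_eq : immersive_on D F -> immersive_on D G.
Proof. by move=> h x Dx X; rewrite -derive_on_eq //; exact: h. Qed.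

Lemma first_form_eq x : D x -> first_form F x = first_form G x.
Proof.
by move=> Dx; apply/matrixP => i j; rewrite [LHS]mxE [RHS]mxE !derive_on_eq.
Qed.

Lemma second_form_eq x xi : D x -> second_form F x xi = second_form G x xi.
Proof.
move=> Dx; apply/matrixP => i j; rewrite [LHS]mxE [RHS]mxE.
apply: (f_equal (fun v => bil v xi)).
by apply: (derive_near _ oD Dx) => y Dy; exact: derive_on_eq.
Qed.

Lemma normal_at_eq TN x xi : D x -> normal_at TN F x xi -> normal_at TN G x xi.
Proof.
move=> Dx [h1 h2]; split; first by rewrite -FG.
by move=> X; rewrite -derive_on_eq.
Qed.

End LocalProperties.

Section LocalRibaucour.
Variables (R : realType) (n : nat) (D : set 'cV[R]_n).
Variables (F G : 'cV[R]_n -> 'cV[R]_(n + n)).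
Hypothesis oD : open D.
Hypothesis FG : forall x, D x -> F x = G x.
Implicit Types (TN : 'cV[R]_(n + n) -> set 'cV[R]_(n + n)).

Let GF x : D x -> G x = F x. Proof. by move=> Dx; rewrite FG. Qed.

Lemma principal_at_eq TN x X : D x ->
  principal_at TN F x X -> principal_at TN G x X.
Proof.
move=> Dx [X0 h]; split; first exact: X0.
move=> xi /(normal_at_eq oD GF Dx) /h [kappa E].
exists kappa; rewrite -E /shape_op (first_form_eq oD FG Dx).
by rewrite (second_form_eq oD FG xi Dx).
Qed.

Lemma flat_normal_bundle_eq TN :
  flat_normal_bundle TN D F -> flat_normal_bundle TN D G.
Proof.
move=> h x xi0 Dx /(normal_at_eq oD GF Dx) /(h _ _ Dx) [xi xi_x hxi].
exists xi; first exact: xi_x.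
apply: filterS2 (open_nbhs_nbhs (conj oD Dx)) hxi.
move=> y Dy [d1 d2 d3]; split; [exact: d1|exact: (normal_at_eq oD FG Dy)|].
by move=> X nu /(normal_at_eq oD GF Dy); exact: d3.
Qed.

Lemma tangent_to_eq C x : D x -> tangent_to C F x -> tangent_to C G x.
Proof.
move=> Dx [h1 h2]; split; first by rewrite -FG.
rewrite -FG // -h2; apply/seteqP; split=> v /= [X ->]; exists X;
  by rewrite (derive_on_eq oD FG).
Qed.

Lemma ribaucour_eq TN isC (S : set 'cV[R]_(n + n)) H :
  ribaucour TN isC S D H F -> ribaucour TN isC S D H G.
Proof.
move=> [[iH [sF iF]] [nH nF] cong curv]; split.
- split; first exact: iH.
  by split; [exact: smooth_on_eq FG sF|exact: immersive_on_eq iF].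
- by split; [exact: nH|exact: flat_normal_bundle_eq].
- move=> x Dx; have [C [h1 h2 h3 h4]] := cong x Dx; exists C.
  by split; [exact: h1|exact: h2|exact: h3|exact: tangent_to_eq].
- by move=> x Dx X /(curv x Dx X); exact: principal_at_eq.
Qed.

End LocalRibaucour.

(** If [yt - y] is a multiple of [Q], then [Q] projected along [yt] to the
    orthogonal complement of [t0] is a multiple of the difference of the
    normalised vectors. *)
Lemma normalized_difference (R : fieldType) m (t0 y yt Q : 'cV[R]_m) b :
  b != 0 -> bil y t0 != 0 -> bil yt t0 != 0 -> yt = y + b *: Q ->
  Q + bil t0 Q *: (- (bil yt t0)^-1 *: yt) =
  (- bil y t0 / b) *: (- (bil yt t0)^-1 *: yt - - (bil y t0)^-1 *: y).
Proof.
move=> b0 a0 at0 ytE.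
have E : bil t0 Q = (bil yt t0 - bil y t0) / b.
  by rewrite [in RHS]ytE bilDl bilZl (bilC t0) addrC addKr mulrC mulKf.
have QE : Q = b^-1 *: (yt - y) by rewrite ytE addrC addKr scalerA mulVf // scale1r.
rewrite E [X in X + _]QE.
move: a0 at0; move: (bil y t0) (bil yt t0) => a at_ a0 at0.
by apply/colP => i; rewrite !mxE; field; rewrite a0 at0 b0.
Qed.

(** Consequently the projected curvature directions of the two maps differ by
    multiples of the difference of the normalised vectors. *)
Lemma spherical_frame_shift (R : realFieldType) m p (t0 phi phit Q : 'cV[R]_m)
    (e : 'M[R]_(m, p)) (w : 'rV[R]_p) B :
  Q + bil t0 Q *: phit = B *: (phit - phi) ->
  e + Q *m w + phit *m (t0^T *m lorentz R m *m (e + Q *m w)) =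
  e + phi *m (t0^T *m lorentz R m *m e)
    + (phit - phi) *m (B *: w + t0^T *m lorentz R m *m e).
Proof.
move=> hB; rewrite !mulmxDr (mulmxA _ Q) mx11_bil mul_scalar_mx.
rewrite -(scalemxAr B) (scalemxAl B) -hB (mulmxDl Q) -scalemxAl -scalemxAr.
rewrite mulmxBl; move: (t0^T *m _ *m e) => T.
move: (Q *m w) (_ *: (phit *m w)) (phit *m T) (phi *m T) => a1 a2 a3 a4.
by apply/matrixP => i j; rewrite !mxE; ring.
Qed.

Lemma bil_difference (R : realFieldType) m (p p' : 'cV[R]_m) :
  bil p p = 1 -> bil p' p' = 1 -> bil p (p' - p) = - (bil (p' - p) (p' - p) / 2).
Proof. by move=> h1 h2; rewrite !(bilBl, bilBr) h1 h2 (bilC p'); field. Qed.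

(** A map [N c] into the light cone and its reflection in the orthogonal
    complements of the [Q x], both with nonvanishing [K c]. *)
Section RibaucourPairs.
Variables (R : realType) (n : nat) (D : set 'cV[R]_n).
Variables (e N : 'cV[R]_n -> 'M[R]_(n + n, n)) (K : 'cV[R]_n -> 'M[R]_n).
Variables (Q : 'cV[R]_n -> 'cV[R]_(n + n)) (Kt : 'cV[R]_n -> 'M[R]_n).
Variable c : 'cV[R]_n.
Local Notation I2 := (lorentz R (n + n)).
Local Notation F := (fun x => N x *m c).
Local Notation h := (fun x => K x *m c).
Local Notation et := (fun x => reflect_mx (Q x) (e x)).
Local Notation Nt := (fun x => reflect_mx (Q x) (N x)).
Local Notation Ft := (fun x => Nt x *m c).
Local Notation ht := (fun x => Kt x *m c).
Hypothesis oD : open D.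
Hypothesis hf : parallel_frame D e N K.
Hypothesis hft : parallel_frame D et Nt Kt.
Hypothesis q0 : forall x, D x -> bil (Q x) (Q x) != 0.
Hypothesis cc : bil c c = 0.
Hypothesis h0 : forall x i, D x -> h x i 0 != 0.
Hypothesis ht0 : forall x i, D x -> ht x i 0 != 0.

Let ee x : D x -> (e x)^T *m I2 *m e x = 1%:M.
Proof. by case: (hf) => _ _ alg _ /alg[]. Qed.

Let dF x i : D x -> is_derive x (evec R i) F (h x i 0 *: col i (e x)).
Proof. by move=> Dx; exact: (frame_derive hf c i Dx). Qed.

Let dFt x i : D x -> is_derive x (evec R i) Ft (ht x i 0 *: col i (et x)).
Proof. by move=> Dx; exact: (frame_derive hft c i Dx). Qed.

Lemma FtE x : Ft x = F x + (- (2 * bil (F x) (Q x) / bil (Q x) (Q x))) *: Q x.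
Proof. by cbv beta; rewrite reflect_mulmx reflect_cv scaleNr (bilC (Q x)). Qed.

Lemma etE x : et x =
  e x + Q x *m (- (2 / bil (Q x) (Q x)) *: ((Q x)^T *m I2 *m e x)).
Proof. by cbv beta; rewrite /reflect_mx scaleNr mulmxN -scalemxAr. Qed.

Let coef_neq0 x : D x -> bil (F x) (Q x) != 0 ->
  - (2 * bil (F x) (Q x) / bil (Q x) (Q x)) != 0.
Proof.
move=> Dx s0; rewrite oppr_eq0; apply: mulf_neq0.
  by apply: mulf_neq0 s0; rewrite pnatr_eq0.
by rewrite invr_eq0 q0.
Qed.

Let FF x : D x -> bil (F x) (F x) = 0.
Proof. by move=> Dx; rewrite (frame_NN hf). Qed.

(** The ambient quadric spanned by the curvature directions of [N c] and by
    [Q] is tangent to [N c] and to its reflection. *)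
Lemma lightcone_quadric x Q' : D x -> bil (F x) (Q x) != 0 ->
  Q' = Q x - e x *m ((e x)^T *m I2 *m Q x) -> bil Q' Q' != 0 ->
  let C := quadric_at (e x) (Q x) (F x) Q' in
  [/\ carrier C `<=` @lightcone R (n + n), tangent_to C F x & tangent_to C Ft x].
Proof.
move=> Dx s0 Q'E k0 C.
have eF i : bil (col i (e x)) (F x) = 0 by exact: (frame_eN hf).
have eeX := ee Dx.
have qx := q0 Dx.
split.
- move=> y /(carrier_quadric eeX eF Q'E k0) [_ yE].
  by rewrite /lightcone /= yE FF.
- split; first exact: (carrier_base (F x) Q'E k0).
  rewrite (range_derive (frame_smooth oD hf c) dF h0 Dx).
  by rewrite (tan_quadric_base eeX s0 Q'E k0).
have [||h1 h2] := tan_quadric_shift eeX eF s0 Q'E k0 (coef_neq0 Dx s0) (FtE x) _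
  (etE x) _.
- by cbv beta; rewrite reflect_mulmx reflect_bil.
- by move=> i; cbv beta; rewrite col_reflect reflect_mulmx reflect_bil.
split; first exact: h1.
by rewrite (range_derive (frame_smooth oD hft c) dFt ht0 Dx) h2.
Qed.

Lemma lightcone_ribaucour isC :
  (forall x, D x -> bil (F x) (Q x) != 0 /\ exists2 Q',
     Q' = Q x - e x *m ((e x)^T *m I2 *m Q x) &
     bil Q' Q' != 0 /\ isC (quadric_at (e x) (Q x) (F x) Q')) ->
  ribaucour (@tan_full R n) isC (@lightcone R (n + n)) D F Ft.
Proof.
move=> hC; split.
- split; split; [exact: (frame_smooth oD hf)| |exact: (frame_smooth oD hft)|].
    by apply/(frame_immersive oD hf).
  by apply/(frame_immersive oD hft).
- by split; [exact: (frame_flat_normal_bundle oD hf h0)|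
             exact: (frame_flat_normal_bundle oD hft ht0)].
- move=> x Dx; have [s0 [Q' Q'E [k0 hQ]]] := hC x Dx.
  have [h1 h2 h3] := lightcone_quadric Dx s0 Q'E k0.
  by exists (quadric_at (e x) (Q x) (F x) Q').
- move=> x Dx X /(frame_principal oD hf h0 X Dx) hX.
  exact/(frame_principal oD hft ht0 X Dx).
Qed.

Variables (t0 : 'cV[R]_(n + n)) (f : 'cV[R]_n -> 'cV[R]_(n + n)).
Hypothesis tt : bil t0 t0 = -1.
Hypothesis c0 : c != 0.
Let phi x := height_factor N c t0 x *: F x.
Let phit x := height_factor Nt c t0 x *: Ft x.
Let ft x := phit x - t0.
Hypothesis fE : forall x, D x -> f x = phi x - t0.

Let phiE x : phi x = height_factor N c t0 x *: F x. Proof. by []. Qed.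
Let phitE x : phit x = height_factor Nt c t0 x *: Ft x. Proof. by []. Qed.
Let ftE x : D x -> ft x = phit x - t0. Proof. by []. Qed.

Hypothesis s0 : forall x, D x -> bil (F x) (Q x) != 0.

Let Q_phi x : D x -> exists B, Q x + bil t0 (Q x) *: phit x = B *: (phit x - phi x).
Proof.
move=> Dx; set b := - (2 * bil (F x) (Q x) / bil (Q x) (Q x)).
have b0 : b != 0 by exact: coef_neq0 (s0 Dx).
have FtQ : Ft x = F x + b *: Q x by exact: FtE.
exists (- bil (F x) t0 / b); apply: normalized_difference => //.
- exact: frame_height_neq0 hf c0 cc tt x Dx.
- exact: frame_height_neq0 hft c0 cc tt x Dx.
Qed.

Let ft_neq_f x : D x -> ft x != f x.
Proof.
move=> Dx; apply/eqP => E.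
have pp : phit x - phi x = 0.
  by have := E; rewrite fE // /ft => /addIr ->; rewrite subrr.
have [B] := Q_phi Dx; rewrite pp scaler0 => /eqP; rewrite addr_eq0 => /eqP QE.
have /eqP := q0 Dx; apply.
by rewrite QE bilNl bilNr opprK bilZl bilZr (lift_null hft cc phitE Dx) !mulr0.
Qed.

Let spherical_shift x : D x -> exists w : 'rV[R]_n,
  spherical_frame et t0 phit x = spherical_frame e t0 phi x + (ft x - f x) *m w.
Proof.
move=> Dx; have [B hB] := Q_phi Dx.
set w0 := - (2 / bil (Q x) (Q x)) *: ((Q x)^T *m I2 *m e x).
exists (B *: w0 + t0^T *m I2 *m e x).
have -> : ft x - f x = phit x - phi x.
  by rewrite fE // /ft opprB addrA subrK.
by rewrite /spherical_frame etE; exact: spherical_frame_shift hB.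
Qed.

(** Ribaucour transforms of the light cone project to Ribaucour transforms of
    the sphere. *)
Lemma spherical_ribaucour :
  (forall x, D x -> ft x <> f x) /\ ribaucour_sphere t0 D f ft.
Proof.
have u1 := spherical_orthonormal hf cc phiE.
have u2 := spherical_orthonormal hft cc phitE.
split=> [x Dx|]; first by apply/eqP; exact: ft_neq_f.
split.
- split; first exact: (spherical_immersion oD hf c0 cc tt h0 phiE fE).
  exact: (spherical_immersion oD hft c0 cc tt ht0 phitE ftE).
- split; first exact: (spherical_flat_normal_bundle oD hf c0 cc tt h0 phiE fE).
  exact: (spherical_flat_normal_bundle oD hft c0 cc tt ht0 phitE ftE).
- move=> x Dx; set U := spherical_frame e t0 phi x.
  have uf i := spherical_frame_orth hf c0 cc tt phiE fE i Dx.
  have uft i := spherical_frame_orth hft c0 cc tt phitE ftE i Dx.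
  have [ft0 ff] := spherical_sphere hf c0 cc tt phiE fE Dx.
  have [ftt0 ftft] := spherical_sphere hft c0 cc tt phitE ftE Dx.
  pose Qh := ft x - f x.
  have Qt : bil t0 Qh = 0 by rewrite bilBr ![bil t0 _]bilC ft0 ftt0 subr0.
  have Q0 : Qh != 0 by rewrite subr_eq0; exact: ft_neq_f.
  have tt0 : bil t0 t0 < 0 by rewrite tt ltrN10.
  have QQ := timelike_orth tt0 Qt Q0.
  have sE : bil (f x) Qh = - (bil Qh Qh / 2) by exact: bil_difference.
  have s1 : bil (f x) Qh != 0 by rewrite sE oppr_eq0 gt_eqF // divr_gt0.
  (* All vectors below are orthogonal to the time-like [t0], so a nonzero one has
     positive norm. *)
  pose Q' := Qh - U *m (U^T *m I2 *m Qh).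
  have Ut a : bil t0 (U *m a) = 0.
    rewrite bilC mulmx_sum_colcv bil_suml big1 // => i _.
    by rewrite bilZl (spherical_frame_t0 hf c0 cc tt phiE) // mulr0.
  have Uf a : bil (U *m a) (f x) = 0.
    by rewrite mulmx_sum_colcv bil_suml big1 // => i _; rewrite bilZl uf mulr0.
  have Q't : bil t0 Q' = 0 by rewrite bilBr Qt Ut subr0.
  have Q'0 : Q' != 0.
    apply: contra s1 => /eqP Q'0.
    have : bil (f x) Q' = 0 by rewrite Q'0 bil0r.
    by rewrite bilBr [bil _ (U *m _)]bilC Uf subr0 => ->.
  have kp := timelike_orth tt0 Q't Q'0.
  have k0 : bil Q' Q' != 0 by rewrite gt_eqF.
  exists (quadric_at U Qh (f x) Q').
  have ux := u1 x Dx.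
  split.
  + exact: (quadric_sphere ux uf s1 (erefl Q') k0).
  + move=> y /(carrier_quadric ux uf (erefl Q') k0) [/span_mxP [a [b yE]] yy].
    rewrite /sphere /= yy ff; split=> //.
    have -> : y = (U *m a + b *: Qh) + f x by rewrite -yE subrK.
    by rewrite !bilDl bilZl ft0 ![bil _ t0]bilC Ut Qt mulr0 !addr0.
  + split; first exact: (carrier_base (f x) (erefl Q') k0).
    rewrite (range_derive (spherical_smooth oD hf c0 cc tt phiE fE)
      (spherical_derive oD hf c0 cc tt phiE fE) (spherical_speed_neq0 hf c0 cc tt h0) Dx).
    by rewrite (tan_quadric_base ux s1 (erefl Q') k0).
  + have [w wE] := spherical_shift Dx.
    have [||h1 h2] := tan_quadric_shift (b := 1) (p' := ft x) ux uf s1 (erefl Q') k0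
      (oner_neq0 _) _ _ wE uft.
    * by rewrite scale1r /Qh addrC subrK.
    * by rewrite ff ftft.
    split; first exact: h1.
    rewrite (range_derive (spherical_smooth oD hft c0 cc tt phitE ftE)
      (spherical_derive oD hft c0 cc tt phitE ftE) (spherical_speed_neq0 hft c0 cc tt ht0) Dx).
    by rewrite h2.
- move=> x Dx X /(spherical_principal oD hf c0 cc tt h0 phiE fE X Dx) hX.
  exact/(spherical_principal oD hft c0 cc tt ht0 phitE ftE X Dx).
Qed.

End RibaucourPairs.

(** * The Ribaucour property of the dressing action *)

Lemma parallel_frame_sub (R : realType) n (D : set 'cV[R]_n) e N K :
  parallel_frame setT e N K -> parallel_frame D e N K.
Proof.
move=> [se sN alg dN]; split.
- by move=> s x _; exact: se.
- by move=> s x _; exact: sN.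
- by move=> x _; exact: alg.
- by move=> x i _; exact: dN.
Qed.

(** The columns of [e] are curvature directions of [N c]. *)
Lemma frame_curvature_direction (R : realType) n (D : set 'cV[R]_n) e N K c :
  open D -> parallel_frame D e N K ->
  (forall x i, D x -> (K x *m c) i 0 != 0) ->
  forall x i, D x -> exists X, 'D_X (fun y => N y *m c) x = col i (e x) /\
    principal_at (@tan_full R n) (fun y => N y *m c) x X.
Proof.
move=> oD hf h0 x i Dx; have hi := h0 x i Dx.
exists (((K x *m c) i 0)^-1 *: delta_mx i 0).
have dj j : (((K x *m c) i 0)^-1 *: delta_mx i 0 : 'cV[R]_n) j 0 =
    ((K x *m c) i 0)^-1 *+ (j == i).
  by rewrite mxE; rewrite [delta_mx _ _ _ _]mxE andbT mulr_natr.
split.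
  rewrite (derive_orthogonal (frame_smooth oD hf c)
    (fun y j => frame_derive hf c j) _ Dx).
  rewrite (bigD1 i) //= big1 => [|j ji].
    by rewrite dj eqxx mulr1n mulVf // scale1r addr0.
  by rewrite dj (negbTE ji) mulr0n mul0r scale0r.
apply/(frame_principal oD hf h0 _ Dx); split.
  apply/cV0Pn; exists i; rewrite dj eqxx mulr1n invr_eq0; exact: hi.
move=> j k; rewrite !dj.
by have [->|_] := eqVneq j i; have [->|_] := eqVneq k i; rewrite ?mulr0n ?eqxx.
Qed.

(** If the first form of [N c] is positive definite, [K c] does not vanish. *)
Lemma frame_metric_neq0 (R : realType) n (D : set 'cV[R]_n) e N K c :
  open D -> parallel_frame D e N K ->
  metric_on D (first_form (fun x => N x *m c)) ->
  forall x i, D x -> (K x *m c) i 0 != 0.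
Proof.
move=> oD hf [_ pos] x i Dx; apply/eqP => hi.
have ee y : D y -> (e y)^T *m lorentz R (n + n) *m e y = 1%:M.
  by case: (hf) => _ _ alg _ /alg[].
have E0 : delta_mx i 0 != 0 :> 'cV[R]_n.
  by apply/cV0Pn; exists i; rewrite mxE !eqxx oner_eq0.
have [_ /(_ _ E0)] := pos x Dx.
rewrite (first_form_orthogonal (frame_smooth oD hf c) ee
  (fun y j => frame_derive hf c j) Dx) -mulmxA.
have -> : diag_mx (\row_i0 ((K x *m c) i0 0 ^+ 2)) *m delta_mx i 0 = 0 :> 'cV[R]_n.
  apply/colP => j; rewrite diag_mx_mulcv [RHS]mxE [X in X * _]mxE.
  have [->|ji] := eqVneq j i; first by rewrite hi expr0n mul0r.
  by rewrite [delta_mx _ _ _ _]mxE (negbTE ji) mulr0.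
by rewrite mulmx0 mxE ltxx.
Qed.

Theorem theorem5p6 (R : realType) (n : nat)
  (t0 : 'cV[R]_(n + n)) (ht0 : bil t0 t0 = -1)
  (alpha : R[i]) (L : {vspace 'cV[R[i]]_(n + n)})
  (halpha1 : alpha != 1) (halphaN1 : alpha != -1)
  (hL : admissible alpha L)
  (Xi : 'cV[R]_n -> 'M[R]_(n + n)) (hXi : UK_solution Xi)
  (Phi : R[i] -> 'cV[R]_n -> 'M[R[i]]_(n + n))
  (hPhi : extended_flat_frame Xi Phi)
  (g1 g2 : 'cV[R]_n -> 'M[R]_n)
  (hg : forall x, Phi 0 x = toC (block_mx (g1 x) 0 0 (g2 x)))
  (c : 'cV[R]_n) (hc0 : c != 0) (hc : bil c c = 0)
  (D : set 'cV[R]_n) (hDopen : open D)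
  (F : 'cV[R]_n -> 'cV[R]_(n + n)) (hF : F = frame_lift Phi g2 c)
  (hFflat : flat_lift_on D F)
  (hdef : forall x, D x ->
     mximg (rho R[i] n) (Ltilde Phi alpha L x) != Ltilde Phi alpha L x)
  (Ft : 'cV[R]_n -> 'cV[R]_(n + n)) (hFt : Ft = dressing Phi alpha L F) :
  (forall x, D x ->
     toC (F x) = Phi 1 x *m toC (col_mx 0 (invmx (g2 x) *m c)) /\
     toC (Ft x) = dressingC Phi alpha L F x /\
     forall i, toC (edir Phi i x) = col (lshift n i) (Phi 1 x) /\
               toC (etilde Phi alpha L i x) = etildeC Phi alpha L i x)
  /\ (immersive_on D Ft ->
        (complex.Im alpha = 0 -> ribaucour_hyperbola_lightcone D F Ft) /\
        (complex.Re alpha = 0 -> (forall x, D x -> Ft x <> F x) ->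
           ribaucour_sphere_lightcone D F Ft))
  /\ (forall x, D x ->
        (exists y : 'cV[R[i]]_(n + n),
           [/\ lightcone y, real_form alpha y &
               toC (Ft x - F x) =
                 Phi 1 x *m (block_mx 1%:M 0 0 (alpha^-1)%:M *m y)]) /\
        forall i, parallel (etilde Phi alpha L i x - edir Phi i x) (Ft x - F x))
  /\ (forall x, D x -> forall i, exists X : 'cV[R]_n,
        'D_X F x = edir Phi i x /\ principal_at (@tan_full R n) F x X)
  /\ (immersive_on D Ft ->
        forall x, D x -> forall i, exists X : 'cV[R]_n,
          'D_X Ft x = etilde Phi alpha L i x /\
          principal_at (@tan_full R n) Ft x X)
  /\ (immersive_on D Ft -> forall f : 'cV[R]_n -> 'cV[R]_(n + n),
        conformally_flat_immersion t0 D f -> flat_lift_of t0 D F f ->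
        exists ft : 'cV[R]_n -> 'cV[R]_(n + n),
          [/\ conformally_flat_immersion t0 D ft, flat_lift_of t0 D Ft ft &
              complex.Im alpha = 0 \/ (forall x, D x -> Ft x <> F x) ->
              (forall x, D x -> ft x <> f x) /\ ribaucour_sphere t0 D f ft]).
Proof.
case: hL => a0 [l [rl l0 ll Ll]] _.
have hXi' x : exists eta, Xi x = pmx eta by case: hXi => _ /(_ x) [].
pose e := base_e Phi; pose N := base_N Phi g2; pose K := base_K g2.
have hf : parallel_frame D e N K.
  exact: parallel_frame_sub (base_frame hXi' hPhi hg).
have FE : F = (fun x => N x *m c).
  by rewrite hF; apply/funext => x; exact: frame_liftE.
have h0 : forall x i, D x -> (K x *m c) i 0 != 0.
  by apply: (frame_metric_neq0 hDopen hf); case: hFflat; rewrite FE => _ _ [].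
pose Q := spec_Q Phi alpha l; pose mu := spec_mu Phi alpha l.
pose kp := kap alpha; pose z := spec_z Phi alpha l.
have w0 x : D x -> spec_w Phi alpha l x != 0.
  by move=> Dx; apply: (spec_w_neq0 hPhi a0 rl Ll); exact: hdef.
have q0 x : D x -> bil (Q x) (Q x) != 0.
  by move=> Dx; exact: (bil_QQ_neq0 hPhi a0 halpha1 halphaN1 rl ll (w0 x Dx)).
(* The reflection of the frame of [F] in the orthogonal complements of [Q]. *)
pose Kt x := K x - (2 / bil (Q x) (Q x)) *:
  (mu x *m ((Q x)^T *m lorentz R (n + n) *m N x)).
have hft : parallel_frame D (fun x => reflect_mx (Q x) (e x))
    (fun x => reflect_mx (Q x) (N x)) Kt.
  apply: (reflected_frame (th := 1 - kp) hDopen hf) => //.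
  - move=> s x _; exact: (smooth_spec_Q hPhi).
  - move=> x i _; exact: (spec_Q_derive hXi' hPhi a0 rl).
  - move=> x _; exact: (spec_Kmu hPhi).
  - move=> x _; exact: (spec_mumu hPhi a0 rl ll).
pose G x := reflect_mx (Q x) (N x) *m c.
have dE x : D x -> dressingC Phi alpha L F x = toC (G x).
  move=> Dx; rewrite /G reflect_mulmx.
  have FEx : F x = base_N Phi g2 x *m c by rewrite FE.
  rewrite (dressingC_reflect hPhi a0 halpha1 halphaN1 rl ll Ll (w0 x Dx) FEx).
  by rewrite FE.
have GFt x : D x -> G x = Ft x by move=> Dx; rewrite hFt /dressing dE // toCK.
have FtG x : D x -> Ft x = G x by move=> Dx; rewrite GFt.
have P1 x : toC (reM (Phi 1 x)) = Phi 1 x by exact: (Phi_real hPhi 1 x).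
have colE1 x i : toC (col i (e x)) = col (lshift n i) (Phi 1 x).
  rewrite /e /base_e !colE -mulmxA mul_col_mx mul1mx mul0mx toCM P1 delta_lshift.
  by rewrite toC_col toC_delta toC0.
have edE x i : edir Phi i x = col i (e x) by rewrite /edir -colE1 toCK.
have etCE x i : D x -> etildeC Phi alpha L i x = toC (col i (reflect_mx (Q x) (e x))).
  by move=> Dx; exact: (etildeC_reflect hPhi a0 halpha1 halphaN1 rl ll Ll (w0 x Dx)).
have etE x i : D x -> etilde Phi alpha L i x = col i (reflect_mx (Q x) (e x)).
  by move=> Dx; rewrite /etilde etCE // toCK.
have immG : immersive_on D Ft -> forall x i, D x -> (Kt x *m c) i 0 != 0.
  move=> h; apply/(frame_immersive hDopen hft c).
  exact: immersive_on_eq hDopen FtG h.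
(* The sign of [(z, z)] is opposite to that of [alpha ^+ 2]; it decides the type
   of the quadric. *)
have zz x : D x -> bil (z x) (z x) =
    - (((spec_w Phi alpha l x)^T *m spec_w Phi alpha l x) 0 0) / kp.
  by move=> Dx; exact: (spec_zz hPhi a0 rl ll x).
have W0 x : D x -> 0 < ((spec_w Phi alpha l x)^T *m spec_w Phi alpha l x) 0 0.
  by move=> Dx; exact: euclid_gt0 (w0 x Dx).
have zneg x : D x -> complex.Im alpha = 0 -> bil (z x) (z x) < 0.
  move=> Dx ha; rewrite zz // mulNr oppr_lt0 divr_gt0 ?W0 //.
  exact: kap_gt0 a0 rl ha.
have zpos x : D x -> complex.Re alpha = 0 -> 0 < bil (z x) (z x).
  move=> Dx ha; rewrite zz // mulNr oppr_gt0 pmulr_rlt0 ?W0 // invr_lt0.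
  exact: kap_lt0 a0 rl ha.
have sE x : bil (N x *m c) (Q x) = bil (invmx (g2 x) *m c) (z x).
  exact: (bil_NQ hPhi).
(* [(F, Q) = (g2^-1 c, z)] does not vanish: for real [alpha] because [z] is
   time-like and [g2^-1 c] null, otherwise because the reflection moves [F]. *)
have s0 : complex.Im alpha = 0 \/ (forall x, D x -> Ft x <> F x) ->
    forall x, D x -> bil (N x *m c) (Q x) != 0.
  move=> [ha x Dx|ne x Dx].
    rewrite sE bilC; apply: timelike_null; first exact: zneg.
      by rewrite bil_mulmx (g2_inv_orth hPhi hg) -[RHS]hc.
    apply: contra hc0 => /eqP v0; rewrite -[c]mul1mx -(mul_lorentz R n).
    by rewrite -{2}(g2_inv_orth hPhi hg x) -!mulmxA v0 !mulmx0.
  apply/eqP => s; apply: (ne x Dx).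
  by rewrite FtG // FE /G reflect_mulmx reflect_cv bilC s mulr0 mul0r scale0r subr0.
have pairE x : D x -> exists b, Ft x - F x = b *: Q x /\
    forall i, exists g, etilde Phi alpha L i x - edir Phi i x = g *: Q x.
  move=> Dx; exists (- (2 * bil (Q x) (N x *m c) / bil (Q x) (Q x))); split.
    by rewrite FtG // FE /G reflect_mulmx reflect_cv addrC addKr scaleNr.
  move=> i; exists (- (2 * bil (Q x) (col i (e x)) / bil (Q x) (Q x))).
  by rewrite etE // edE col_reflect reflect_cv addrC addKr scaleNr.
split.
  move=> x Dx; split.
    rewrite FE /N /base_N -mulmxA mul_col_mx mul0mx toCM P1; by [].
  split; first by rewrite FtG // dE.
  move=> i; split; last by rewrite etE // etCE.
  by rewrite edE colE1.
have eeD x : D x -> (e x)^T *m lorentz R (n + n) *m e x = 1%:M.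
  by case: hf => _ _ alg _ /alg[].
split.
  move=> imm; have ht0' := immG imm.
  (* Either congruence follows from the type of the quadric spanned at [F x] by
     the [e_i] and [Q]. *)
  have rib isC : (forall x, D x -> bil (N x *m c) (Q x) != 0) ->
      (forall x, D x -> bil (z x) (z x) != 0) ->
      (forall x Q', D x ->
        Q' = Q x - e x *m ((e x)^T *m lorentz R (n + n) *m Q x) ->
        bil Q' Q' = bil (z x) (z x) ->
        isC (quadric_at (e x) (Q x) (N x *m c) Q')) ->
      ribaucour (@tan_full R n) isC (@lightcone R (n + n)) D F Ft.
    move=> hs hz hC; rewrite FE; apply: (ribaucour_eq hDopen GFt).
    apply: (lightcone_ribaucour hDopen hf hft q0 hc h0 ht0') => x Dx.
    have kE := spec_Q_perp hPhi alpha l x.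
    split; first exact: hs.
    exists (Q x - e x *m ((e x)^T *m lorentz R (n + n) *m Q x)); first by [].
    split; first by rewrite [X in X != 0]kE; exact: hz.
    exact: hC.
  split.
    move=> ha; apply: rib.
    - by apply: s0; left.
    - by move=> x Dx; rewrite lt_eqF // zneg.
    - move=> x Q' Dx Q'E kE.
      have eF i : bil (col i (e x)) (N x *m c) = 0 by exact: (frame_eN hf).
      have sx : bil (N x *m c) (Q x) != 0 by apply: s0 => //; left.
      by apply: (quadric_hyperbola (eeD x Dx) eF sx Q'E); rewrite kE ?lt_eqF // zneg.
  move=> ha ne; apply: rib.
  - by apply: s0; right.
  - by move=> x Dx; rewrite gt_eqF // zpos.
  - move=> x Q' Dx Q'E kE.
    have eF i : bil (col i (e x)) (N x *m c) = 0 by exact: (frame_eN hf).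
    have sx : bil (N x *m c) (Q x) != 0 by apply: s0 => //; right.
    by apply: (quadric_sphere (eeD x Dx) eF sx Q'E); rewrite kE ?gt_eqF // zpos.
split.
  move=> x Dx; have [b [bE gE]] := pairE x Dx; split.
    exists (b%:C%C *: (Phi_inv Phi alpha x *m l)); split.
    - by rewrite /lightcone /= bilZl bilZr (mv_null hPhi alpha ll) !mulr0.
    - exact: (mv_real_form hPhi a0 rl).
    - rewrite bE toCZ /Q /spec_Q toCM P1 (spec_qE hPhi rl).
      by rewrite /scale_inv !scalemxAr.
  move=> i; have [g gEi] := gE i; rewrite /parallel bE gEi.
  have [/eqP|bg] := eqVneq (b, g) (0, 0).
    rewrite xpair_eqE => /andP[/eqP -> /eqP ->]; exists 1, 1.
    by rewrite !scale0r; split=> //; rewrite xpair_eqE oner_eq0.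
  exists b, g; split; last by rewrite !scalerA mulrC.
  exact: bg.
split.
  move=> x Dx i; rewrite FE edE.
  exact: (frame_curvature_direction hDopen hf h0).
split.
  move=> imm x Dx i; have ht0' := immG imm.
  have [X [dX pX]] := frame_curvature_direction hDopen hft ht0' i Dx.
  exists X; rewrite etE // -dX; split.
    exact: (derive_on_eq hDopen FtG).
  exact: (principal_at_eq hDopen GFt).
move=> imm f [immf sf cff] [_ lif]; have ht0' := immG imm.
pose phi x := height_factor N c t0 x *: (N x *m c).
pose phit x := height_factor (fun x => reflect_mx (Q x) (N x)) c t0 x *: G x.
pose ft x := phit x - t0.
have fE x : D x -> f x = phi x - t0.
  move=> Dx; have [ft0 _] := sf x Dx.
  have /vlineP [k kE] := lif x Dx; rewrite FE in kE.
  (* [f + t0] is a multiple of [F] of height -1, hence the normalised lift. *)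
  have Ft0 := frame_height_neq0 hf hc0 hc ht0 Dx.
  have : bil (f x + t0) t0 = -1 by rewrite bilDl ft0 ht0 add0r.
  rewrite kE bilZl => kt.
  have -> : phi x = f x + t0; last by rewrite addrK.
  rewrite kE /phi /height_factor; congr (_ *: _).
  apply: (mulIf Ft0); rewrite kt mulNr mulVf //.
have phitE x : phit x = height_factor (fun x => reflect_mx (Q x) (N x)) c t0 x *:
    (reflect_mx (Q x) (N x) *m c) by [].
have ftE x : D x -> ft x = phit x - t0 by [].
exists ft; split.
- split.
  + exact: (spherical_immersion hDopen hft hc0 hc ht0 ht0' phitE ftE).
  + by move=> x Dx; exact: (spherical_sphere hft hc0 hc ht0 phitE ftE).
  + exact: (spherical_conformally_flat hDopen hft hc0 hc ht0 ht0' phitE ftE).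
- split; last first.
    move=> x Dx; rewrite /ft subrK FtG //; apply/vlineP.
    by exists (height_factor (fun x => reflect_mx (Q x) (N x)) c t0 x).
  split.
  + exact (smooth_on_eq hDopen GFt (frame_smooth hDopen hft c)).
  + move=> x Dx; rewrite FtG // /lightcone /=.
    by rewrite [LHS](frame_NN hft).
  + apply: (flat_metric_eq hDopen _ (frame_flat_metric hDopen hft ht0')) => x Dx.
    exact: (first_form_eq hDopen GFt).
- move=> /s0 hs.
  exact: (spherical_ribaucour hDopen hf hft q0 hc h0 ht0' ht0 hc0 fE hs).
Qed.
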